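(* Let $(A,B,C,D)\in\mathbf C^4$, $S=S_{(A,B,C,D)}$, and let $f\in\mathcal A$ be an algebraically stable hyperbolic element, with $v_+=\mathrm{Ind}(\bar f^{-1})$. Then there exist an element $N_f\in\mathrm{GL}(2,\mathbf Z)$ with positive entries which is conjugate to $M_f$ in $\mathrm{PGL}(2,\mathbf Z)$, a neighborhood $\mathcal U$ of $v_+$ in $\bar S$, and a holomorphic diffeomorphism $\Psi_f^+:\mathbb D\times\mathbb D\to\mathcal U$ with $\Psi_f^+(0,0)=v_+$ and $$\Psi_f^+\big((u,v)^{N_f}\big)=\bar f\big(\Psi_f^+(u,v)\big)\quad\text{for all }(u,v)\in\mathbb D\times\mathbb D.$$
   Context: For $(A,B,C,D)\in\mathbf C^4$, $S=S_{(A,B,C,D)}\subset\mathbf C^3$ is the affine cubic surface $x^2+y^2+z^2+xyz=Ax+By+Cz+D$ (character surfaces of the four-punctured sphere). $\mathcal A$ is the group of polynomial automorphisms of $S$ generated by the three involutions $s_x(x,y,z)=(A-yz-x,y,z)$, $s_y(x,y,z)=(x,B-xz-y,z)$, $s_z(x,y,z)=(x,y,C-xy-z)$; it is a free product of three copies of $\mathbf Z/2\mathbf Z$ and is identified with the subgroup $\Gamma_2^*\subset\mathrm{PGL}(2,\mathbf Z)$ of elements congruent to the identity mod 2, via $s_x\mapsto\begin{pmatrix}-1&-2\\0&1\end{pmatrix}$, $s_y\mapsto\begin{pmatrix}-1&0\\0&1\end{pmatrix}$, $s_z\mapsto\begin{pmatrix}1&0\\-2&-1\end{pmatrix}$. For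 $f\in\mathcal A$, $M_f\in\Gamma_2^*$ is the corresponding element; $f$ is hyperbolic if $M_f$ is hyperbolic, and $\lambda(f)>1$ is then the spectral radius of $M_f$. The closure $\bar S$ of $S$ in $\mathbb P^3(\mathbf C)$ (coordinates $[x:y:z:w]$) meets the plane at infinity $w=0$ in the triangle $\Delta=\{xyz=0,w=0\}$ with vertices $v_x=[1:0:0:0]$, $v_y=[0:1:0:0]$, $v_z=[0:0:1:0]$, and $\bar S$ is smooth near $\Delta$. Each $f\in\mathcal A$ extends to a birational map $\bar f$ of $\bar S$; $\mathrm{Ind}(\bar f)$ is its indeterminacy set. A hyperbolic $f\in\mathcal A$ is called algebraically stable if it is a cyclically reduced word in $s_x,s_y,s_z$ in which each involution appears at least once; then $\mathrm{Ind}(\bar f)=\{v_-\}$ and $\mathrm{Ind}(\bar f^{-1})=\{v_+\}$ are two distinct vertices of $\Delta$, $\bar f$ is holomorphic near $v_+$, and $\bar f^n$ contracts $\Delta\setminus\{v_-\}$ to $v_+$ for $n\ge1$. $\mathbb D$ is the unit disk. For $N=(n_{ij})\in\mathrm{GL}(2,\mathbf Z)$ the monomial map is $(u,v)^N=(u^{n_{11}}v^{n_{12}},u^{n_{21}}v^{n_{22}})$. *)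

(* Defs.v *)
From Stdlib Require Import Reals ZArith List.
Import ListNotations.
Open Scope R_scope.

Definition CC : Type := (R * R)%type.
Definition CR (r : R) : CC := (r, 0).
Definition C0 : CC := (0, 0).
Definition C1 : CC := (1, 0).
Definition Cadd (z w : CC) : CC := (fst z + fst w, snd z + snd w).
Definition Copp (z : CC) : CC := (- fst z, - snd z).
Definition Csub (z w : CC) : CC := Cadd z (Copp w).
Definition Cmul (z w : CC) : CC :=
  (fst z * fst w - snd z * snd w, fst z * snd w + snd z * fst w).
Definition Cconj (z : CC) : CC := (fst z, - snd z).
Definition Cnorm2 (z : CC) : R := fst z * fst z + snd z * snd z.
Definition Cabs (z : CC) : R := sqrt (Cnorm2 z).
Definition Cinv (z : CC) : CC := (fst z / Cnorm2 z, - snd z / Cnorm2 z).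
Definition Cdiv (z w : CC) : CC := Cmul z (Cinv w).
Fixpoint Cpow (z : CC) (n : nat) : CC :=
  match n with O => C1 | S k => Cmul z (Cpow z k) end.

Definition C2 : Type := (CC * CC)%type.
Definition C3 : Type := (CC * CC * CC)%type.
Definition n2 (h : C2) : R := Cabs (fst h) + Cabs (snd h).
Definition add2 (p h : C2) : C2 := (Cadd (fst p) (fst h), Cadd (snd p) (snd h)).
Definition n3 (h : C3) : R :=
  let '(a, b, c) := h in Cabs a + Cabs b + Cabs c.
Definition add3 (p h : C3) : C3 :=
  let '(a, b, c) := p in let '(a', b', c') := h in (Cadd a a', Cadd b b', Cadd c c').
Definition sub3 (p h : C3) : C3 :=
  let '(a, b, c) := p in let '(a', b', c') := h in (Csub a a', Csub b b', Csub c c').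

Definition open2 (O : C2 -> Prop) : Prop :=
  forall p, O p -> exists r, 0 < r /\ forall h, n2 h < r -> O (add2 p h).
Definition open3 (O : C3 -> Prop) : Prop :=
  forall p, O p -> exists r, 0 < r /\ forall h, n3 h < r -> O (add3 p h).

Definition holo2 (O : C2 -> Prop) (g : C2 -> CC) : Prop :=
  open2 O /\
  forall p, O p -> exists a b : CC, forall eps, 0 < eps -> exists del, 0 < del /\
    forall h, n2 h < del -> O (add2 p h) ->
      Cabs (Csub (Csub (g (add2 p h)) (g p))
                 (Cadd (Cmul a (fst h)) (Cmul b (snd h)))) <= eps * n2 h.
Definition holo3 (O : C3 -> Prop) (g : C3 -> CC) : Prop :=
  open3 O /\
  forall p, O p -> exists a b c : CC, forall eps, 0 < eps -> exists del, 0 < del /\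
    forall h, n3 h < del -> O (add3 p h) ->
      let '(h1, h2, h3) := h in
      Cabs (Csub (Csub (g (add3 p h)) (g p))
                 (Cadd (Cadd (Cmul a h1) (Cmul b h2)) (Cmul c h3))) <= eps * n3 h.

Definition ball3 (c : C3) (r : R) : C3 -> Prop := fun q => n3 (sub3 q c) < r.

Definition Disk (u : CC) : Prop := Cabs u < 1.
Definition Bidisk (p : C2) : Prop := Disk (fst p) /\ Disk (snd p).

(* ---------- P^3(CC): points given by nonzero representatives [x:y:z:w] ---------- *)
Definition C4 : Type := (CC * CC * CC * CC)%type.
Definition c4 (x y z w : CC) : C4 := (x, y, z, w).
Definition coord (i : nat) (q : C4) : CC :=
  let '(x, y, z, w) := q in
  match i with 0%nat => x | 1%nat => y | 2%nat => z | _ => w end.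
Definition zero4 : C4 := c4 C0 C0 C0 C0.
Definition peq (p q : C4) : Prop :=
  p <> zero4 /\ exists l : CC, l <> C0 /\
    forall i, (i < 4)%nat -> coord i q = Cmul l (coord i p).
Definition chart (i : nat) (q : C4) : C3 :=
  let '(x, y, z, w) := q in
  match i with
  | 0%nat => (Cdiv y x, Cdiv z x, Cdiv w x)
  | 1%nat => (Cdiv x y, Cdiv z y, Cdiv w y)
  | 2%nat => (Cdiv x z, Cdiv y z, Cdiv w z)
  | _ => (Cdiv x w, Cdiv y w, Cdiv z w)
  end.
(* Fubini-Study type distance on P^3 (1 - cos^2 of the Hermitian angle) *)
Definition herm (p q : C4) : CC :=
  let '(x, y, z, w) := p in let '(x', y', z', w') := q in
  Cadd (Cadd (Cadd (Cmul x (Cconj x')) (Cmul y (Cconj y')))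
             (Cmul z (Cconj z'))) (Cmul w (Cconj w')).
Definition pn2 (p : C4) : R :=
  let '(x, y, z, w) := p in Cnorm2 x + Cnorm2 y + Cnorm2 z + Cnorm2 w.
Definition pdist (p q : C4) : R := 1 - Cnorm2 (herm p q) / (pn2 p * pn2 q).

Definition holoP (O : C2 -> Prop) (Psi : C2 -> C4) : Prop :=
  open2 O /\ (forall p, O p -> Psi p <> zero4) /\
  forall i, (i < 4)%nat ->
    let Oi := fun p => O p /\ coord i (Psi p) <> C0 in
    open2 Oi /\
    forall j, (j < 4)%nat -> holo2 Oi (fun p => Cdiv (coord j (Psi p)) (coord i (Psi p))).

Section Surf.
Variables A B Cc D : CC.
Definition onS (p : C3) : Prop :=
  let '(x, y, z) := p in
  Cadd (Cadd (Cadd (Cmul x x) (Cmul y y)) (Cmul z z)) (Cmul x (Cmul y z)) =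
  Cadd (Cadd (Cadd (Cmul A x) (Cmul B y)) (Cmul Cc z)) D.
(* closure in P^3: homogenized equation *)
Definition onbarS (q : C4) : Prop :=
  let '(x, y, z, w) := q in
  q <> zero4 /\
  Cadd (Cmul w (Cadd (Cadd (Cmul x x) (Cmul y y)) (Cmul z z))) (Cmul x (Cmul y z)) =
  Cadd (Cmul (Cmul w w) (Cadd (Cadd (Cmul A x) (Cmul B y)) (Cmul Cc z)))
       (Cmul D (Cmul w (Cmul w w))).

Definition s_x (p : C3) : C3 := let '(x, y, z) := p in (Csub (Csub A (Cmul y z)) x, y, z).
Definition s_y (p : C3) : C3 := let '(x, y, z) := p in (x, Csub (Csub B (Cmul x z)) y, z).
Definition s_z (p : C3) : C3 := let '(x, y, z) := p in (x, y, Csub (Csub Cc (Cmul x y)) z).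
End Surf.

Inductive letter : Type := Lx | Ly | Lz.
Definition letter_eq_dec (a b : letter) : {a = b} + {a <> b}.
Proof. decide equality. Defined.

Definition s_of (A B Cc : CC) (a : letter) : C3 -> C3 :=
  match a with Lx => s_x A | Ly => s_y B | Lz => s_z Cc end.
Definition eval_word (A B Cc : CC) (w : list letter) : C3 -> C3 :=
  fold_right (fun a g => fun p => s_of A B Cc a (g p)) (fun p => p) w.

(* extension of the polynomial map g of S to \bar S:
   ext_val q p  <->  \bar g(q) = p, i.e. [g(q')] -> [p] as q' -> q, q' in S *)
Definition lift3 (p : C3) : C4 := let '(x, y, z) := p in c4 x y z C1.
Definition ext_val (A B Cc D : CC) (g : C3 -> C3) (q p : C4) : Prop :=
  onbarS A B Cc D q /\ p <> zero4 /\
  forall eps, 0 < eps -> exists del, 0 < del /\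
    forall p' : C3, onS A B Cc D p' -> pdist q (lift3 p') < del ->
      pdist p (lift3 (g p')) < eps.
Definition Ind (A B Cc D : CC) (g : C3 -> C3) (q : C4) : Prop :=
  onbarS A B Cc D q /\ ~ (exists p, ext_val A B Cc D g q p).

Definition Mat2 : Type := (Z * Z * Z * Z)%type.  (* (a, b, c, d) = [[a, b], [c, d]] *)
Definition mmul (M N : Mat2) : Mat2 :=
  let '(a, b, c, d) := M in let '(a', b', c', d') := N in
  (a * a' + b * c', a * b' + b * d', c * a' + d * c', c * b' + d * d')%Z.
Definition mscale (s : Z) (M : Mat2) : Mat2 :=
  let '(a, b, c, d) := M in (s * a, s * b, s * c, s * d)%Z.
Definition mdet (M : Mat2) : Z := let '(a, b, c, d) := M in (a * d - b * c)%Z.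
Definition mid : Mat2 := (1, 0, 0, 1)%Z.
Definition M_of (a : letter) : Mat2 :=
  match a with
  | Lx => (-1, -2, 0, 1)%Z
  | Ly => (-1, 0, 0, 1)%Z
  | Lz => (1, 0, -2, -1)%Z
  end.
Definition M_word (w : list letter) : Mat2 := fold_right (fun a M => mmul (M_of a) M) mid w.

Definition inGL2Z (M : Mat2) : Prop := mdet M = 1%Z \/ mdet M = (-1)%Z.
Definition positive_entries (M : Mat2) : Prop :=
  let '(a, b, c, d) := M in (0 < a /\ 0 < b /\ 0 < c /\ 0 < d)%Z.
Definition conj_PGL (N M : Mat2) : Prop :=
  exists P : Mat2, inGL2Z P /\ exists s : Z, (s = 1 \/ s = -1)%Z /\
    mmul P N = mscale s (mmul M P).
Definition hyperbolicM (M : Mat2) : Prop :=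
  let '(a, b, c, d) := M in
  exists l : R, 1 < Rabs l /\ (IZR a - l) * (IZR d - l) - IZR b * IZR c = 0.

Definition cyc_reduced (w : list letter) : Prop :=
  w <> [] /\
  (forall i, (S i < length w)%nat -> nth i w Lx <> nth (S i) w Lx) /\
  ((2 <= length w)%nat -> nth 0 w Lx <> nth (pred (length w)) w Lx).
Definition alg_stable (w : list letter) : Prop :=
  hyperbolicM (M_word w) /\ cyc_reduced w /\ In Lx w /\ In Ly w /\ In Lz w.

Definition monomial (N : Mat2) (p : C2) : C2 :=
  let '(a, b, c, d) := N in
  (Cmul (Cpow (fst p) (Z.to_nat a)) (Cpow (snd p) (Z.to_nat b)),
   Cmul (Cpow (fst p) (Z.to_nat c)) (Cpow (snd p) (Z.to_nat d))).

Definition biholo_onto (A B Cc D : CC) (Psi : C2 -> C4) (U : C4 -> Prop) : Prop :=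
  (forall q, U q -> onbarS A B Cc D q) /\
  (forall q, U q -> exists r, 0 < r /\
      forall q', onbarS A B Cc D q' -> pdist q q' < r -> U q') /\
  holoP Bidisk Psi /\
  (forall p, Bidisk p -> U (Psi p)) /\
  (forall p p', Bidisk p -> Bidisk p' -> peq (Psi p) (Psi p') -> p = p') /\
  exists Phi : C4 -> C2,
    (forall q, U q -> Bidisk (Phi q) /\ peq (Psi (Phi q)) q) /\
    (forall q, U q -> exists i, (i < 4)%nat /\ coord i q <> C0 /\
       exists r, 0 < r /\ exists G1 G2 : C3 -> CC,
         holo3 (ball3 (chart i q) r) G1 /\ holo3 (ball3 (chart i q) r) G2 /\
         forall q', U q' -> coord i q' <> C0 -> n3 (sub3 (chart i q') (chart i q)) < r ->
           Phi q' = (G1 (chart i q'), G2 (chart i q'))).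

(* Main.v *)
(** Parametrize the surface near the vertex [j] at infinity by the pair [(u_k, u_l)], where each affine
coordinate is written [x_k = -(u_k + 1/u_k)] with [|u_k| < 1]: the equation is quadratic in the remaining
coordinate [x_j], and choosing its large root gives a chart along the two edges of the triangle through
the vertex. The involution [s_i] keeps two of the three coordinates, so from the chart at [j] to the chart
at [i <> j] it is [(u_i, u_k) |-> (u_j, u_k)] with [u_j = u_i u_k (1 + O(u_i u_k))]. Hence a cyclically
reduced word acts in the chart of its first letter by [F(s) = s^N exp (L s)], with [N] a product of
nonnegative matrices and [L = O(uv)]. If all three letters occur, [N] is positive, so [uv] decreases
superexponentially along [F], and [h = sum_k N^{-k-1} L o F^k] converges near the axes of the bidisk; then
[Phi(s) = s exp (h s)] satisfies [Phi o F = Phi^N] and is the identity on the axes. The inverse of [Phi]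
conjugates [f] to the monomial map near the axes of the unit bidisk, and extends to the punctured bidisk by
[Psi(p) = f^{-k} (Psi(p^{N^k}))] because [f] is invertible on the affine surface. *)

From Stdlib Require Import Reals ZArith List Lra Lia ClassicalEpsilon.
Require Import Defs.
Import ListNotations.
Open Scope R_scope.

Declare Scope CC_scope.
Delimit Scope CC_scope with cc.
Bind Scope CC_scope with CC.
Infix "+" := Cadd : CC_scope.
Infix "-" := Csub : CC_scope.
Infix "*" := Cmul : CC_scope.
Infix "/" := Cdiv : CC_scope.
Notation "- z" := (Copp z) : CC_scope.
Notation "0" := C0 : CC_scope.
Notation "1" := C1 : CC_scope.
Notation "2" := (Cadd C1 C1) : CC_scope.
Notation "4" := (Cmul (Cadd C1 C1) (Cadd C1 C1)) : CC_scope.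
Arguments Cabs _%_cc.
Arguments Cadd _%_cc _%_cc.
Arguments Csub _%_cc _%_cc.
Arguments Cmul _%_cc _%_cc.
Arguments Cdiv _%_cc _%_cc.
Arguments Copp _%_cc.

(** A conjugacy on a small neighborhood of the vertex cannot be rescaled to the unit bidisk, because
    dilations do not commute with a monomial map, and the extension by [f^{-k}] says nothing on the
    axes, which [f] contracts to the vertex. Hence every estimate is made near the whole of both
    axes, over each radius [r < 1], in a neighborhood whose width may shrink as [r] tends to 1.
    Holomorphic means complex differentiable at every point, and neither integrals nor power series
    are used: limits and inverses of differentiable maps are controlled by Lipschitz bounds. These
    bounds concern multiplicative increments and carry the weight [|uv|]. They are stable under
    sums, products and composition, and the operator [g |-> N^{-1} (g o F)] halves their constant
    near the axes, because [F] shrinks [|uv|] more than [N^{-1}] and the increments cost. So the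
    series for [h] converges together with its Lipschitz constants, and differentiability passes
    from the partial sums to [h]. The inverse of [Phi] is Lipschitz as the fixed point of a
    contraction, and a Lipschitz right inverse of a differentiable map of the plane is
    differentiable. *)

Lemma Rabs_le_inv x a : Rabs x <= a -> - a <= x <= a.
Proof. unfold Rabs; destruct (Rcase_abs x); lra. Qed.

Tactic Notation "rmin" constr(a) constr(b) := pose proof (Rmin_l a b); pose proof (Rmin_r a b).

(** * Field structure and modulus of the complex numbers *)

Lemma CC_eq (z w : CC) : fst z = fst w -> snd z = snd w -> z = w.
Proof. destruct z, w; simpl; intros; subst; reflexivity. Qed.

Lemma CC_ring : ring_theory C0 C1 Cadd Cmul Csub Copp eq.
Proof.
  split; intros; try reflexivity;
    apply CC_eq; unfold C0, C1, Cadd, Cmul, Csub, Copp; simpl; ring.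
Qed.

Lemma Cnorm2_ge0 z : 0 <= Cnorm2 z.
Proof. unfold Cnorm2; nra. Qed.

Lemma Cnorm2_eq0 z : Cnorm2 z = 0 -> z = C0.
Proof.
  unfold Cnorm2; intro H; apply CC_eq; simpl; nra.
Qed.

Lemma Cnorm2_pos z : z <> C0 -> 0 < Cnorm2 z.
Proof.
  intro H; destruct (Cnorm2_ge0 z) as [h|h]; [exact h|].
  exfalso; apply H, Cnorm2_eq0; auto.
Qed.

Lemma C1_neq0 : C1 <> C0.
Proof. intro H; apply (f_equal fst) in H; simpl in H; lra. Qed.

Lemma CC_field : field_theory C0 C1 Cadd Cmul Csub Copp Cdiv Cinv eq.
Proof.
  split; [exact CC_ring | exact C1_neq0 | reflexivity |].
  intros z H; apply Cnorm2_pos in H.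
  apply CC_eq; unfold Cinv, Cmul, C1; simpl; unfold Cnorm2 in *; field; lra.
Qed.

Add Field CCfield : CC_field.

Lemma two_neq0 : (2 <> 0)%cc.
Proof. intro H; apply (f_equal fst) in H; simpl in H; lra. Qed.

Lemma Cmul_eq0 (z w : CC) : (z * w = 0)%cc -> z = C0 \/ w = C0.
Proof.
  intro H; destruct (excluded_middle_informative (z = C0)) as [|h]; [auto|right].
  replace w with (Cinv z * (z * w))%cc by (field; auto).
  rewrite H; ring.
Qed.

Lemma Cmul_neq0 (z w : CC) : z <> C0 -> w <> C0 -> (z * w)%cc <> C0.
Proof. intros h1 h2 H; apply Cmul_eq0 in H; tauto. Qed.

Lemma Cinv_neq0 z : z <> C0 -> Cinv z <> C0.
Proof.
  intros h H. apply C1_neq0. replace C1 with (Cinv z * z)%cc by (field; auto).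
  rewrite H; ring.
Qed.

Lemma Cdiv_neq0 (z w : CC) : z <> C0 -> w <> C0 -> (z / w)%cc <> C0.
Proof. intros; apply Cmul_neq0; auto using Cinv_neq0. Qed.

Lemma Csub_eq0 (z w : CC) : (z - w = 0)%cc -> z = w.
Proof. intro H; replace z with ((z - w) + w)%cc by ring; rewrite H; ring. Qed.

Lemma Cabs_ge0 z : 0 <= Cabs z.
Proof. apply sqrt_pos. Qed.

Lemma Cabs_sq z : Cabs z * Cabs z = Cnorm2 z.
Proof. apply sqrt_sqrt, Cnorm2_ge0. Qed.

Lemma Cabs_mul (z w : CC) : Cabs (z * w) = Cabs z * Cabs w.
Proof.
  unfold Cabs; rewrite <- sqrt_mult by apply Cnorm2_ge0; f_equal.
  unfold Cnorm2, Cmul; simpl; ring.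
Qed.

Lemma Cabs_C0 : Cabs 0 = 0.
Proof. unfold Cabs, Cnorm2; simpl. replace (0 * 0 + 0 * 0) with 0 by ring. apply sqrt_0. Qed.

Lemma Cabs_C1 : Cabs 1 = 1.
Proof. unfold Cabs, Cnorm2; simpl. replace (1 * 1 + 0 * 0) with 1 by ring. apply sqrt_1. Qed.

Lemma Cabs_opp (z : CC) : Cabs (- z) = Cabs z.
Proof. unfold Cabs, Cnorm2, Copp; simpl; f_equal; ring. Qed.

Lemma Cabs_eq0 z : Cabs z = 0 -> z = C0.
Proof. intro H; apply Cnorm2_eq0; rewrite <- Cabs_sq, H; ring. Qed.

Lemma Cabs_pos z : z <> C0 -> 0 < Cabs z.
Proof.
  intro H; destruct (Cabs_ge0 z) as [h|h]; [exact h|].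
  exfalso; apply H, Cabs_eq0; auto.
Qed.

Lemma Cabs_neq0 z : 0 < Cabs z -> z <> C0.
Proof. intros h H; rewrite H, Cabs_C0 in h; lra. Qed.

Lemma Cabs_fst z : Rabs (fst z) <= Cabs z.
Proof.
  apply Rsqr_incr_0_var; [|apply Cabs_ge0].
  rewrite <- Rsqr_abs. unfold Rsqr. rewrite Cabs_sq. unfold Cnorm2; nra.
Qed.

Lemma Cabs_snd z : Rabs (snd z) <= Cabs z.
Proof.
  apply Rsqr_incr_0_var; [|apply Cabs_ge0].
  rewrite <- Rsqr_abs. unfold Rsqr. rewrite Cabs_sq. unfold Cnorm2; nra.
Qed.

Lemma Cabs_le_sum z : Cabs z <= Rabs (fst z) + Rabs (snd z).
Proof.
  pose proof (Rabs_pos (fst z)); pose proof (Rabs_pos (snd z)).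
  apply Rsqr_incr_0_var; [|lra].
  unfold Rsqr at 1; rewrite Cabs_sq; unfold Cnorm2.
  pose proof (Rsqr_abs (fst z)) as h1; pose proof (Rsqr_abs (snd z)) as h2.
  unfold Rsqr in *; nra.
Qed.

Lemma Cabs_tri (z w : CC) : Cabs (z + w) <= Cabs z + Cabs w.
Proof.
  pose proof (Cabs_ge0 z); pose proof (Cabs_ge0 w).
  apply Rsqr_incr_0_var; [|lra].
  unfold Rsqr at 1; rewrite Cabs_sq.
  assert (hz := Cabs_sq z); assert (hw := Cabs_sq w).
  assert (h : fst z * fst w + snd z * snd w <= Cabs z * Cabs w).
  { rewrite <- Cabs_mul. destruct (Rle_or_lt (fst z * fst w + snd z * snd w) 0) as [h|h].
    - pose proof (Cabs_ge0 (z * w)%cc); lra.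
    - apply Rsqr_incr_0_var; [|apply Cabs_ge0].
      unfold Rsqr at 2; rewrite Cabs_sq. unfold Rsqr, Cnorm2, Cmul; simpl.
      pose proof (Rle_0_sqr (fst z * snd w - snd z * fst w)) as g. unfold Rsqr in g. nra. }
  unfold Cnorm2, Cadd in *; simpl; unfold Rsqr; nra.
Qed.

Lemma Cabs_sub_sym (z w : CC) : Cabs (z - w) = Cabs (w - z).
Proof. rewrite <- Cabs_opp; f_equal; ring. Qed.

Lemma Cabs_sub_tri (z w : CC) : Cabs (z - w) <= Cabs z + Cabs w.
Proof. unfold Csub; rewrite <- (Cabs_opp w); apply Cabs_tri. Qed.

Lemma Cabs_tri_rev (z w : CC) : Cabs z - Cabs w <= Cabs (z - w).
Proof. pose proof (Cabs_tri (z - w) w) as H. replace (z - w + w)%cc with z in H by ring. lra. Qed.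

Lemma Cabs_inv z : z <> C0 -> Cabs (Cinv z) = / Cabs z.
Proof.
  intro H. pose proof (Cabs_pos z H).
  apply (Rmult_eq_reg_l (Cabs z)); [|lra].
  rewrite <- Cabs_mul, Rinv_r by lra. replace (z * Cinv z)%cc with C1 by (field; auto).
  apply Cabs_C1.
Qed.

Lemma Cabs_div (z w : CC) : w <> C0 -> Cabs (z / w) = Cabs z / Cabs w.
Proof. intro; unfold Cdiv; rewrite Cabs_mul, Cabs_inv; auto. Qed.

Lemma Cabs_CR x : Cabs (CR x) = Rabs x.
Proof.
  unfold Cabs, Cnorm2, CR; simpl. replace (x * x + 0 * 0) with (Rsqr x) by (unfold Rsqr; ring).
  apply sqrt_Rsqr_abs.
Qed.

Lemma Cabs_2 : Cabs 2 = 2.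
Proof. replace (2)%cc with (CR 2) by (apply CC_eq; simpl; ring). rewrite Cabs_CR; apply Rabs_right; lra. Qed.

Lemma Cabs_4 : Cabs 4 = 4.
Proof. rewrite Cabs_mul, Cabs_2; ring. Qed.

(** * Complex exponential, logarithm and square root *)

Definition cexp (z : CC) : CC := (exp (fst z) * cos (snd z), exp (fst z) * sin (snd z)).
(** Principal branches. [clog] is a logarithm only where the real part is positive, since [atan] of
    the slope loses the quadrant; [csqrt] is the root of nonnegative real part, by the half-angle
    formulas. *)
Definition clog (w : CC) : CC := (ln (Cabs w), atan (snd w / fst w)).
Definition csqrt (w : CC) : CC :=
  (sqrt ((Cabs w + fst w) / 2),
   (if Rle_dec 0 (snd w) then 1 else -1) * sqrt ((Cabs w - fst w) / 2)).

Lemma cexp_add (z w : CC) : cexp (z + w)%cc = (cexp z * cexp w)%cc.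
Proof.
  unfold cexp, Cadd, Cmul; apply CC_eq; simpl; rewrite exp_plus, ?cos_plus, ?sin_plus; ring.
Qed.

Lemma cexp_0 : cexp C0 = C1.
Proof. unfold cexp, C0, C1; simpl; rewrite exp_0, cos_0, sin_0; apply CC_eq; simpl; ring. Qed.

Lemma cexp_neq0 z : cexp z <> C0.
Proof.
  intro H. apply C1_neq0. rewrite <- cexp_0. replace C0 with (z + (- z))%cc at 1 by ring.
  rewrite cexp_add, H. ring.
Qed.

Lemma cexp_opp z : cexp (- z)%cc = Cinv (cexp z).
Proof.
  replace (Cinv (cexp z)) with (Cinv (cexp z) * cexp (z + (- z)))%cc.
  - rewrite cexp_add. field. apply cexp_neq0.
  - replace (z + - z)%cc with C0 by ring. rewrite cexp_0; ring.
Qed.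

Lemma cexp_sub (z w : CC) : cexp (z - w)%cc = (cexp z / cexp w)%cc.
Proof. unfold Csub; rewrite cexp_add, cexp_opp; reflexivity. Qed.

Lemma Cabs_cexp z : Cabs (cexp z) = exp (fst z).
Proof.
  unfold Cabs, Cnorm2, cexp; simpl.
  replace (_ + _) with (Rsqr (exp (fst z)) * ((Rsqr (sin (snd z)) + Rsqr (cos (snd z))))) by (unfold Rsqr; ring).
  rewrite sin2_cos2, Rmult_1_r. apply sqrt_Rsqr. left; apply exp_pos.
Qed.

(** From [exp a >= 1 + a] and the same at [- a]; the factor [1 + exp a] covers both signs, so that
    no bound on [a] is needed. *)
Lemma exp_m1_bound a : Rabs (exp a - 1) <= Rabs a * (1 + exp a).
Proof.
  pose proof (exp_ineq1_le a). pose proof (exp_ineq1_le (- a)). pose proof (exp_pos a).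
  assert (exp a * exp (-a) = 1) by (rewrite <- exp_plus, Rplus_opp_r; apply exp_0).
  assert (exp a * (1 - a) <= 1) by nra.
  destruct (Rle_or_lt 0 a) as [h|h].
  - rewrite (Rabs_right a) by lra. rewrite Rabs_right by lra. nra.
  - rewrite (Rabs_left a) by lra. assert (exp a < 1) by (rewrite <- exp_0; apply exp_increasing; lra).
    rewrite Rabs_left by lra. nra.
Qed.

Lemma abs_sin_le b : Rabs (sin b) <= Rabs b.
Proof.
  assert (pos : forall x, 0 < x -> Rabs (sin x) <= x).
  { intros x h. destruct (Rle_or_lt x 1) as [h1|h1].
    - rewrite Rabs_right. left; apply sin_lt_x; auto.
      pose proof PI2_1. apply Rle_ge, sin_ge_0; lra.
    - pose proof (SIN_bound x). apply Rabs_le; lra. }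
  destruct (Rtotal_order b 0) as [h|[h|h]].
  - replace (Rabs (sin b)) with (Rabs (sin (- b))) by (rewrite sin_neg, Rabs_Ropp; auto).
    rewrite (Rabs_left b) by lra. apply pos; lra.
  - subst; rewrite sin_0; lra.
  - rewrite (Rabs_right b) by lra; auto.
Qed.

Lemma one_sub_cos b : 0 <= 1 - cos b <= b * b / 2.
Proof.
  pose proof (COS_bound b). split; [lra|].
  replace b with (2 * (b / 2)) at 1 by field. rewrite cos_2a_sin.
  pose proof (abs_sin_le (b/2)) as h. apply Rsqr_le_abs_1 in h. unfold Rsqr in h. nra.
Qed.

Lemma cexp_i_m1_bound b : Cabs (Csub (cos b, sin b) C1) <= Rabs b.
Proof.
  apply Rsqr_incr_0_var; [|apply Rabs_pos]. rewrite <- Rsqr_abs. unfold Rsqr.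
  rewrite Cabs_sq. unfold Cnorm2, Csub, Cadd, Copp, C1; simpl.
  pose proof (one_sub_cos b). pose proof (sin2_cos2 b) as h; unfold Rsqr in h. nra.
Qed.

(** No smallness of [z] is needed because both end values of the exponential, [1] and [cexp z],
    appear on the right. *)
Lemma cexp_m1_bound (z : CC) : Cabs (cexp z - 1) <= 2 * Cabs z * (1 + Cabs (cexp z)).
Proof.
  rewrite Cabs_cexp.
  replace (cexp z - 1)%cc with (CR (exp (fst z)) * Csub (cos (snd z), sin (snd z)) C1 + CR (exp (fst z) - 1))%cc
    by (apply CC_eq; unfold cexp, CR, Csub, Cadd, Copp, Cmul, C1; simpl; ring).
  eapply Rle_trans; [apply Cabs_tri|]. rewrite Cabs_mul, !Cabs_CR.
  pose proof (cexp_i_m1_bound (snd z)). pose proof (exp_m1_bound (fst z)).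
  pose proof (exp_pos (fst z)). pose proof (Cabs_fst z). pose proof (Cabs_snd z).
  rewrite (Rabs_right (exp _)) by lra. pose proof (Rabs_pos (fst z)). pose proof (Rabs_pos (snd z)). 
  pose proof (Cabs_ge0 (Csub (cos (snd z), sin (snd z)) C1)).
  nra.
Qed.

Lemma exp_quad a : Rabs a <= 1/2 -> 0 <= exp a - 1 - a <= 2 * (a * a).
Proof.
  intro h. apply Rabs_le_inv in h.
  pose proof (exp_ineq1_le a). pose proof (exp_ineq1_le (- a)). pose proof (exp_pos a).
  assert (exp a * exp (-a) = 1) by (rewrite <- exp_plus, Rplus_opp_r; apply exp_0).
  assert (exp a * (1 - a) <= 1) by nra. split; [lra|nra].
Qed.

Lemma sin_quad b : Rabs b <= 1/2 -> Rabs (sin b - b) <= b * b.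
Proof.
  assert (pos : forall x, 0 <= x <= 1/2 -> Rabs (sin x - x) <= x * x).
  { intros x h. pose proof PI2_1. destruct (pre_sin_bound x 0) as [h1 _]; [lra|lra|].
    unfold sin_approx, sin_term in h1; simpl in h1.
    assert (sin x <= x) by (destruct (Req_dec x 0) as [->|]; [rewrite sin_0; lra|left; apply sin_lt_x; lra]).
    rewrite Rabs_left1 by lra.
    assert (x * (x * x) <= x * x) by nra. lra. }
  intro h; apply Rabs_le_inv in h. destruct (Rle_or_lt 0 b).
  - apply pos; lra.
  - replace (sin b - b) with (- (sin (- b) - (- b))) by (rewrite sin_neg; ring).
    rewrite Rabs_Ropp. replace (b * b) with ((-b) * (-b)) by ring. apply pos; lra.
Qed.

Lemma cexp_quad (z : CC) : Cabs z <= 1/2 -> Cabs (cexp z - 1 - z) <= 8 * (Cabs z * Cabs z).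
Proof.
  intro h.
  set (a := fst z); set (b := snd z).
  replace (cexp z - 1 - z)%cc
    with (CR (exp a - 1) * Csub (cos b, sin b) C1 + (CR (exp a - 1 - a) + ((cos b - 1)%R, (sin b - b)%R)))%cc
    by (apply CC_eq; unfold cexp, CR, Csub, Cadd, Copp, Cmul, C1; simpl; fold a b; ring).
  pose proof (Cabs_fst z) as ha. pose proof (Cabs_snd z) as hb. fold a in ha. fold b in hb.
  assert (Cabs (cos b - 1, sin b - b) <= 2 * (b * b)).
  { eapply Rle_trans; [apply Cabs_le_sum|]; simpl.
    pose proof (sin_quad b ltac:(lra)). pose proof (one_sub_cos b).
    rewrite (Rabs_left1 (cos b - 1)) by lra. nra. }
  pose proof (exp_quad a ltac:(lra)). pose proof (exp_m1_bound a). pose proof (cexp_i_m1_bound b).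
  assert (a * a <= Cabs z * Cabs z) by (rewrite <- (Rabs_right (a*a)) by nra; rewrite Rabs_mult; pose proof (Rabs_pos a); nra).
  assert (b * b <= Cabs z * Cabs z) by (rewrite <- (Rabs_right (b*b)) by nra; rewrite Rabs_mult; pose proof (Rabs_pos b); nra).
  eapply Rle_trans; [apply Cabs_tri|]. rewrite Cabs_mul, Cabs_CR.
  assert (exp a <= 2) by (apply Rabs_le_inv in ha; nra).
  assert (Rabs (exp a - 1) * Cabs (Csub (cos b, sin b) C1) <= 3 * (Cabs z * Cabs z)).
  { pose proof (Rabs_pos a). pose proof (Rabs_pos b). pose proof (Cabs_ge0 z).
    replace (3 * (Cabs z * Cabs z)) with ((3 * Cabs z) * Cabs z) by ring.
    apply Rmult_le_compat; try apply Rabs_pos; try apply Cabs_ge0; nra. }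
  eapply Rle_trans; [apply Rplus_le_compat_l, Cabs_tri|]. rewrite Cabs_CR, (Rabs_right (_ - _ - _)) by lra.
  lra.
Qed.

Lemma cexp_clog w : 0 < fst w -> cexp (clog w) = w.
Proof.
  intro h. assert (h0 : 0 < Cabs w) by (pose proof (Cabs_fst w); rewrite Rabs_right in H; lra).
  assert (hs : sqrt (1 + Rsqr (snd w / fst w)) = Cabs w / fst w).
  { apply sqrt_lem_1; [pose proof (Rle_0_sqr (snd w / fst w)); lra| apply Rlt_le, Rdiv_lt_0_compat; auto|].
    replace (Cabs w / fst w * (Cabs w / fst w)) with (Cabs w * Cabs w / (fst w * fst w)) by (field; lra).
    rewrite Cabs_sq; unfold Cnorm2, Rsqr; field; lra. }
  unfold cexp, clog; cbn [fst snd]. rewrite exp_ln, sin_atan, cos_atan by auto. unfold Rsqr in *; rewrite hs.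
  apply CC_eq; simpl; field; lra.
Qed.

Lemma fst_close (w : CC) : 1 - Cabs (w - 1) <= fst w.
Proof.
  pose proof (Cabs_fst (w - 1)%cc) as h. unfold Csub, Cadd, Copp, C1 in *; simpl in *.
  apply Rabs_le_inv in h. lra.
Qed.

Lemma abs_atan_le t : Rabs (atan t) <= Rabs t.
Proof.
  assert (pos : forall x, 0 < x -> 0 <= atan x <= x).
  { intros x hx. pose proof (atan_increasing 0 x hx) as h0. rewrite atan_0 in h0. split; [lra|].
    destruct (MVT_cor2 atan (fun x => / (1 + x ^ 2)) 0 x hx) as [c [hc _]].
    - intros c _. apply derivable_pt_lim_atan.
    - rewrite atan_0 in hc. pose proof (pow2_ge_0 c).
      assert (/ (1 + c ^ 2) <= 1) by (rewrite <- Rinv_1; apply Rinv_le_contravar; lra). nra. }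
  destruct (Rtotal_order t 0) as [h|[h|h]].
  - pose proof (pos (- t) ltac:(lra)) as g. rewrite atan_opp in g. rewrite !Rabs_left1; lra.
  - subst; rewrite atan_0; lra.
  - pose proof (pos t h). rewrite !Rabs_right; lra.
Qed.

Lemma clog_bound (w : CC) : Cabs (w - 1) <= 1/2 -> Cabs (clog w) <= 4 * Cabs (w - 1).
Proof.
  intro h. pose proof (fst_close w).
  eapply Rle_trans; [apply Cabs_le_sum|]. unfold clog; simpl.
  assert (h2 : Rabs (snd w) <= Cabs (w - 1)).
  { replace (snd w) with (snd (w - 1)%cc) by (unfold Csub, Cadd, Copp, C1; simpl; ring). apply Cabs_snd. }
  pose proof (abs_atan_le (snd w / fst w)) as h3.
  assert (h4 : Rabs (snd w / fst w) <= 2 * Cabs (w - 1)).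
  { unfold Rdiv; rewrite Rabs_mult, Rabs_inv, (Rabs_right (fst w)) by lra.
    apply (Rmult_le_reg_r (fst w)); [lra|]. rewrite Rmult_assoc, Rinv_l by lra.
    pose proof (Cabs_ge0 (w - 1)%cc). nra. }
  assert (h5 : Rabs (ln (Cabs w)) <= 2 * Cabs (w - 1)).
  { pose proof (Cabs_tri (w - 1) 1) as g1. replace (w - 1 + 1)%cc with w in g1 by ring.
    pose proof (Cabs_tri_rev 1 (1 - w)) as g2. replace (1 - (1 - w))%cc with w in g2 by ring.
    rewrite Cabs_C1 in *. rewrite (Cabs_sub_sym 1) in g2.
    assert (hp : 0 < Cabs w) by lra.
    pose proof (exp_ineq1_le (ln (Cabs w))) as g3. rewrite exp_ln in g3 by auto.
    pose proof (exp_ineq1_le (- ln (Cabs w))) as g4. rewrite exp_Ropp, exp_ln in g4 by auto.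
    assert (/ Cabs w <= 1 + 2 * Cabs (w - 1)).
    { apply (Rmult_le_reg_r (Cabs w)); [lra|]. rewrite Rinv_l by lra. nra. }
    apply Rabs_le. lra. }
  lra.
Qed.

Lemma cexp_eq1 (z : CC) : cexp z = C1 -> Rabs (snd z) < 2 * PI -> z = C0.
Proof.
  intros h hb.
  assert (ha : fst z = 0).
  { apply (f_equal Cabs) in h. rewrite Cabs_cexp, Cabs_C1 in h. apply exp_inv. rewrite exp_0; auto. }
  apply CC_eq; [exact ha|]. simpl.
  apply (f_equal fst) in h as h1.
  unfold cexp, C1 in h1; simpl in h1. rewrite ha, exp_0 in h1.
  assert (h3 : cos (snd z) = 1) by lra.
  assert (hs : sin (snd z / 2) = 0).
  { replace (snd z) with (2 * (snd z / 2)) in h3 by field. rewrite cos_2a_sin in h3. nra. }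
  apply Rabs_def2 in hb. 
  destruct (Rtotal_order (snd z) 0) as [g|[g|g]]; [|exact g|]; exfalso.
  - assert (0 < sin (- (snd z / 2))) by (apply sin_gt_0; lra). rewrite sin_neg in H; lra.
  - assert (0 < sin (snd z / 2)) by (apply sin_gt_0; lra). lra.
Qed.

(** Reduces the variation of the logarithm near any point to its size near [1]; the Lipschitz bound
    and the derivative both come from this. *)
Lemma clog_sub (w w0 : CC) : Cabs (w - 1) <= 1/8 -> Cabs (w0 - 1) <= 1/8 ->
  (clog w - clog w0)%cc = clog (w / w0)%cc /\ Cabs (w / w0 - 1) <= 1/2 /\ Cabs (w / w0 - 1) <= 2 * Cabs (w - w0).
Proof.
  intros h h0.
  pose proof (fst_close w). pose proof (fst_close w0).
  assert (hw0 : 7/8 <= Cabs w0) by (pose proof (Cabs_fst w0) as g; rewrite Rabs_right in g; lra).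
  assert (n0 : w0 <> C0) by (apply Cabs_neq0; lra).
  assert (e : Cabs (w / w0 - 1) = Cabs (w - w0) / Cabs w0).
  { rewrite <- Cabs_div by auto. f_equal. field; auto. }
  assert (g2 : Cabs (w / w0 - 1) <= 2 * Cabs (w - w0)).
  { rewrite e. apply (Rmult_le_reg_r (Cabs w0)); [lra|]. unfold Rdiv; rewrite Rmult_assoc, Rinv_l by lra.
    pose proof (Cabs_ge0 (w - w0)%cc); nra. }
  assert (g3 : Cabs (w - w0) <= 1/4).
  { replace (w - w0)%cc with ((w - 1) - (w0 - 1))%cc by ring. eapply Rle_trans; [apply Cabs_sub_tri|]. lra. }
  split; [|split; lra].
  apply Csub_eq0, cexp_eq1.
  - rewrite !cexp_sub, !cexp_clog; try lra.
    + field; split; auto. apply Cabs_neq0. pose proof (Cabs_fst w) as g; rewrite Rabs_right in g; lra.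
    + pose proof (fst_close (w / w0)%cc). lra.
  (* Three values of [atan], each below [PI / 2] in absolute value: the imaginary part stays below
     [3 * PI / 2]. *)
  - set (q := (w / w0)%cc). unfold clog, Csub, Cadd, Copp; cbn [fst snd].
    pose proof (atan_bound (snd w / fst w)). pose proof (atan_bound (snd w0 / fst w0)).
    pose proof (atan_bound (snd q / fst q)). pose proof PI_RGT_0.
    apply Rabs_def1; lra.
Qed.

Lemma clog_lip (w w0 : CC) : Cabs (w - 1) <= 1/8 -> Cabs (w0 - 1) <= 1/8 ->
  Cabs (clog w - clog w0) <= 8 * Cabs (w - w0).
Proof.
  intros h h0. destruct (clog_sub w w0 h h0) as [-> [g1 g2]].
  pose proof (clog_bound _ g1). lra.
Qed.

Lemma csqrt_sq w : (csqrt w * csqrt w)%cc = w.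
Proof.
  pose proof (Cabs_fst w) as h. apply Rabs_le_inv in h.
  assert (h1 : 0 <= (Cabs w + fst w) / 2) by lra. assert (h2 : 0 <= (Cabs w - fst w) / 2) by lra.
  pose proof (sqrt_sqrt _ h1) as e1. pose proof (sqrt_sqrt _ h2) as e2.
  assert (e3 : sqrt ((Cabs w + fst w) / 2) * sqrt ((Cabs w - fst w) / 2) = Rabs (snd w) / 2).
  { rewrite <- sqrt_mult by auto. apply sqrt_lem_1; [apply Rmult_le_pos; auto| pose proof (Rabs_pos (snd w)); lra|].
    replace (Rabs (snd w) / 2 * (Rabs (snd w) / 2)) with ((Rabs (snd w))² / 4) by (unfold Rsqr; field).
    rewrite <- Rsqr_abs. pose proof (Cabs_sq w) as g. unfold Cnorm2, Rsqr in *. nra. }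
  unfold csqrt. set (u := sqrt _) in *. set (v := sqrt ((_ - _)/2)) in *.
  apply CC_eq; unfold Cmul; simpl; destruct (Rle_dec 0 (snd w)) as [g|g]; simpl.
  - nra.
  - nra.
  - rewrite Rabs_right in e3 by lra. lra.
  - rewrite Rabs_left in e3 by lra. lra.
Qed.

Lemma csqrt_ge0 w : 0 <= fst (csqrt w).
Proof. apply sqrt_pos. Qed.

(** Two roots with real parts of the same sign have a sum bounded below, so
    [t^2 - s^2 = (t - s)(t + s)] controls [t - s]. Uniqueness, the Lipschitz bound and the
    derivative of [csqrt] follow. *)
Lemma csqrt_near (w s0 : CC) : 0 < fst s0 ->
  Cabs (csqrt w - s0) <= Cabs (w - s0 * s0) / fst s0.
Proof.
  intro h. pose proof (csqrt_ge0 w).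
  assert (hs : fst s0 <= Cabs (csqrt w + s0)).
  { pose proof (Cabs_fst (csqrt w + s0)%cc) as g. unfold Cadd in *; simpl in *.
    rewrite Rabs_right in g; lra. }
  replace (w - s0 * s0)%cc with ((csqrt w - s0) * (csqrt w + s0))%cc
    by (rewrite <- (csqrt_sq w) at 3; ring).
  rewrite Cabs_mul. apply (Rmult_le_reg_r (fst s0)); [lra|].
  unfold Rdiv; rewrite (Rmult_assoc _ (/ _)), Rinv_l, Rmult_1_r by lra.
  apply Rmult_le_compat_l; auto. apply Cabs_ge0.
Qed.

Lemma csqrt_unique s0 : 0 < fst s0 -> csqrt (s0 * s0)%cc = s0.
Proof.
  intro h. pose proof (csqrt_near (s0 * s0) s0 h) as g.
  replace (s0 * s0 - s0 * s0)%cc with C0 in g by ring. rewrite Cabs_C0 in g. unfold Rdiv in g; rewrite Rmult_0_l in g.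
  apply Csub_eq0, Cabs_eq0. pose proof (Cabs_ge0 (csqrt (s0 * s0) - s0)%cc). lra.
Qed.

Lemma csqrt_lip (w w0 : CC) : 0 < fst (csqrt w0) ->
  Cabs (csqrt w - csqrt w0) <= Cabs (w - w0) / fst (csqrt w0).
Proof. intro h. pose proof (csqrt_near w _ h) as g. rewrite csqrt_sq in g. exact g. Qed.

(** Inverse on the unit disk of [u |-> u / (1 + u^2)]: the small root of a quadratic equation,
    written with a sum in the denominator so as to be regular at [z = 0]. *)
Definition jouk_inv (z : CC) : CC := (2 * z / (1 + csqrt (1 - 4 * (z * z))))%cc.

Lemma one_add_csqrt_neq0 (w : CC) : (1 + csqrt w)%cc <> C0.
Proof.
  intro h. apply (f_equal fst) in h. unfold Cadd, C1, C0 in h. cbn [fst] in h. pose proof (csqrt_ge0 w). lra.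
Qed.

Lemma one_add_sq_neq0 (u : CC) : Cabs u < 1 -> (1 + u * u)%cc <> C0.
Proof.
  intros h H. assert (Cabs (u * u) = 1).
  { replace (u * u)%cc with ((1 + u * u) - 1)%cc by ring. rewrite H.
    replace (0 - 1)%cc with (- (1))%cc by ring. rewrite Cabs_opp; apply Cabs_C1. }
  rewrite Cabs_mul in H0. pose proof (Cabs_ge0 u). nra.
Qed.

(** The Cayley transform sends the unit disk to the right half-plane. With [w = u^2] it decides
    which square root is the principal one in [sqrt_of_joukowski]. *)
Lemma fst_cayley_pos (w : CC) : Cabs w < 1 -> 0 < fst ((1 - w) / (1 + w))%cc.
Proof.
  intro h. assert (hn : (1 + w)%cc <> C0).
  { intro H. assert (g : Cabs w = 1). { replace w with ((1 + w) - 1)%cc by ring. rewrite H.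
    replace (0 - 1)%cc with (- (1))%cc by ring. rewrite Cabs_opp; apply Cabs_C1. } lra. }
  apply Cnorm2_pos in hn.
  assert (hw : Cnorm2 w < 1) by (rewrite <- Cabs_sq; pose proof (Cabs_ge0 w); nra).
  replace (fst ((1 - w) / (1 + w))%cc) with ((1 - Cnorm2 w) / Cnorm2 (1 + w)%cc).
  - apply Rdiv_lt_0_compat; lra.
  - unfold Cdiv, Cmul, Cinv, Cnorm2, Csub, Cadd, Copp, C1 in *; simpl in *. field. lra.
Qed.

Lemma sqrt_of_joukowski (u : CC) : Cabs u < 1 ->
  let z := (u / (1 + u * u))%cc in csqrt (1 - 4 * (z * z))%cc = ((1 - u * u) / (1 + u * u))%cc.
Proof.
  intros h z. pose proof (one_add_sq_neq0 u h).
  rewrite <- csqrt_unique.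
  - f_equal. unfold z. field. auto.
  - apply fst_cayley_pos. rewrite Cabs_mul. pose proof (Cabs_ge0 u). nra.
Qed.

Lemma jouk_inv_left (u : CC) : Cabs u < 1 -> jouk_inv (u / (1 + u * u))%cc = u.
Proof.
  intros h. pose proof (one_add_sq_neq0 u h). unfold jouk_inv. rewrite sqrt_of_joukowski by auto.
  pose proof two_neq0. field. split; auto.
  change (R1, R0) with C1. replace (1 + u * u + (1 - u * u))%cc with (2)%cc by ring. auto.
Qed.

Lemma one_add_jouk_inv_sq (z : CC) : (1 + jouk_inv z * jouk_inv z)%cc = (2 / (1 + csqrt (1 - 4 * (z * z))))%cc.
Proof.
  unfold jouk_inv. set (s := csqrt _).
  assert (hs : (1 + s)%cc <> C0) by apply one_add_csqrt_neq0.
  assert (e : (4 * (z * z) = 1 - s * s)%cc) by (unfold s; rewrite csqrt_sq; ring).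
  replace (2 * z / (1 + s) * (2 * z / (1 + s)))%cc with (4 * (z * z) / ((1 + s) * (1 + s)))%cc by (field; auto).
  rewrite e. field. auto.
Qed.

Lemma one_add_jouk_inv_sq_neq0 (z : CC) : (1 + jouk_inv z * jouk_inv z)%cc <> C0.
Proof. rewrite one_add_jouk_inv_sq. apply Cdiv_neq0; [apply two_neq0|apply one_add_csqrt_neq0]. Qed.

Lemma jouk_inv_right (z : CC) : (jouk_inv z / (1 + jouk_inv z * jouk_inv z))%cc = z.
Proof.
  rewrite one_add_jouk_inv_sq. unfold jouk_inv. pose proof (one_add_csqrt_neq0 (1 - 4 * (z * z))%cc).
  pose proof two_neq0. field. auto.
Qed.

Lemma four_neq0 : (4 <> 0)%cc.
Proof. apply Cmul_neq0; apply two_neq0. Qed.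

(* [field] leaves side conditions in which numerals have been unfolded. *)
Ltac cfield := field; repeat split; try change (R1, R0) with C1; try exact two_neq0; try exact four_neq0;
  auto using Cmul_neq0.

(** * Complex differentiability *)

(** A common interface to [CC], [C2] and [C3], so that the rules of calculus are proved once. [vlin]
    is the set of admissible differentials: complex linearity is built into the three instances,
    while the rules use only linear combinations and boundedness. *)
Record nspace : Type := {
  car :> Type;
  vadd : car -> car -> car;
  vzero : car;
  vnorm : car -> R;
  vlin : (car -> CC) -> Prop;
  vadd_0 : forall p, vadd p vzero = p;
  vnorm_0 : vnorm vzero = 0;
  vnorm_ge0 : forall p, 0 <= vnorm p;
  vlin_0 : vlin (fun _ => C0);
  vlin_comb : forall a b l m, vlin l -> vlin m -> vlin (fun h => a * l h + b * m h)%cc;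
  vlin_bound : forall l, vlin l -> exists K, 0 <= K /\ forall h, Cabs (l h) <= K * vnorm h }.

Definition Dif (V : nspace) (f : V -> CC) (p : V) : Prop :=
  exists l, vlin V l /\ forall eps, 0 < eps -> exists del, 0 < del /\
    forall h, vnorm V h < del ->
      Cabs (f (vadd V p h) - f p - l h) <= eps * vnorm V h.

Definition near (V : nspace) (p : V) (P : V -> Prop) : Prop :=
  exists del, 0 < del /\ forall h, vnorm V h < del -> P (vadd V p h).

Section Calculus.
Variable V : nspace.
Implicit Types (f g : V -> CC) (p : V).

Lemma near_self p (P : V -> Prop) : near V p P -> P p.
Proof.
  intros [d [hd H]]. rewrite <- (vadd_0 V p). apply H. rewrite vnorm_0; auto.
Qed.

Lemma near_and p (P Q : V -> Prop) : near V p P -> near V p Q -> near V p (fun x => P x /\ Q x).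
Proof.
  intros [d [hd H]] [e [he G]]. exists (Rmin d e). split; [apply Rmin_pos; auto|].
  intros h hh. rmin d e.
  split; [apply H|apply G]; lra.
Qed.

Lemma near_mono p (P Q : V -> Prop) : (forall x, P x -> Q x) -> near V p P -> near V p Q.
Proof. intros I [d [hd H]]. exists d; split; auto. Qed.

Lemma Dif_ext_near f g p : near V p (fun x => f x = g x) -> Dif V f p -> Dif V g p.
Proof.
  intros N [l [hl H]]. pose proof (near_self _ _ N) as e0. destruct N as [d0 [hd0 N]].
  exists l; split; auto. intros eps he. destruct (H eps he) as [d [hd H']].
  exists (Rmin d d0). split; [apply Rmin_pos; auto|].
  intros h hh. rmin d d0.
  rewrite <- e0, <- N by lra. apply H'; lra.
Qed.

Lemma Dif_ext f g p : (forall x, f x = g x) -> Dif V f p -> Dif V g p.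
Proof. intro e. apply Dif_ext_near. exists 1; split; [lra|auto]. Qed.

Lemma Dif_const c p : Dif V (fun _ => c) p.
Proof.
  exists (fun _ => C0). split; [apply vlin_0|]. intros eps he. exists 1; split; [lra|].
  intros h _. replace (c - c - 0)%cc with C0 by ring. rewrite Cabs_C0.
  pose proof (vnorm_ge0 V h). nra.
Qed.

Lemma Dif_lin l p : vlin V l -> (forall q h, l (vadd V q h) = (l q + l h)%cc) -> Dif V l p.
Proof.
  intros hl ha. exists l. split; auto. intros eps he. exists 1; split; [lra|].
  intros h _. rewrite ha. replace (l p + l h - l p - l h)%cc with C0 by ring. rewrite Cabs_C0.
  pose proof (vnorm_ge0 V h). nra.
Qed.

Lemma Dif_locLip f p : Dif V f p -> exists K, 0 < K /\
  exists del, 0 < del /\ forall h, vnorm V h < del ->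
    Cabs (f (vadd V p h) - f p) <= K * vnorm V h.
Proof.
  intros [l [hl H]]. destruct (vlin_bound V l hl) as [K [hK B]].
  exists (K + 1). split; [lra|].
  destruct (H 1 ltac:(lra)) as [d [hd G]]. exists d; split; auto.
  intros h hh. replace (f (vadd V p h) - f p)%cc with ((f (vadd V p h) - f p - l h) + l h)%cc by ring.
  eapply Rle_trans; [apply Cabs_tri|]. specialize (G h hh). specialize (B h). lra.
Qed.

Lemma Dif_cont f p eps : Dif V f p -> 0 < eps -> near V p (fun x => Cabs (f x - f p) < eps).
Proof.
  intros H he. destruct (Dif_locLip f p H) as [K [hK [d [hd G]]]].
  exists (Rmin d (eps / (2 * K))). split.
  - apply Rmin_pos; auto. apply Rdiv_lt_0_compat; lra.
  - intros h hh. rmin d (eps / (2 * K)).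
    eapply Rle_lt_trans; [apply G; lra|].
    apply Rle_lt_trans with (K * (eps / (2 * K))).
    + apply Rmult_le_compat_l; lra.
    + replace (K * (eps / (2 * K))) with (eps / 2) by (field; lra). lra.
Qed.

Lemma Dif_comb a b f g p : Dif V f p -> Dif V g p -> Dif V (fun x => a * f x + b * g x)%cc p.
Proof.
  intros [l [hl H]] [m [hm G]].
  exists (fun h => a * l h + b * m h)%cc. split; [apply vlin_comb; auto|].
  intros eps he.
  set (c := Cabs a + Cabs b + 1). pose proof (Cabs_ge0 a). pose proof (Cabs_ge0 b).
  assert (hc : 0 < eps / c) by (apply Rdiv_lt_0_compat; unfold c; lra).
  destruct (H _ hc) as [d [hd H']]. destruct (G _ hc) as [e [hE G']].
  exists (Rmin d e). split; [apply Rmin_pos; auto|].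
  intros h hh. rmin d e.
  specialize (H' h ltac:(lra)). specialize (G' h ltac:(lra)).
  replace (_ - _ - _)%cc with (a * (f (vadd V p h) - f p - l h) + b * (g (vadd V p h) - g p - m h))%cc by ring.
  eapply Rle_trans; [apply Cabs_tri|]. rewrite !Cabs_mul.
  pose proof (vnorm_ge0 V h).
  apply Rle_trans with ((Cabs a + Cabs b) * (eps / c * vnorm V h)); [nra|].
  apply Rle_trans with (c * (eps / c * vnorm V h)).
  - apply Rmult_le_compat_r; [|unfold c; lra]. apply Rmult_le_pos; lra.
  - apply Req_le. unfold c. field. lra.
Qed.

Lemma Dif_add f g p : Dif V f p -> Dif V g p -> Dif V (fun x => f x + g x)%cc p.
Proof.
  intros H G. apply (Dif_ext (fun x => 1 * f x + 1 * g x)%cc); [intro; ring|].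
  apply Dif_comb; auto.
Qed.

Lemma Dif_sub f g p : Dif V f p -> Dif V g p -> Dif V (fun x => f x - g x)%cc p.
Proof.
  intros H G. apply (Dif_ext (fun x => 1 * f x + (- (1)) * g x)%cc); [intro; ring|].
  apply Dif_comb; auto.
Qed.

Lemma Dif_opp f p : Dif V f p -> Dif V (fun x => - f x)%cc p.
Proof.
  intros H. apply (Dif_ext (fun x => (- (1)) * f x + 0 * f x)%cc); [intro; ring|].
  apply Dif_comb; auto.
Qed.

End Calculus.

Definition lin1 (l : CC -> CC) : Prop := exists a, forall h, l h = (a * h)%cc.
Definition lin2 (l : C2 -> CC) : Prop := exists a b, forall h, l h = (a * fst h + b * snd h)%cc.
Definition lin3 (l : C3 -> CC) : Prop :=
  exists a b c, forall h, l h = (a * fst (fst h) + b * snd (fst h) + c * snd h)%cc.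

Definition VC1 : nspace.
Proof.
  refine (Build_nspace CC Cadd C0 Cabs lin1 _ Cabs_C0 Cabs_ge0 _ _ _).
  - intro; ring.
  - exists C0; intro; ring.
  - intros a b l m [x X] [y Y]. exists (a * x + b * y)%cc. intro; rewrite X, Y; ring.
  - intros l [x X]. exists (Cabs x). split; [apply Cabs_ge0|]. intro; rewrite X, Cabs_mul; lra.
Defined.

Definition VC2 : nspace.
Proof.
  refine (Build_nspace C2 add2 (C0, C0) n2 lin2 _ _ _ _ _ _).
  - intros [p q]; unfold add2; simpl; f_equal; ring.
  - unfold n2; simpl; rewrite Cabs_C0; ring.
  - intros p; unfold n2; pose proof (Cabs_ge0 (fst p)); pose proof (Cabs_ge0 (snd p)); lra.
  - exists C0, C0; intro; ring.
  - intros a b l m (x & x' & X) (y & y' & Y). exists (a * x + b * y)%cc, (a * x' + b * y')%cc.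
    intro; rewrite X, Y; ring.
  - intros l (x & x' & X). exists (Cabs x + Cabs x').
    pose proof (Cabs_ge0 x); pose proof (Cabs_ge0 x'). split; [lra|].
    intros h; rewrite X. eapply Rle_trans; [apply Cabs_tri|]. rewrite !Cabs_mul. unfold n2.
    pose proof (Cabs_ge0 (fst h)); pose proof (Cabs_ge0 (snd h)); nra.
Defined.

Definition VC3 : nspace.
Proof.
  refine (Build_nspace C3 add3 (C0, C0, C0) n3 lin3 _ _ _ _ _ _).
  - intros [[p q] r]; unfold add3; simpl; repeat f_equal; ring.
  - unfold n3; simpl; rewrite Cabs_C0; ring.
  - intros [[p q] r]; unfold n3; pose proof (Cabs_ge0 p); pose proof (Cabs_ge0 q); pose proof (Cabs_ge0 r); lra.
  - exists C0, C0, C0; intro; ring.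
  - intros a b l m (x & x' & x'' & X) (y & y' & y'' & Y).
    exists (a * x + b * y)%cc, (a * x' + b * y')%cc, (a * x'' + b * y'')%cc.
    intro; rewrite X, Y; ring.
  - intros l (x & x' & x'' & X). exists (Cabs x + Cabs x' + Cabs x'').
    pose proof (Cabs_ge0 x); pose proof (Cabs_ge0 x'); pose proof (Cabs_ge0 x''). split; [lra|].
    intros [[p q] r]; rewrite X; cbn [fst snd].
    eapply Rle_trans; [apply Cabs_tri|]. eapply Rle_trans; [apply Rplus_le_compat_r, Cabs_tri|].
    rewrite !Cabs_mul. unfold n3.
    pose proof (Cabs_ge0 p); pose proof (Cabs_ge0 q); pose proof (Cabs_ge0 r); nra.
Defined.

Definition Dif1 : (CC -> CC) -> CC -> Prop := Dif VC1.
Definition Dif2 : (C2 -> CC) -> C2 -> Prop := Dif VC2.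
Definition Dif3 : (C3 -> CC) -> C3 -> Prop := Dif VC3.
Definition near2 : C2 -> (C2 -> Prop) -> Prop := near VC2.
Definition near3 : C3 -> (C3 -> Prop) -> Prop := near VC3.

Lemma Dif_comp3 (V : nspace) (g : C3 -> CC) (F : V -> C3) (p : V) :
  Dif3 g (F p) -> Dif V (fun x => fst (fst (F x))) p -> Dif V (fun x => snd (fst (F x))) p -> Dif V (fun x => snd (F x)) p ->
  Dif V (fun x => g (F x)) p.
Proof.
  intros [m [(a & b & c & hm) G]] D1 D2 D3.
  set (f1 := fun x => fst (fst (F x))) in *. set (f2 := fun x => snd (fst (F x))) in *. set (f3 := fun x => snd (F x)) in *.
  (* The differential of [g] composed with the components of [F] is differentiable by the sum rule,
     so the error splits into that of [g] at [F p] and that of this combination. *)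
  assert (DL : Dif V (fun x => a * f1 x + b * f2 x + c * f3 x)%cc p).
  { apply (Dif_ext V (fun x => 1 * (a * f1 x + b * f2 x) + c * f3 x)%cc); [intro; ring|].
    apply Dif_comb; auto. apply Dif_comb; auto. }
  destruct DL as [l [hl DL]].
  destruct (Dif_locLip V f1 p D1) as [K1 [hK1 [d1 [hd1 L1]]]].
  destruct (Dif_locLip V f2 p D2) as [K2 [hK2 [d2 [hd2 L2]]]].
  destruct (Dif_locLip V f3 p D3) as [K3 [hK3 [d3 [hd3 L3]]]].
  set (K := K1 + K2 + K3). assert (hK : 0 < K) by (unfold K; lra).
  exists l; split; auto. intros eps he.
  destruct (G (eps / (2 * K))) as [dg [hdg G']]; [apply Rdiv_lt_0_compat; lra|].
  destruct (DL (eps / 2) ltac:(lra)) as [dd [hdd D']].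
  set (d4 := dg / K). assert (hd4 : 0 < d4) by (apply Rdiv_lt_0_compat; lra).
  exists (Rmin (Rmin d1 d2) (Rmin d3 (Rmin d4 dd))). split; [repeat apply Rmin_pos; auto|].
  intros h hh.
  rmin (Rmin d1 d2) (Rmin d3 (Rmin d4 dd)).
  rmin d1 d2. rmin d3 (Rmin d4 dd).
  rmin d4 dd.
  specialize (L1 h ltac:(lra)). specialize (L2 h ltac:(lra)). specialize (L3 h ltac:(lra)). specialize (D' h ltac:(lra)).
  pose proof (vnorm_ge0 V h) as nh. set (q := vadd V p h) in *.
  set (k := (f1 q - f1 p, f2 q - f2 p, f3 q - f3 p)%cc : C3).
  assert (hk : n3 k <= K * vnorm V h) by (unfold n3, k, K; lra).
  assert (hk2 : n3 k < dg).
  { eapply Rle_lt_trans; [apply hk|]. apply Rlt_le_trans with (K * d4); [apply Rmult_lt_compat_l; lra|].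
    unfold d4. apply Req_le. field. lra. }
  specialize (G' k hk2). rewrite hm in G'.
  assert (e : vadd VC3 (F p) k = F q).
  { unfold k, f1, f2, f3. simpl. destruct (F p) as [[x y] z], (F q) as [[x' y'] z']. unfold add3; cbn [fst snd]. repeat f_equal; ring. }
  rewrite e in G'. change (fst (fst k)) with (f1 q - f1 p)%cc in G'. change (snd (fst k)) with (f2 q - f2 p)%cc in G'. change (snd k) with (f3 q - f3 p)%cc in G'.
  replace (g (F q) - g (F p) - l h)%cc with
    ((g (F q) - g (F p) - (a * (f1 q - f1 p) + b * (f2 q - f2 p) + c * (f3 q - f3 p)))
     + (a * f1 q + b * f2 q + c * f3 q - (a * f1 p + b * f2 p + c * f3 p) - l h))%cc by ring.
  eapply Rle_trans; [apply Cabs_tri|].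
  assert (eps / (2 * K) * n3 k <= eps / 2 * vnorm V h).
  { apply Rle_trans with (eps / (2 * K) * (K * vnorm V h)).
    - apply Rmult_le_compat_l; auto. left; apply Rdiv_lt_0_compat; lra.
    - apply Req_le; field; lra. }
  change (vnorm VC3 k) with (n3 k) in G'. lra.
Qed.

Lemma Dif_comp2 (V : nspace) (g : C2 -> CC) (f1 f2 : V -> CC) (p : V) :
  Dif2 g (f1 p, f2 p) -> Dif V f1 p -> Dif V f2 p -> Dif V (fun x => g (f1 x, f2 x)) p.
Proof.
  intros [l [(a & b & hl) G]] D1 D2.
  apply (Dif_comp3 V (fun t : C3 => g (fst t)) (fun x => (f1 x, f2 x, C0))); [|exact D1|exact D2|exact (Dif_const V C0 p)].
  exists (fun h => l (fst h)). split; [exists a, b, C0; intros [[h1 h2] h3]; cbn [fst snd]; rewrite hl; cbn [fst snd]; ring|].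
  intros eps he. destruct (G eps he) as [d [hd G']]. exists d. split; auto.
  intros [[h1 h2] h3] hh. pose proof (Cabs_ge0 h3). simpl in hh.
  specialize (G' (h1, h2)). simpl in G' |- *. unfold n2, add2 in *; simpl in *.
  eapply Rle_trans; [apply G'; lra|]. apply Rmult_le_compat_l; lra.
Qed.

Lemma Dif2_fst p : Dif2 fst p.
Proof.
  apply (Dif_lin VC2). exists C1, C0; intro; ring. intros; reflexivity.
Qed.

Lemma Dif2_snd p : Dif2 snd p.
Proof.
  apply (Dif_lin VC2). exists C0, C1; intro; ring. intros; reflexivity.
Qed.

Lemma Dif1_id z : Dif1 (fun x => x) z.
Proof. apply (Dif_lin VC1). exists C1; intro; ring. intros; reflexivity. Qed.

Lemma Dif_comp1 (V : nspace) (g : CC -> CC) (f : V -> CC) (p : V) :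
  Dif1 g (f p) -> Dif V f p -> Dif V (fun x => g (f x)) p.
Proof.
  intros [m [[a hm] G]] D1.
  apply (Dif_comp2 V (fun s => g (fst s)) f (fun _ => C0)); auto using Dif_const.
  exists (fun h : C2 => a * fst h)%cc. split.
  - exists a, C0; intro; ring.
  - intros eps he. destruct (G eps he) as [d [hd G']]. exists d; split; auto.
    intros h hh. simpl in hh. unfold n2 in hh. pose proof (Cabs_ge0 (fst h)). pose proof (Cabs_ge0 (snd h)).
    specialize (G' (fst h)). simpl in *. rewrite hm in G'. unfold n2. specialize (G' ltac:(lra)). nra.
Qed.

Lemma Dif2_mul p : Dif2 (fun s => fst s * snd s)%cc p.
Proof.
  destruct p as [a b].
  exists (fun h : C2 => b * fst h + a * snd h)%cc. split.
  - exists b, a; reflexivity.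
  - intros eps he. exists eps; split; auto. intros [h k] hh. simpl in *. unfold n2 in *; simpl in *.
    replace ((a + h) * (b + k) - a * b - (b * h + a * k))%cc with (h * k)%cc by ring.
    rewrite Cabs_mul. pose proof (Cabs_ge0 h); pose proof (Cabs_ge0 k); nra.
Qed.

Lemma Dif_mul (V : nspace) (f g : V -> CC) (p : V) :
  Dif V f p -> Dif V g p -> Dif V (fun x => f x * g x)%cc p.
Proof. intros H G. apply (Dif_comp2 V (fun s => fst s * snd s)%cc f g p); auto using Dif2_mul. Qed.

Lemma Dif1_intro (g : CC -> CC) (z a : CC) (K del : R) : 0 < del ->
  (forall h, Cabs h < del -> Cabs (g (z + h)%cc - g z - a * h) <= K * (Cabs h * Cabs h)) -> Dif1 g z.
Proof.
  intros hd H. exists (fun h => a * h)%cc. split; [exists a; reflexivity|].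
  intros eps he. exists (Rmin del (eps / (Rabs K + 1))). pose proof (Rabs_pos K). split.
  - apply Rmin_pos; auto. apply Rdiv_lt_0_compat; lra.
  - intros h hh. rmin del (eps / (Rabs K + 1)).
    simpl in *. eapply Rle_trans; [apply H; lra|].
    pose proof (Cabs_ge0 h). rewrite <- Rmult_assoc. apply Rmult_le_compat_r; auto.
    apply Rle_trans with ((Rabs K + 1) * (eps / (Rabs K + 1))).
    + pose proof (Rle_abs K). apply Rle_trans with ((Rabs K + 1) * Cabs h); [nra|].
      apply Rmult_le_compat_l; lra.
    + apply Req_le; field; lra.
Qed.

Lemma Dif1_cexp z : Dif1 cexp z.
Proof.
  apply (Dif1_intro _ z (cexp z) (Cabs (cexp z) * 8) (1/2)); [lra|]. intros h hh.
  rewrite cexp_add. replace (cexp z * cexp h - cexp z - cexp z * h)%cc with (cexp z * (cexp h - 1 - h))%cc by ring.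
  rewrite Cabs_mul, Rmult_assoc. apply Rmult_le_compat_l; [apply Cabs_ge0|]. apply cexp_quad; lra.
Qed.

Lemma Dif1_inv z : z <> C0 -> Dif1 Cinv z.
Proof.
  intro hz. pose proof (Cabs_pos z hz) as h0.
  apply (Dif1_intro _ z (- (Cinv z * Cinv z))%cc (2 / (Cabs z * Cabs z * Cabs z)) (Cabs z / 2)); [lra|].
  intros h hh.
  assert (g : Cabs z / 2 <= Cabs (z + h)).
  { pose proof (Cabs_tri_rev z (- h)) as t. replace (z - - h)%cc with (z + h)%cc in t by ring.
    rewrite Cabs_opp in t. lra. }
  assert (hn : (z + h)%cc <> C0) by (apply Cabs_neq0; lra).
  replace (Cinv (z + h) - Cinv z - - (Cinv z * Cinv z) * h)%cc with (h * h / (z * z * (z + h)))%cc by (field; auto).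
  rewrite Cabs_div by (repeat apply Cmul_neq0; auto). rewrite !Cabs_mul.
  pose proof (Cabs_ge0 h).
  apply (Rmult_le_reg_r (Cabs z * Cabs z * Cabs (z + h))); [repeat apply Rmult_lt_0_compat; lra|].
  unfold Rdiv at 1; rewrite Rmult_assoc, Rinv_l by (repeat apply Rmult_integral_contrapositive_currified; lra).
  apply Rle_trans with (2 / (Cabs z * Cabs z * Cabs z) * (Cabs h * Cabs h) * (Cabs z * Cabs z * (Cabs z / 2))).
  - apply Req_le. field. lra.
  - apply Rmult_le_compat_l.
    + apply Rmult_le_pos; [|nra]. left; apply Rdiv_lt_0_compat; [lra|]. repeat apply Rmult_lt_0_compat; lra.
    + apply Rmult_le_compat_l; [nra|lra].
Qed.

Lemma Dif_inv (V : nspace) (f : V -> CC) (p : V) : f p <> C0 -> Dif V f p -> Dif V (fun x => Cinv (f x)) p.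
Proof. intros h H. apply Dif_comp1; auto using Dif1_inv. Qed.

Lemma Dif_div (V : nspace) (f g : V -> CC) (p : V) :
  g p <> C0 -> Dif V f p -> Dif V g p -> Dif V (fun x => f x / g x)%cc p.
Proof. intros h H G. apply (Dif_mul V f (fun x => Cinv (g x))); auto using Dif_inv. Qed.

Lemma Dif1_csqrt w : 0 < fst (csqrt w) -> Dif1 csqrt w.
Proof.
  intro hp. set (s := csqrt w). set (c := fst s). fold s in hp. fold c in hp.
  assert (hs : c <= Cabs s) by (pose proof (Cabs_fst s) as g; rewrite Rabs_right in g; unfold c in *; lra).
  assert (hsn : s <> C0) by (apply Cabs_neq0; lra).
  apply (Dif1_intro _ w (Cinv (2 * s)) (/ (c * c * c)) 1); [lra|].
  intros h _. fold s. set (t := csqrt (w + h)%cc).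
  assert (ht : Cabs (t - s) <= Cabs h / c).
  { pose proof (csqrt_lip (w + h) w hp) as g. replace (w + h - w)%cc with h in g by ring. exact g. }
  assert (e : h = ((t - s) * (t + s))%cc).
  { replace ((t - s) * (t + s))%cc with (t * t - s * s)%cc by ring.
    unfold t, s. rewrite !csqrt_sq. ring. }
  pose proof two_neq0.
  replace (t - s - Cinv (2 * s) * h)%cc with (- ((t - s) * (t - s)) / (2 * s))%cc by (rewrite e; field; auto).
  rewrite Cabs_div by (apply Cmul_neq0; auto). rewrite Cabs_opp, !Cabs_mul, Cabs_2.
  pose proof (Cabs_ge0 (t - s)%cc). pose proof (Cabs_ge0 h).
  apply Rle_trans with (Cabs (t - s) * Cabs (t - s) / c).
  - apply Rmult_le_compat_l; [nra|]. apply Rinv_le_contravar; lra.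
  - apply Rle_trans with ((Cabs h / c) * (Cabs h / c) / c).
    + apply Rmult_le_compat_r; [left; apply Rinv_0_lt_compat; auto|]. apply Rmult_le_compat; auto.
    + apply Req_le. field. lra.
Qed.

(** The quadratic bound for [cexp] at the increment [l] of the logarithm is also one for [clog],
    because [l] is [O(h)]. *)
Lemma Dif1_clog w : Cabs (w - 1) < 1/8 -> Dif1 clog w.
Proof.
  intro h0. pose proof (fst_close w).
  assert (hw : 7/8 <= Cabs w) by (pose proof (Cabs_fst w) as g; rewrite Rabs_right in g; lra).
  assert (n0 : w <> C0) by (apply Cabs_neq0; lra).
  apply (Dif1_intro _ w (Cinv w) (8 * (8 * 8)  * 4) (Rmin (1/128) (1/8 - Cabs (w - 1)))).
  { apply Rmin_pos; lra. }
  intros h hh. rmin (1/128) (1/8 - Cabs (w - 1)).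
  assert (h1 : Cabs (w + h - 1) <= 1/8).
  { replace (w + h - 1)%cc with ((w - 1) + h)%cc by ring. eapply Rle_trans; [apply Cabs_tri|]. lra. }
  destruct (clog_sub (w + h) w h1 ltac:(lra)) as [e [g1 g2]]. rewrite e.
  replace (w + h - w)%cc with h in g2 by ring.
  set (q := ((w + h) / w)%cc) in *. set (l := clog q).
  assert (hl : Cabs l <= 8 * Cabs h) by (pose proof (clog_bound q g1); unfold l; lra).
  assert (eq : cexp l = q) by (apply cexp_clog; pose proof (fst_close q); lra).
  pose proof (cexp_quad l ltac:(lra)) as g. rewrite eq in g.
  replace (q - 1 - l)%cc with (- (l - Cinv w * h))%cc in g by (unfold q; field; auto).
  rewrite Cabs_opp in g. eapply Rle_trans; [exact g|].
  pose proof (Cabs_ge0 l). pose proof (Cabs_ge0 h). nra.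
Qed.

Lemma Dif_sqrt (V : nspace) (f : V -> CC) (p : V) :
  0 < fst (csqrt (f p)) -> Dif V f p -> Dif V (fun x => csqrt (f x)) p.
Proof. intros h H. apply Dif_comp1; auto using Dif1_csqrt. Qed.

Lemma Dif1_jouk_inv z : 0 < fst (csqrt (1 - 4 * (z * z))%cc) -> Dif1 jouk_inv z.
Proof.
  intro h. unfold jouk_inv. apply Dif_div; [apply one_add_csqrt_neq0| |].
  - apply Dif_mul; [apply Dif_const|apply Dif1_id].
  - apply (Dif_add VC1 (fun _ => C1)); [apply Dif_const|].
    apply Dif_sqrt; auto. apply (Dif_sub VC1 (fun _ => C1)); [apply Dif_const|].
    apply (Dif_mul VC1 (fun _ => (4)%cc)); [apply Dif_const|]. apply (Dif_mul VC1 (fun x => x)); apply Dif1_id.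
Qed.

Lemma Dif_pow (V : nspace) (f : V -> CC) (p : V) n : Dif V f p -> Dif V (fun x => Cpow (f x) n) p.
Proof.
  intro H. induction n as [|n IH]; simpl; [apply Dif_const|]. apply (Dif_mul V f); auto.
Qed.

(** * Geometric convergence; differentiability of limits and of inverses *)

Definition half (n : nat) : R := (1/2) ^ n.

Lemma half_pos n : 0 < half n.
Proof. apply pow_lt; lra. Qed.

Lemma half_S n : half (S n) = half n / 2.
Proof. unfold half; simpl; lra. Qed.

Lemma half_0 : half 0 = 1.
Proof. reflexivity. Qed.

Lemma half_small c eps : 0 <= c -> 0 < eps -> exists n, c * half n < eps.
Proof.
  intros hc he. destruct (pow_lt_1_zero (1/2)) with (y := eps / (c + 1)) as [n hn].
  - rewrite Rabs_right; lra.
  - apply Rdiv_lt_0_compat; lra.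
  - exists n. specialize (hn n (Nat.le_refl n)). pose proof (half_pos n).
    change ((1/2)^n) with (half n) in hn. rewrite Rabs_right in hn by lra.
    apply Rle_lt_trans with ((c + 1) * half n); [nra|].
    replace eps with ((c + 1) * (eps / (c + 1))) by (field; lra). apply Rmult_lt_compat_l; lra.
Qed.

Lemma geo_cauchy (u : nat -> CC) c : (forall n, Cabs (u (S n) - u n) <= c * half n) ->
  forall n k, Cabs (u (n + k)%nat - u n) <= 2 * c * half n.
Proof.
  intros H n k.
  assert (hc : 0 <= c) by (pose proof (H 0%nat); pose proof (Cabs_ge0 (u 1%nat - u 0%nat)%cc); rewrite half_0 in *; lra).
  (* Subtracting the tail beyond [n + k] makes the bound inductive. *)
  enough (g : Cabs (u (n + k)%nat - u n) <= 2 * c * half n - 2 * c * half (n + k)).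
  { pose proof (half_pos (n + k)). nra. }
  induction k as [|k IH].
  - rewrite Nat.add_0_r. replace (u n - u n)%cc with C0 by ring. rewrite Cabs_C0; lra.
  - replace (n + S k)%nat with (S (n + k)) by lia. rewrite half_S.
    replace (u (S (n + k)) - u n)%cc with ((u (S (n + k)) - u (n + k)%nat) + (u (n + k)%nat - u n))%cc by ring.
    eapply Rle_trans; [apply Cabs_tri|]. specialize (H (n + k)%nat). lra.
Qed.

Lemma real_geo_limit (u : nat -> R) c : 0 <= c -> (forall n k, Rabs (u (n + k)%nat - u n) <= c * half n) ->
  exists l, forall n, Rabs (u n - l) <= c * half n.
Proof.
  intros hc H. destruct (R_complete u) as [l hl].
  - intros eps he. destruct (half_small (2 * c) eps) as [N hN]; [lra|lra|].
    exists N. intros n m hn hm. unfold Rdist.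
    pose proof (H N (n - N)%nat) as g1. pose proof (H N (m - N)%nat) as g2.
    replace (N + (n - N))%nat with n in g1 by lia. replace (N + (m - N))%nat with m in g2 by lia.
    apply Rabs_le_inv in g1. apply Rabs_le_inv in g2. apply Rabs_def1; lra.
  - exists l. intros n. apply Rnot_lt_le. intro hlt.
    set (e := Rabs (u n - l) - c * half n) in *.
    destruct (hl e) as [N hN]; [unfold e; lra|].
    specialize (hN (n + N)%nat ltac:(lia)). unfold Rdist in hN. pose proof (H n N) as g.
    pose proof (Rabs_triang (u n - u (n + N)%nat) (u (n + N)%nat - l)) as t.
    replace (u n - u (n + N)%nat + (u (n + N)%nat - l)) with (u n - l) in t by ring.
    rewrite (Rabs_minus_sym (u n) (u (n + N)%nat)) in t. unfold e in *. lra.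
Qed.

Lemma geo_limit (u : nat -> CC) c : (forall n, Cabs (u (S n) - u n) <= c * half n) ->
  exists l, forall n, Cabs (u n - l) <= 4 * c * half n.
Proof.
  intros H. pose proof (geo_cauchy u c H) as G.
  assert (hc : 0 <= c) by (pose proof (H 0%nat); pose proof (Cabs_ge0 (u 1%nat - u 0%nat)%cc); rewrite half_0 in *; lra).
  destruct (real_geo_limit (fun n => fst (u n)) (2 * c)) as [a ha]; [lra| |].
  { intros n k. eapply Rle_trans; [|apply (G n k)].
    replace (fst (u (n + k)%nat) - fst (u n)) with (fst (u (n + k)%nat - u n)%cc) by (unfold Csub, Cadd, Copp; simpl; ring). apply Cabs_fst. }
  destruct (real_geo_limit (fun n => snd (u n)) (2 * c)) as [b hb]; [lra| |].
  { intros n k. eapply Rle_trans; [|apply (G n k)].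
    replace (snd (u (n + k)%nat) - snd (u n)) with (snd (u (n + k)%nat - u n)%cc) by (unfold Csub, Cadd, Copp; simpl; ring). apply Cabs_snd. }
  exists (a, b). intro n. eapply Rle_trans; [apply Cabs_le_sum|]. unfold Csub, Cadd, Copp; simpl.
  specialize (ha n). specialize (hb n). unfold Rminus in *. lra.
Qed.

Lemma Cabs_mul_small (a : CC) (M : R) :
  (exists del, 0 < del /\ forall t, Cabs t < del -> Cabs (a * t) <= M * Cabs t) -> Cabs a <= M.
Proof.
  intros [d [hd H]]. specialize (H (CR (d / 2))). rewrite Cabs_mul, Cabs_CR, Rabs_right in H by lra.
  specialize (H ltac:(lra)). nra.
Qed.

Lemma n2_fst (a : CC) : n2 (a, C0) = Cabs a.
Proof. unfold n2; simpl; rewrite Cabs_C0; ring. Qed.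

Lemma n2_snd (a : CC) : n2 (C0, a) = Cabs a.
Proof. unfold n2; simpl; rewrite Cabs_C0; ring. Qed.

Lemma n2_ge0 h : 0 <= n2 h.
Proof. exact (vnorm_ge0 VC2 h). Qed.

(* Only Lipschitz control of the remainders at the base point is needed: it forces the differentials to converge. *)
Lemma Dif2_limit (f : C2 -> CC) (g : nat -> C2 -> CC) (p : C2) (c del : R) :
  0 < del -> 0 <= c -> (forall n, Dif2 (g n) p) ->
  (forall n h, n2 h < del -> Cabs ((f (add2 p h) - g n (add2 p h)) - (f p - g n p)) <= c * half n * n2 h) ->
  Dif2 f p.
Proof.
  intros hd hc D H.
  assert (D' : forall n, { ab : CC * CC | forall eps, 0 < eps -> exists del, 0 < del /\ forall h, n2 h < del ->
     Cabs (g n (add2 p h) - g n p - (fst ab * fst h + snd ab * snd h)) <= eps * n2 h}).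
  { intro n. apply constructive_indefinite_description. destruct (D n) as [l [[a [b hl]] K]].
    exists (a, b). intros eps he. destruct (K eps he) as [d [hd' K']]. exists d; split; auto.
    intros h hh. cbn [fst snd]. rewrite <- hl. apply K'; auto. }
  set (A := fun n => fst (proj1_sig (D' n))). set (B := fun n => snd (proj1_sig (D' n))).
  assert (E : forall n eps, 0 < eps -> exists del, 0 < del /\ forall h, n2 h < del ->
     Cabs (g n (add2 p h) - g n p - (A n * fst h + B n * snd h)) <= eps * n2 h).
  { intro n. exact (proj2_sig (D' n)). }
  clearbody A B. clear D D'.
  (* Consecutive differentials differ by [O(half n)]: on small increments they approximate [g n] and
     [g (S n)], whose difference has the Lipschitz constant given by [H]. *)
  assert (L : forall n, exists d, 0 < d /\ forall h, n2 h < d ->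
     Cabs ((A (S n) * fst h + B (S n) * snd h) - (A n * fst h + B n * snd h)) <= (2 + 2 * c) * half n * n2 h).
  { intro n. pose proof (half_pos n) as hn.
    destruct (E n _ hn) as [d1 [hd1 E1]]. destruct (E (S n) _ hn) as [d2 [hd2 E2]].
    exists (Rmin del (Rmin d1 d2)). split; [repeat apply Rmin_pos; auto|]. intros h hh.
    rmin del (Rmin d1 d2).
    rmin d1 d2.
    specialize (E1 h ltac:(lra)). specialize (E2 h ltac:(lra)).
    pose proof (H n h ltac:(lra)) as U1. pose proof (H (S n) h ltac:(lra)) as U2. rewrite half_S in U2.
    set (q := add2 p h) in *. set (l1 := (A n * fst h + B n * snd h)%cc) in *. set (l2 := (A (S n) * fst h + B (S n) * snd h)%cc) in *.
    replace (l2 - l1)%cc with ((g n q - g n p - l1) - (g (S n) q - g (S n) p - l2)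
       + ((f q - g n q - (f p - g n p)) - (f q - g (S n) q - (f p - g (S n) p))))%cc by ring.
    eapply Rle_trans; [apply Cabs_tri|].
    eapply Rle_trans; [apply Rplus_le_compat; apply Cabs_sub_tri|]. pose proof (n2_ge0 h).
    assert (0 <= c * half n * n2 h) by (repeat apply Rmult_le_pos; lra). nra. }
  assert (LA : forall n, Cabs (A (S n) - A n) <= (2 + 2 * c) * half n).
  { intro n. apply Cabs_mul_small. destruct (L n) as [d [hd' L']]. exists d; split; auto.
    intros t ht. specialize (L' (t, C0)). rewrite n2_fst in L'. specialize (L' ht). cbn [fst snd] in L'.
    eapply Rle_trans; [|exact L']. apply Req_le. f_equal. ring. }
  assert (LB : forall n, Cabs (B (S n) - B n) <= (2 + 2 * c) * half n).
  { intro n. apply Cabs_mul_small. destruct (L n) as [d [hd' L']]. exists d; split; auto.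
    intros t ht. specialize (L' (C0, t)). rewrite n2_snd in L'. specialize (L' ht). cbn [fst snd] in L'.
    eapply Rle_trans; [|exact L']. apply Req_le. f_equal. ring. }
  destruct (geo_limit A _ LA) as [a ha]. destruct (geo_limit B _ LB) as [b hb].
  exists (fun h => a * fst h + b * snd h)%cc. split; [exists a, b; reflexivity|].
  intros eps he.
  destruct (half_small (c + 8 * (2 + 2 * c)) (eps / 2)) as [n hn]; [lra|lra|].
  destruct (E n (eps / 2) ltac:(lra)) as [d [hd' E']].
  exists (Rmin del d). split; [apply Rmin_pos; auto|]. intros h hh. simpl vnorm in *. simpl vadd.
  rmin del d.
  specialize (E' h ltac:(lra)). specialize (H n h ltac:(lra)). specialize (ha n). specialize (hb n).
  set (q := add2 p h) in *.
  replace (f q - f p - (a * fst h + b * snd h))%cc with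
    ((f q - g n q - (f p - g n p)) + ((g n q - g n p - (A n * fst h + B n * snd h)) + ((A n - a) * fst h + (B n - b) * snd h)))%cc by ring.
  eapply Rle_trans; [apply Cabs_tri|]. eapply Rle_trans; [apply Rplus_le_compat_l, Cabs_tri|].
  eapply Rle_trans; [apply Rplus_le_compat_l, Rplus_le_compat_l, Cabs_tri|].
  rewrite !Cabs_mul.
  assert (Cabs (A n - a) * Cabs (fst h) + Cabs (B n - b) * Cabs (snd h) <= 8 * (2 + 2 * c) * half n * n2 h).
  { unfold n2. pose proof (half_pos n).
    pose proof (Rmult_le_compat_r _ _ _ (Cabs_ge0 (fst h)) ha). pose proof (Rmult_le_compat_r _ _ _ (Cabs_ge0 (snd h)) hb).
    assert (0 <= (2 + 2 * c) * half n * (Cabs (fst h) + Cabs (snd h))).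
    { pose proof (Cabs_ge0 (fst h)). pose proof (Cabs_ge0 (snd h)). repeat apply Rmult_le_pos; lra. }
    lra. }
  pose proof (Rmult_le_compat_r _ _ _ (n2_ge0 h) (Rlt_le _ _ hn)). lra.
Qed.

Lemma lin2_small (a b : CC) :
  (forall eps, 0 < eps -> exists del, 0 < del /\ forall h, n2 h < del -> Cabs (a * fst h + b * snd h) <= eps * n2 h) ->
  a = C0 /\ b = C0.
Proof.
  intro H. split; apply Cabs_eq0; apply Rle_antisym; try apply Cabs_ge0;
    apply Rnot_lt_le; intro hlt.
  - destruct (H (Cabs a / 2) ltac:(lra)) as [d [hd K]].
    enough (Cabs a <= Cabs a / 2) by lra. apply Cabs_mul_small. exists d; split; auto. intros t ht.
    specialize (K (t, C0)). rewrite n2_fst in K. specialize (K ht). cbn [fst snd] in K.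
    eapply Rle_trans; [|exact K]. apply Req_le; f_equal; ring.
  - destruct (H (Cabs b / 2) ltac:(lra)) as [d [hd K]].
    enough (Cabs b <= Cabs b / 2) by lra. apply Cabs_mul_small. exists d; split; auto. intros t ht.
    specialize (K (C0, t)). rewrite n2_snd in K. specialize (K ht). cbn [fst snd] in K.
    eapply Rle_trans; [|exact K]. apply Req_le; f_equal; ring.
Qed.

Definition sub2 (p q : C2) : C2 := (fst p - fst q, snd p - snd q)%cc.

Lemma add2_sub2 p q : add2 q (sub2 p q) = p.
Proof. destruct p, q; unfold add2, sub2; simpl; f_equal; ring. Qed.

(* A Lipschitz right inverse forces the differential to be invertible. *)
Lemma Dif2_inverse (P1 P2 : C2 -> CC) (G : C2 -> C2) (t0 : C2) (K del : R) :
  0 < del -> 0 <= K -> Dif2 P1 (G t0) -> Dif2 P2 (G t0) ->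
  (forall k, n2 k < del -> n2 (sub2 (G (add2 t0 k)) (G t0)) <= K * n2 k) ->
  (forall k, n2 k < del -> P1 (G (add2 t0 k)) = fst (add2 t0 k) /\ P2 (G (add2 t0 k)) = snd (add2 t0 k)) ->
  Dif2 (fun t => fst (G t)) t0 /\ Dif2 (fun t => snd (G t)) t0.
Proof.
  intros hd hK D1 D2 L I.
  set (s0 := G t0) in *.
  assert (I0 : P1 s0 = fst t0 /\ P2 s0 = snd t0).
  { specialize (I (C0, C0)). replace (add2 t0 (C0, C0)) with t0 in I by (symmetry; apply (vadd_0 VC2)).
    apply I. rewrite n2_fst, Cabs_C0; auto. }
  (* Since [G] is Lipschitz, an error [o(h)] in the increment [h] of [G] is an error [o(k)] in the
     increment [k] of [t0]. *)
  assert (key : forall P a b j, (forall eps, 0 < eps -> exists del, 0 < del /\ forall h, n2 h < del ->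
       Cabs (P (add2 s0 h) - P s0 - (a * fst h + b * snd h)) <= eps * n2 h) ->
     (forall k, n2 k < del -> (P (G (add2 t0 k)) - P s0 = j k)%cc) ->
     forall eps, 0 < eps -> exists d, 0 < d /\ forall k, n2 k < d ->
       Cabs (j k - (a * (fst (G (add2 t0 k)) - fst s0) + b * (snd (G (add2 t0 k)) - snd s0))) <= eps * n2 k).
  { intros P a b j H J eps he. destruct (H (eps / (K + 1))) as [d [hd' H']]; [apply Rdiv_lt_0_compat; lra|].
    exists (Rmin del (d / (K + 1))). split; [apply Rmin_pos; auto; apply Rdiv_lt_0_compat; lra|].
    intros k hk. rmin del (d / (K + 1)).
    specialize (L k ltac:(lra)). specialize (J k ltac:(lra)). pose proof (n2_ge0 k).
    set (h := sub2 (G (add2 t0 k)) s0) in *.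
    assert (hh : n2 h < d).
    { apply Rle_lt_trans with ((K + 1) * n2 k); [nra|].
      replace d with ((K + 1) * (d / (K + 1))) by (field; lra). apply Rmult_lt_compat_l; lra. }
    specialize (H' h hh). unfold h in H' at 1. rewrite add2_sub2, J in H'.
    change (fst h) with (fst (G (add2 t0 k)) - fst s0)%cc in H'. change (snd h) with (snd (G (add2 t0 k)) - snd s0)%cc in H'.
    eapply Rle_trans; [exact H'|].
    apply Rle_trans with (eps / (K + 1) * ((K + 1) * n2 k)).
    - apply Rmult_le_compat_l; [left; apply Rdiv_lt_0_compat; lra|nra].
    - apply Req_le; field; lra. }
  destruct D1 as [l1 [[a1 [b1 e1]] D1]]. destruct D2 as [l2 [[a2 [b2 e2]] D2]].
  assert (K1 := key P1 a1 b1 fst). assert (K2 := key P2 a2 b2 snd). clear key.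
  assert (K1' := K1 ltac:(intros eps he; destruct (D1 eps he) as [d [hd' D]]; exists d; split; auto; intros h hh; rewrite <- e1; apply D; auto)
     ltac:(intros k hk; destruct (I k hk) as [-> _]; destruct I0 as [-> _]; simpl; ring)).
  assert (K2' := K2 ltac:(intros eps he; destruct (D2 eps he) as [d [hd' D]]; exists d; split; auto; intros h hh; rewrite <- e2; apply D; auto)
     ltac:(intros k hk; destruct (I k hk) as [_ ->]; destruct I0 as [_ ->]; simpl; ring)).
  clear K1 K2 D1 D2 I I0 L.
  set (g1 := fun k => (fst (G (add2 t0 k)) - fst s0)%cc) in *. set (g2 := fun k => (snd (G (add2 t0 k)) - snd s0)%cc) in *.
  assert (comb : forall u v eps, 0 < eps -> exists d, 0 < d /\ forall k, n2 k < d ->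
     Cabs ((u * fst k + v * snd k) - ((u * a1 + v * a2) * g1 k + (u * b1 + v * b2) * g2 k)) <= eps * n2 k).
  { intros u v eps he. pose proof (Cabs_ge0 u). pose proof (Cabs_ge0 v).
    set (c := Cabs u + Cabs v + 1).
    assert (hc : 0 < eps / c) by (apply Rdiv_lt_0_compat; unfold c; lra).
    destruct (K1' _ hc) as [d1 [hd1 L1]]. destruct (K2' _ hc) as [d2 [hd2 L2]].
    exists (Rmin d1 d2). split; [apply Rmin_pos; auto|]. intros k hk.
    rmin d1 d2.
    specialize (L1 k ltac:(lra)). specialize (L2 k ltac:(lra)). fold (g1 k) (g2 k) in L1, L2.
    replace (_ - _)%cc with (u * (fst k - (a1 * g1 k + b1 * g2 k)) + v * (snd k - (a2 * g1 k + b2 * g2 k)))%cc by ring.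
    eapply Rle_trans; [apply Cabs_tri|]. rewrite !Cabs_mul. pose proof (n2_ge0 k).
    apply Rle_trans with ((Cabs u + Cabs v) * (eps / c * n2 k)); [nra|].
    apply Rle_trans with (c * (eps / c * n2 k)).
    - apply Rmult_le_compat_r; [|unfold c; lra]. apply Rmult_le_pos; lra.
    - apply Req_le. unfold c. field. lra. }
  (* If a row vector [(u, v)] kills the matrix of differentials, [comb] makes [u k_1 + v k_2] an
     [o(k)], hence [u = v = 0]. When [det] vanishes, [(b2, - b1)] and [(a2, - a1)] are such vectors,
     so the matrix is zero, and then [(1, 1)] is one too. *)
  set (det := (a1 * b2 - a2 * b1)%cc).
  assert (hdet : det <> C0).
  { intro h0.
    assert (z : forall u v, (u * a1 + v * a2 = 0)%cc -> (u * b1 + v * b2 = 0)%cc -> u = C0 /\ v = C0).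
    { intros u v hu hv. apply lin2_small. intros eps he. destruct (comb u v eps he) as [d [hd' C]].
      exists d; split; auto. intros k hk. specialize (C k hk). rewrite hu, hv in C.
      replace (u * fst k + v * snd k - (0 * g1 k + 0 * g2 k))%cc with (u * fst k + v * snd k)%cc in C by ring. exact C. }
    destruct (z b2 (- b1)%cc) as [y1 y2]; [rewrite <- h0; unfold det; ring|ring|].
    destruct (z a2 (- a1)%cc) as [y3 y4]; [ring|replace C0 with (- (0))%cc by ring; rewrite <- h0; unfold det; ring|].
    assert (b1 = C0) by (replace b1 with (- - b1)%cc by ring; rewrite y2; ring).
    assert (a1 = C0) by (replace a1 with (- - a1)%cc by ring; rewrite y4; ring).
    subst. destruct (z C1 C1) as [y _]; [ring|ring|]. apply C1_neq0; auto. }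
  split.
  - exists (fun k => (b2 / det) * fst k + (- b1 / det) * snd k)%cc. split; [eexists; eexists; reflexivity|].
    intros eps he. destruct (comb (b2 / det)%cc (- b1 / det)%cc eps he) as [d [hd' C]]. exists d; split; auto.
    intros k hk. specialize (C k hk). simpl vnorm. simpl vadd. eapply Rle_trans; [|exact C]. apply Req_le.
    rewrite <- Cabs_opp. f_equal. fold s0. unfold g1, g2, det. field. exact hdet.
  - exists (fun k => (- a2 / det) * fst k + (a1 / det) * snd k)%cc. split; [eexists; eexists; reflexivity|].
    intros eps he. destruct (comb (- a2 / det)%cc (a1 / det)%cc eps he) as [d [hd' C]]. exists d; split; auto.
    intros k hk. specialize (C k hk). simpl vnorm. simpl vadd. eapply Rle_trans; [|exact C]. apply Req_le.
    rewrite <- Cabs_opp. f_equal. fold s0. unfold g1, g2, det. field. exact hdet.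
Qed.

Lemma holo2_of_Dif (O : C2 -> Prop) (g : C2 -> CC) : open2 O -> (forall p, O p -> Dif2 g p) -> holo2 O g.
Proof.
  intros hO H. split; auto. intros p hp. destruct (H p hp) as [l [[a [b e]] D]].
  exists a, b. intros eps he. destruct (D eps he) as [d [hd D']]. exists d; split; auto.
  intros h hh _. rewrite <- e. apply D'; auto.
Qed.

Lemma holo3_of_Dif (O : C3 -> Prop) (g : C3 -> CC) : open3 O -> (forall p, O p -> Dif3 g p) -> holo3 O g.
Proof.
  intros hO H. split; auto. intros p hp. destruct (H p hp) as [l [[a [b [c e]]] D]].
  exists a, b, c. intros eps he. destruct (D eps he) as [d [hd D']]. exists d; split; auto.
  intros [[h1 h2] h3] hh _. specialize (D' (h1, h2, h3) hh). rewrite e in D'. exact D'.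
Qed.

(** * Functions with multiplicative Lipschitz bounds near the axes *)

Definition axprod (s : C2) : R := Cabs (fst s) * Cabs (snd s).
Definition axes_nbhd (r e : R) (s : C2) : Prop := Cabs (fst s) < r /\ Cabs (snd s) < r /\ axprod s < e.
Definition twist (s al : C2) : C2 := (fst s * cexp (fst al), snd s * cexp (snd al))%cc.

Lemma axprod_ge0 s : 0 <= axprod s.
Proof. apply Rmult_le_pos; apply Cabs_ge0. Qed.

Lemma axes_nbhd_mono r e r' e' s : r <= r' -> e <= e' -> axes_nbhd r e s -> axes_nbhd r' e' s.
Proof. unfold axes_nbhd; intros; repeat split; lra. Qed.

Lemma axes_nbhd_near r e s : r <= 1 -> axes_nbhd r e s -> near2 s (axes_nbhd r e).
Proof.
  intros hr (h1 & h2 & h3).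
  set (d := Rmin (Rmin (r - Cabs (fst s)) (r - Cabs (snd s))) ((e - axprod s) / 3)).
  exists d. split.
  - unfold d. repeat apply Rmin_pos; lra.
  - intros h hh. simpl in *.
    rmin (Rmin (r - Cabs (fst s)) (r - Cabs (snd s))) ((e - axprod s) / 3).
    rmin (r - Cabs (fst s)) (r - Cabs (snd s)).
    fold d in H, H0. unfold n2 in hh.
    pose proof (Cabs_ge0 (fst h)). pose proof (Cabs_ge0 (snd h)). pose proof (Cabs_ge0 (fst s)). pose proof (Cabs_ge0 (snd s)).
    pose proof (Cabs_tri (fst s) (fst h)) as t1. pose proof (Cabs_tri (snd s) (snd h)) as t2.
    unfold axes_nbhd, axprod, add2 in *; cbn [fst snd]. repeat split; try lra.
    apply Rle_lt_trans with ((Cabs (fst s) + d) * (Cabs (snd s) + d)).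
    + apply Rmult_le_compat; try apply Cabs_ge0; lra.
    + nra.
Qed.

Lemma axprod_twist s al : axprod (twist s al) = axprod s * Cabs (cexp (fst al)) * Cabs (cexp (snd al)).
Proof. unfold axprod, twist; cbn [fst snd]. rewrite !Cabs_mul. ring. Qed.

Definition one : C2 -> R := fun _ => 1.

(* Perturbations are multiplicative, [s |-> s exp al], because the maps of interest act on [al] almost linearly.
   With the weight [w] taken at both ends, no smallness of [al] is required. *)
Definition log_lip_on (w : C2 -> R) (M r e : R) (g : C2 -> CC) : Prop :=
  forall s, axes_nbhd r e s -> Cabs (g s) <= M * w s /\ Dif2 g s /\
    forall al, axes_nbhd r e (twist s al) -> Cabs (g (twist s al) - g s) <= M * (w s + w (twist s al)) * n2 al.

Definition log_lip (w : C2 -> R) (r : R) (g : C2 -> CC) : Prop :=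
  exists e M, 0 < e /\ 0 <= M /\ log_lip_on w M r e g.

(** The width [e] is chosen after [r]: no uniformity is claimed as [r] tends to 1. *)
Definition near_axes (r : R) (P : C2 -> Prop) : Prop := exists e, 0 < e /\ forall s, axes_nbhd r e s -> P s.

Lemma near_axes_and r (P Q : C2 -> Prop) : near_axes r P -> near_axes r Q -> near_axes r (fun s => P s /\ Q s).
Proof.
  intros [d [hd H]] [e [he G]]. exists (Rmin d e). split; [apply Rmin_pos; auto|].
  intros s hs. rmin d e.
  split; [apply H|apply G]; eapply axes_nbhd_mono; try eassumption; lra.
Qed.

Lemma near_axes_mono r (P Q : C2 -> Prop) : (forall s, P s -> Q s) -> near_axes r P -> near_axes r Q.
Proof. intros I [d [hd H]]. exists d; split; auto. Qed.

Lemma log_lip_on_mono w M r e M' e' g : (forall s, 0 <= w s) -> M <= M' -> e' <= e -> log_lip_on w M r e g -> log_lip_on w M' r e' g.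
Proof.
  intros hw hM he H s hs.
  destruct (H s) as (h1 & h2 & h3); [eapply axes_nbhd_mono; try eassumption; lra|].
  split; [|split; auto].
  - eapply Rle_trans; [apply h1|]. apply Rmult_le_compat_r; auto.
  - intros al hal. eapply Rle_trans; [apply h3; eapply axes_nbhd_mono; try eassumption; lra|].
    apply Rmult_le_compat_r; [apply n2_ge0|]. apply Rmult_le_compat_r; auto.
    pose proof (hw s). pose proof (hw (twist s al)). lra.
Qed.

Lemma one_ge0 s : 0 <= one s.
Proof. unfold one; lra. Qed.

Section Classes.
Variable r : R.
Hypothesis r_pos : 0 < r.
Hypothesis r_lt1 : r < 1.

Lemma log_lip_ext w f g : near_axes r (fun s => f s = g s) -> log_lip w r f -> log_lip w r g.
Proof.
  intros [e [he E]] (e' & M & he' & hM & H).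
  exists (Rmin e e'), M. split; [apply Rmin_pos; auto|]. split; auto.
  rmin e e'.
  assert (D1 : forall s, axes_nbhd r (Rmin e e') s -> axes_nbhd r e s) by (intros; eapply axes_nbhd_mono; try eassumption; lra).
  assert (D2 : forall s, axes_nbhd r (Rmin e e') s -> axes_nbhd r e' s) by (intros; eapply axes_nbhd_mono; try eassumption; lra).
  intros s hs. destruct (H s (D2 _ hs)) as (h1 & h2 & h3).
  rewrite <- E by auto. split; [exact h1|split].
  - apply (Dif_ext_near VC2 f); auto. apply (near_mono VC2 s (axes_nbhd r e)); auto. apply axes_nbhd_near; [lra|auto].
  - intros al hal. rewrite <- E by auto. auto.
Qed.

Lemma log_lip_const c : log_lip one r (fun _ => c).
Proof.
  exists 1, (Cabs c). pose proof (Cabs_ge0 c). split; [lra|split; [lra|]].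
  intros s _. unfold one. split; [lra|split; [apply (Dif_const VC2)|]].
  intros al _. replace (c - c)%cc with C0 by ring. rewrite Cabs_C0. pose proof (n2_ge0 al).
  repeat apply Rmult_le_pos; lra.
Qed.

Lemma twist_diff (a al : CC) : Cabs (a * cexp al - a) <= 2 * (Cabs a + Cabs (a * cexp al)) * Cabs al.
Proof.
  replace (a * cexp al - a)%cc with (a * (cexp al - 1))%cc by ring. rewrite !Cabs_mul.
  pose proof (cexp_m1_bound al). pose proof (Cabs_ge0 a).
  apply Rle_trans with (Cabs a * (2 * Cabs al * (1 + Cabs (cexp al)))); [apply Rmult_le_compat_l; auto|].
  apply Req_le; ring.
Qed.

Lemma log_lip_fst : log_lip one r fst.
Proof.
  exists 1, 2. split; [lra|split; [lra|]]. intros s (h1 & h2 & h3). unfold one.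
  split; [lra|split; [apply Dif2_fst|]]. intros al (g1 & g2 & g3).
  eapply Rle_trans; [apply twist_diff|]. cbn [fst twist] in g1. unfold n2.
  pose proof (Cabs_ge0 (fst al)). pose proof (Cabs_ge0 (snd al)).
  apply Rmult_le_compat; try lra. pose proof (Cabs_ge0 (fst s)). pose proof (Cabs_ge0 (fst s * cexp (fst al))%cc). lra.
Qed.

Lemma log_lip_snd : log_lip one r snd.
Proof.
  exists 1, 2. split; [lra|split; [lra|]]. intros s (h1 & h2 & h3). unfold one.
  split; [lra|split; [apply Dif2_snd|]]. intros al (g1 & g2 & g3).
  eapply Rle_trans; [apply twist_diff|]. cbn [snd twist] in g2. unfold n2.
  pose proof (Cabs_ge0 (fst al)). pose proof (Cabs_ge0 (snd al)).
  apply Rmult_le_compat; try lra. pose proof (Cabs_ge0 (snd s)). pose proof (Cabs_ge0 (snd s * cexp (snd al))%cc). lra.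
Qed.

(** A twist multiplies [uv] by a single exponential, so the variation of [uv] is controlled by its
    own two end values: this is the source of the weight [axprod]. *)
Lemma log_lip_pi : log_lip axprod r (fun s => fst s * snd s)%cc.
Proof.
  exists 1, 2. split; [lra|split; [lra|]]. intros s (h1 & h2 & h3).
  split; [rewrite Cabs_mul; fold (axprod s); pose proof (axprod_ge0 s); lra|split; [apply Dif2_mul|]].
  intros al _. pose proof (twist_diff (fst s * snd s) (fst al + snd al)) as t.
  rewrite cexp_add in t. unfold twist; cbn [fst snd].
  replace (fst s * cexp (fst al) * (snd s * cexp (snd al)))%cc with (fst s * snd s * (cexp (fst al) * cexp (snd al)))%cc by ring.
  eapply Rle_trans; [apply t|].
  replace (axprod (fst s * cexp (fst al), snd s * cexp (snd al))%cc) with (Cabs (fst s * snd s * (cexp (fst al) * cexp (snd al))))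
    by (unfold axprod; cbn [fst snd]; rewrite !Cabs_mul; ring).
  replace (axprod s) with (Cabs (fst s * snd s)) by apply Cabs_mul.
  apply Rmult_le_compat_l; [|apply Cabs_tri].
  pose proof (Cabs_ge0 (fst s * snd s)%cc). pose proof (Cabs_ge0 (fst s * snd s * (cexp (fst al) * cexp (snd al)))%cc). lra.
Qed.

Lemma log_lip_two (w : C2 -> R) f g : (forall s, 0 <= w s) -> log_lip one r f -> log_lip w r g ->
  exists e M, 0 < e /\ 0 <= M /\ log_lip_on one M r e f /\ log_lip_on w M r e g.
Proof.
  intros hw (e & M & he & hM & H) (e' & M' & he' & hM' & H').
  exists (Rmin e e'), (Rmax M M').
  rmin e e'. pose proof (Rmax_l M M'). pose proof (Rmax_r M M').
  split; [apply Rmin_pos; auto|]. split; [lra|].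
  split; [eapply log_lip_on_mono; [apply one_ge0| | |exact H]; lra|eapply log_lip_on_mono; [| | |exact H']; auto; lra].
Qed.

Lemma log_lip_add w f g : (forall s, 0 <= w s) -> log_lip w r f -> log_lip w r g -> log_lip w r (fun s => f s + g s)%cc.
Proof.
  intros hw (e & M & he & hM & H) (e' & M' & he' & hM' & H').
  exists (Rmin e e'), (M + M').
  rmin e e'.
  split; [apply Rmin_pos; auto|]. split; [lra|].
  apply (log_lip_on_mono w M r e M (Rmin e e')) in H; try lra; auto.
  apply (log_lip_on_mono w M' r e' M' (Rmin e e')) in H'; try lra; auto.
  intros s hs. destruct (H s hs) as (h1 & h2 & h3). destruct (H' s hs) as (k1 & k2 & k3).
  split; [|split].
  - eapply Rle_trans; [apply Cabs_tri|]. lra.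
  - apply (Dif_add VC2); auto.
  - intros al hal. specialize (h3 al hal). specialize (k3 al hal).
    replace (_ - _)%cc with ((f (twist s al) - f s) + (g (twist s al) - g s))%cc by ring.
    eapply Rle_trans; [apply Cabs_tri|]. lra.
Qed.

(** One factor is merely bounded: the functions of weight [axprod] form an ideal in those of weight
    [one]. *)
Lemma log_lip_mul w f g : (forall s, 0 <= w s) -> log_lip one r f -> log_lip w r g -> log_lip w r (fun s => f s * g s)%cc.
Proof.
  intros hw Hf Hg. destruct (log_lip_two w f g hw Hf Hg) as (e & M & he & hM & H & H').
  exists e, (3 * (M * M)). split; auto. split; [nra|].
  intros s hs. destruct (H s hs) as (h1 & h2 & h3). destruct (H' s hs) as (k1 & k2 & k3).
  unfold one in *. rewrite Rmult_1_r in h1. pose proof (hw s) as ws.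
  pose proof (Cabs_ge0 (f s)). pose proof (Cabs_ge0 (g s)).
  split; [|split].
  - rewrite Cabs_mul. apply Rle_trans with (M * (M * w s)); [apply Rmult_le_compat; auto|].
    assert (0 <= M * M * w s) by (repeat apply Rmult_le_pos; auto). lra.
  - apply (Dif_mul VC2); auto.
  - intros al hal. specialize (h3 al hal). specialize (k3 al hal).
    destruct (H _ hal) as (l1 & _). unfold one in l1. rewrite Rmult_1_r in l1. pose proof (hw (twist s al)) as ws'.
    replace (_ - _)%cc with (f (twist s al) * (g (twist s al) - g s) + (f (twist s al) - f s) * g s)%cc by ring.
    eapply Rle_trans; [apply Cabs_tri|]. rewrite !Cabs_mul. pose proof (n2_ge0 al).
    apply Rle_trans with (M * (M * (w s + w (twist s al)) * n2 al) + (M * (1 + 1) * n2 al) * (M * w s)).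
    + apply Rplus_le_compat; apply Rmult_le_compat; auto using Cabs_ge0.
    + assert (0 <= M * M * n2 al * w (twist s al)) by (repeat apply Rmult_le_pos; auto).
      assert (0 <= M * M * n2 al * w s) by (repeat apply Rmult_le_pos; auto). lra.
Qed.

Lemma log_lip_opp w f : (forall s, 0 <= w s) -> log_lip w r f -> log_lip w r (fun s => - f s)%cc.
Proof.
  intros hw H. apply (log_lip_ext w (fun s => (- (1)) * f s)%cc).
  - exists 1; split; [lra|]. intros; ring.
  - apply (log_lip_mul w (fun _ => (- (1))%cc)); auto using log_lip_const.
Qed.

Lemma log_lip_sub w f g : (forall s, 0 <= w s) -> log_lip w r f -> log_lip w r g -> log_lip w r (fun s => f s - g s)%cc.
Proof. intros hw H G. apply (log_lip_add w f (fun s => - g s)%cc); auto using log_lip_opp. Qed.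

Lemma log_lip_weak g : log_lip axprod r g -> log_lip one r g.
Proof.
  intros (e & M & he & hM & H). exists (Rmin e 1), M. rmin e 1.
  split; [apply Rmin_pos; lra|]. split; auto.
  apply (log_lip_on_mono axprod M r e M (Rmin e 1)) in H; try lra; auto using axprod_ge0.
  intros s hs. destruct (H s hs) as (h1 & h2 & h3). unfold one. destruct hs as (_ & _ & hs).
  split; [|split; auto].
  - eapply Rle_trans; [exact h1|]. apply Rmult_le_compat_l; lra.
  - intros al hal. eapply Rle_trans; [apply h3; exact hal|]. destruct hal as (_ & _ & hal).
    apply Rmult_le_compat_r; [apply n2_ge0|]. apply Rmult_le_compat_l; lra.
Qed.

Lemma log_lip_small g eta : log_lip axprod r g -> 0 < eta -> near_axes r (fun s => Cabs (g s) < eta).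
Proof.
  intros (e & M & he & hM & H) heta. exists (Rmin e (eta / (M + 1))).
  rmin e (eta / (M + 1)).
  split; [apply Rmin_pos; auto; apply Rdiv_lt_0_compat; lra|].
  intros s hs. destruct (H s) as (h1 & _); [eapply axes_nbhd_mono; try eassumption; lra|].
  destruct hs as (_ & _ & hs). pose proof (axprod_ge0 s).
  apply Rle_lt_trans with ((M + 1) * axprod s); [nra|].
  replace eta with ((M + 1) * (eta / (M + 1))) by (field; lra). apply Rmult_lt_compat_l; lra.
Qed.

(** The Lipschitz constant of [F] transports variations only. The size bound is a separate
    hypothesis, because for a weight that vanishes on the axes it asks [F] to vanish at the values
    taken there. *)
Lemma log_lip_comp w (F : CC -> CC) (P : CC -> Prop) (L : R) g : (forall s, 0 <= w s) -> 0 <= L ->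
  (forall z, P z -> Dif1 F z) ->
  (forall z z', P z -> P z' -> Cabs (F z' - F z) <= L * Cabs (z' - z)) ->
  near_axes r (fun s => P (g s)) ->
  log_lip w r (fun s => g s) -> near_axes r (fun s => Cabs (F (g s)) <= L * w s) ->
  log_lip w r (fun s => F (g s)).
Proof.
  intros hw hL D Lip V (e & M & he & hM & H) B.
  destruct (near_axes_and _ _ _ V B) as (e' & he' & G).
  exists (Rmin e e'), (L * (M + 1)). rmin e e'.
  split; [apply Rmin_pos; auto|]. split; [nra|].
  apply (log_lip_on_mono w M r e M (Rmin e e')) in H; try lra; auto.
  assert (D2 : forall s, axes_nbhd r (Rmin e e') s -> axes_nbhd r e' s) by (intros; eapply axes_nbhd_mono; try eassumption; lra).
  intros s hs. destruct (H s hs) as (h1 & h2 & h3). destruct (G s (D2 _ hs)) as [p b]. pose proof (hw s).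
  split; [|split].
  - eapply Rle_trans; [exact b|]. assert (0 <= L * M * w s) by (repeat apply Rmult_le_pos; auto). lra.
  - apply (Dif_comp1 VC2); auto.
  - intros al hal. specialize (h3 al hal). destruct (G _ (D2 _ hal)) as [p' b'].
    eapply Rle_trans; [apply Lip; auto|].
    apply Rle_trans with (L * (M * (w s + w (twist s al)) * n2 al)); [apply Rmult_le_compat_l; auto|].
    pose proof (hw (twist s al)). pose proof (n2_ge0 al).
    assert (0 <= L * ((w s + w (twist s al)) * n2 al)) by (repeat apply Rmult_le_pos; lra). lra.
Qed.

Lemma near_axes_log_lip_bound w g : log_lip w r g -> exists M, 0 <= M /\ near_axes r (fun s => Cabs (g s) <= M * w s).
Proof. intros (e & M & he & hM & H). exists M; split; auto. exists e; split; auto. intros s hs. apply H; auto. Qed.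

Lemma log_lip_inv g c : 0 < c -> near_axes r (fun s => c <= Cabs (g s)) -> log_lip one r g -> log_lip one r (fun s => Cinv (g s)).
Proof.
  intros hc V H.
  assert (hc' : 0 < / (c * c)) by (apply Rinv_0_lt_compat; nra).
  assert (hc2 : 0 < / c) by (apply Rinv_0_lt_compat; lra).
  apply (log_lip_comp one Cinv (fun z => c <= Cabs z) (/ (c * c) + / c)); auto using one_ge0.
  - lra.
  - intros z hz. apply Dif1_inv, Cabs_neq0; lra.
  - intros z z' hz hz'. assert (z <> C0) by (apply Cabs_neq0; lra). assert (z' <> C0) by (apply Cabs_neq0; lra).
    replace (Cinv z' - Cinv z)%cc with ((z - z') / (z * z'))%cc by (field; auto).
    rewrite Cabs_div by (apply Cmul_neq0; auto). rewrite Cabs_mul, (Cabs_sub_sym z).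
    pose proof (Cabs_ge0 (z' - z)%cc).
    assert (/ (Cabs z * Cabs z') <= / (c * c)) by (apply Rinv_le_contravar; [nra|apply Rmult_le_compat; lra]).
    unfold Rdiv. nra.
  - eapply near_axes_mono; [|exact V]. simpl. intros s hs. rewrite Cabs_inv by (apply Cabs_neq0; lra). unfold one.
    assert (/ Cabs (g s) <= / c) by (apply Rinv_le_contravar; lra). lra.
Qed.

Lemma log_lip_sqrt g c : 0 < c -> near_axes r (fun s => c <= fst (csqrt (g s))) -> log_lip one r g -> log_lip one r (fun s => csqrt (g s)).
Proof.
  intros hc V H. destruct (near_axes_log_lip_bound _ _ H) as (M & hM & B).
  assert (hc2 : 0 < / c) by (apply Rinv_0_lt_compat; lra).
  apply (log_lip_comp one csqrt (fun z => c <= fst (csqrt z)) (/ c + (M + 1))); auto using one_ge0.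
  - lra.
  - intros z hz. apply Dif1_csqrt; lra.
  - intros z z' hz hz'. eapply Rle_trans; [apply csqrt_lip; lra|].
    pose proof (Cabs_ge0 (z' - z)%cc). unfold Rdiv.
    assert (/ fst (csqrt z) <= / c) by (apply Rinv_le_contravar; lra). nra.
  - eapply near_axes_mono; [|exact B]. simpl. intros s hs. unfold one in *.
    pose proof (csqrt_sq (g s)) as e. apply (f_equal Cabs) in e. rewrite Cabs_mul in e.
    pose proof (Cabs_ge0 (csqrt (g s))). nra.
Qed.

Lemma log_lip_log w g : (forall s, 0 <= w s) -> near_axes r (fun s => Cabs (g s - 1) < 1/8) ->
  log_lip w r (fun s => g s - 1)%cc -> log_lip w r (fun s => clog (g s)).
Proof.
  intros hw V H. destruct (near_axes_log_lip_bound _ _ H) as (M & hM & B).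
  apply (log_lip_ext w (fun s => (fun z => clog (z + 1)) (g s - 1)%cc)).
  { exists 1; split; [lra|]. intros; f_equal; ring. }
  apply (log_lip_comp w (fun z => clog (z + 1)%cc) (fun z => Cabs z < 1/8) (8 + 4 * M)); auto.
  - lra.
  - intros z hz. apply (Dif_comp1 VC1 clog (fun z => z + 1)%cc).
    + apply Dif1_clog. replace (z + 1 - 1)%cc with z by ring; auto.
    + apply (Dif_add VC1); [apply Dif1_id|apply (Dif_const VC1)].
  - intros z z' hz hz'. eapply Rle_trans; [apply clog_lip|].
    + replace (z' + 1 - 1)%cc with z' by ring; lra.
    + replace (z + 1 - 1)%cc with z by ring; lra.
    + replace (z' + 1 - (z + 1))%cc with (z' - z)%cc by ring. pose proof (Cabs_ge0 (z' - z)%cc). nra.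
  - eapply near_axes_mono; [|exact (near_axes_and _ _ _ V B)]. cbn beta. intros s [h1 h2].
    replace (g s - 1 + 1)%cc with (g s) by ring.
    eapply Rle_trans; [apply clog_bound; lra|]. pose proof (hw s). nra.
Qed.

End Classes.

(** * The parametrization of the surface near a vertex *)

Section Chart.
Variables a b c d : CC.

(** On the axes the discriminant of the quadratic equation for [X] is the square of [S0f], and [Rf]
    is the remainder divided by [uv]. Near the axes [S0f] has positive real part, so the principal
    root in [Deltaf] is a holomorphic branch there. *)
Definition S0f (s : C2) : CC := ((1 - fst s * fst s) * (1 - snd s * snd s))%cc.
Definition Rf (s : C2) : CC :=
  (4 * (d - 4) * (fst s * snd s) + a * a * (fst s * snd s)
   - 2 * a * ((1 + fst s * fst s) * (1 + snd s * snd s))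
   - 4 * b * (snd s * (1 + fst s * fst s)) - 4 * c * (fst s * (1 + snd s * snd s)))%cc.
Definition Deltaf (s : C2) : CC := csqrt (S0f s * S0f s + fst s * snd s * Rf s).
(* With [y = -(p + 1/p)] and [z = -(q + 1/q)], the equation of the surface is quadratic in
   [X = -pqx]; this is the root that equals [1] when [pq = 0], and [1 + p^2q^2] on the Cayley cubic. *)
Definition Xf (s : C2) : CC :=
  (((1 + fst s * fst s) * (1 + snd s * snd s) - a * (fst s * snd s) + Deltaf s) / 2)%cc.
(** [zetaf] is [- 1 / x_j], so the third parameter is [u_j = jouk_inv zetaf = uv * Ef], and [ef] is
    the logarithm of its ratio to the monomial [uv]. *)
Definition zetaf (s : C2) : CC := (fst s * snd s / Xf s)%cc.
Definition sigmaf (s : C2) : CC := csqrt (1 - 4 * (zetaf s * zetaf s)).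
Definition Ef (s : C2) : CC := (2 / (Xf s * (1 + sigmaf s)))%cc.
Definition ef (s : C2) : CC := clog (Ef s).

(** [Sumf] and [Prodf] are the sum and the product of the two roots of the quadratic equation for
    [X]. *)
Definition Sumf (s : C2) : CC := ((1 + fst s * fst s) * (1 + snd s * snd s) - a * (fst s * snd s))%cc.
Definition Prodf (s : C2) : CC :=
  (snd s * snd s * ((1 + fst s * fst s) * (1 + fst s * fst s))
   + fst s * fst s * ((1 + snd s * snd s) * (1 + snd s * snd s))
   + b * (fst s * (snd s * snd s)) * (1 + fst s * fst s)
   + c * (fst s * fst s * snd s) * (1 + snd s * snd s)
   - d * (fst s * fst s * (snd s * snd s)))%cc.

Lemma Delta_sq s : (Deltaf s * Deltaf s = Sumf s * Sumf s - 4 * Prodf s)%cc.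
Proof. unfold Deltaf. rewrite csqrt_sq. unfold S0f, Rf, Sumf, Prodf. ring. Qed.

Lemma Xf_quad s : (Xf s * Xf s - Sumf s * Xf s + Prodf s = 0)%cc.
Proof.
  pose proof (Delta_sq s) as h. pose proof two_neq0 as h2.
  assert (e : Prodf s = ((Sumf s * Sumf s - Deltaf s * Deltaf s) / 4)%cc) by (rewrite h; cfield).
  rewrite e. unfold Xf. fold (Sumf s). cfield.
Qed.

(** For the two roots, [2 X - Sumf] is [Deltaf] or its opposite; the sign of the real part tells
    which. *)
Lemma Xf_unique s X : (X * X - Sumf s * X + Prodf s = 0)%cc -> 0 < fst (2 * X - Sumf s)%cc -> X = Xf s.
Proof.
  intros h hp. pose proof two_neq0 as h2.
  assert (e : Deltaf s = (2 * X - Sumf s)%cc).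
  { rewrite <- (csqrt_unique _ hp). unfold Deltaf. f_equal.
    transitivity (Sumf s * Sumf s - 4 * Prodf s)%cc; [unfold S0f, Rf, Sumf, Prodf; ring|].
    replace (Prodf s) with (Sumf s * X - X * X + (X * X - Sumf s * X + Prodf s))%cc by ring. rewrite h. ring. }
  unfold Xf. fold (Sumf s). rewrite e. cfield.
Qed.

Lemma two_X_sub_sum s : (2 * Xf s - Sumf s)%cc = Deltaf s.
Proof. unfold Xf. fold (Sumf s). pose proof two_neq0. cfield. Qed.

Section Bounds.
Variable r : R.
Hypothesis r_pos : 0 < r.
Hypothesis r_lt1 : r < 1.

Let c0 : R := (1 - r * r) * (1 - r * r) / 2.

Local Lemma c0_pos : 0 < c0.
Proof. unfold c0. assert (0 < 1 - r * r) by nra. nra. Qed.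

Lemma S0f_low : near_axes r (fun s => c0 <= fst (S0f s)).
Proof.
  (* With [P], [Q] the two moduli, the real part is at least [(1 - P^2)(1 - Q^2) - 2 P^2 Q^2]; this
     width makes the subtracted term at most half of [(1 - r^2)^2]. *)
  exists ((1 - r * r) / 2). split; [nra|]. intros s (h1 & h2 & h3).
  pose proof (fst_close (S0f s)) as g.
  assert (e : (S0f s - 1 = - (fst s * fst s) - snd s * snd s + (fst s * snd s) * (fst s * snd s))%cc) by (unfold S0f; ring).
  rewrite e in g.
  pose proof (Cabs_tri (- (fst s * fst s) - snd s * snd s) ((fst s * snd s) * (fst s * snd s))) as t1.
  pose proof (Cabs_sub_tri (- (fst s * fst s)) (snd s * snd s)) as t2.
  rewrite Cabs_opp in t2. rewrite !Cabs_mul in t1, t2. unfold axprod in h3.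
  set (P := Cabs (fst s)) in *. set (Q := Cabs (snd s)) in *.
  assert (0 <= P) by apply Cabs_ge0. assert (0 <= Q) by apply Cabs_ge0.
  assert (P * P <= r * r) by nra. assert (Q * Q <= r * r) by nra.
  assert (hm : (1 - r * r) * (1 - r * r) <= (1 - P * P) * (1 - Q * Q)) by (apply Rmult_le_compat; nra).
  assert (P * Q * (P * Q) <= (1 - r * r) / 2 * ((1 - r * r) / 2)) by (apply Rmult_le_compat; nra).
  unfold c0. nra.
Qed.

Lemma log_lip_cross f g : log_lip one r f -> log_lip one r g -> log_lip one r (fun s => f s * g s)%cc.
Proof. apply log_lip_mul; auto using one_ge0. Qed.

Lemma log_lip_plus f g : log_lip one r f -> log_lip one r g -> log_lip one r (fun s => f s + g s)%cc.
Proof. apply log_lip_add; auto using one_ge0. Qed.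

Lemma log_lip_minus f g : log_lip one r f -> log_lip one r g -> log_lip one r (fun s => f s - g s)%cc.
Proof. apply log_lip_sub; auto using one_ge0. Qed.

Ltac cls := repeat lazymatch goal with
  | |- log_lip one _ (fun _ => Cadd _ _) => apply log_lip_plus
  | |- log_lip one _ (fun _ => Csub _ _) => apply log_lip_minus
  | |- log_lip one _ (fun _ => Cmul _ _) => apply log_lip_cross
  | |- log_lip one _ fst => exact (log_lip_fst r r_pos r_lt1)
  | |- log_lip one _ snd => exact (log_lip_snd r r_pos r_lt1)
  | |- log_lip one _ (fun s => fst s) => exact (log_lip_fst r r_pos r_lt1)
  | |- log_lip one _ (fun s => snd s) => exact (log_lip_snd r r_pos r_lt1)
  | |- log_lip one _ (fun _ => ?c) => first [apply log_lip_const | assumption]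
  | |- _ => assumption
  end.

Lemma log_lip_S0 : log_lip one r S0f.
Proof. unfold S0f. cls. Qed.

Lemma log_lip_R : log_lip one r Rf.
Proof. unfold Rf. cls. Qed.

Lemma log_lip_pi_mul f : log_lip one r f -> log_lip axprod r (fun s => fst s * snd s * f s)%cc.
Proof.
  intro H. apply (log_lip_ext r r_lt1 axprod (fun s => f s * (fst s * snd s))%cc).
  - exists 1; split; [lra|]. intros; ring.
  - apply log_lip_mul; auto using axprod_ge0, log_lip_pi.
Qed.

Lemma Delta_low : near_axes r (fun s => c0 / 2 <= fst (Deltaf s)).
Proof.
  pose proof c0_pos as hc.
  pose proof (log_lip_small r r_pos r_lt1 _ (c0 * c0 / 2) (log_lip_pi_mul Rf log_lip_R) ltac:(nra)) as H.
  eapply near_axes_mono; [|exact (near_axes_and r _ _ S0f_low H)]. cbn beta. intros s [h1 h2].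
  pose proof (csqrt_near (S0f s * S0f s + fst s * snd s * Rf s) (S0f s) ltac:(lra)) as g.
  replace (S0f s * S0f s + fst s * snd s * Rf s - S0f s * S0f s)%cc with (fst s * snd s * Rf s)%cc in g by ring.
  fold (Deltaf s) in g.
  assert (g2 : Cabs (fst s * snd s * Rf s) / fst (S0f s) <= c0 / 2).
  { apply (Rmult_le_reg_r (fst (S0f s))); [lra|]. unfold Rdiv at 1; rewrite Rmult_assoc, Rinv_l by lra. nra. }
  pose proof (Cabs_fst (Deltaf s - S0f s)%cc) as g3. apply Rabs_le_inv in g3.
  unfold Csub, Cadd, Copp in *; cbn [fst snd] in *. lra.
Qed.

Lemma log_lip_Delta : log_lip one r Deltaf.
Proof.
  pose proof c0_pos. apply (log_lip_sqrt r r_pos r_lt1 _ (c0 / 2)); [lra|exact Delta_low|].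
  pose proof log_lip_S0. pose proof log_lip_R. cls.
Qed.

(** Rationalizing [Deltaf - S0f = uv * Rf / (Deltaf + S0f)] exhibits the factor [uv] of [Xf - 1]. *)
Lemma log_lip_X1 : log_lip axprod r (fun s => Xf s - 1)%cc.
Proof.
  pose proof c0_pos as hc. pose proof two_neq0 as h2.
  pose proof (near_axes_and r _ _ S0f_low Delta_low) as V.
  assert (low : near_axes r (fun s => c0 <= Cabs (Deltaf s + S0f s))).
  { eapply near_axes_mono; [|exact V]. cbn beta. intros s [h1 h3]. pose proof (Cabs_fst (Deltaf s + S0f s)%cc) as g.
    apply Rabs_le_inv in g. unfold Cadd in *; cbn [fst] in *. lra. }
  apply (log_lip_ext r r_lt1 axprod (fun s => fst s * snd s * (fst s * snd s - a / 2 + Rf s * Cinv (Deltaf s + S0f s) / 2))%cc).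
  - eapply near_axes_mono; [|exact low]. cbn beta. intros s hs.
    assert (hn : (Deltaf s + S0f s)%cc <> C0) by (apply Cabs_neq0; lra).
    assert (e : (fst s * snd s * Rf s = (Deltaf s - S0f s) * (Deltaf s + S0f s))%cc).
    { replace ((Deltaf s - S0f s) * (Deltaf s + S0f s))%cc with (Deltaf s * Deltaf s - S0f s * S0f s)%cc by ring.
      unfold Deltaf; rewrite csqrt_sq. ring. }
    transitivity (fst s * snd s * (fst s * snd s - a / 2) + fst s * snd s * Rf s * Cinv (Deltaf s + S0f s) / 2)%cc.
    { cfield. }
    rewrite e. unfold Xf. transitivity (fst s * snd s * (fst s * snd s - a / 2) + (Deltaf s - S0f s) / 2)%cc.
    { cfield. }
    unfold S0f. cfield.
  - apply log_lip_pi_mul. unfold Cdiv. pose proof log_lip_R. pose proof log_lip_S0. pose proof log_lip_Delta.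
    assert (log_lip one r (fun s => Cinv (Deltaf s + S0f s))).
    { apply (log_lip_inv r _ c0); auto. cls. }
    cls.
Qed.

Lemma log_lip_X : log_lip one r Xf.
Proof.
  apply (log_lip_ext r r_lt1 one (fun s => (Xf s - 1) + 1)%cc).
  - exists 1; split; [lra|]. intros; ring.
  - apply log_lip_plus; [apply (log_lip_weak r), log_lip_X1|cls].
Qed.

Lemma X_near1 : near_axes r (fun s => Cabs (Xf s - 1) < 1/8).
Proof. apply (log_lip_small r r_pos r_lt1 _ _ log_lip_X1). lra. Qed.

Lemma near1_abs (z : CC) : Cabs (z - 1) < 1/8 -> 7/8 <= Cabs z.
Proof.
  intro h. pose proof (Cabs_tri_rev 1 (1 - z)) as t. replace (1 - (1 - z))%cc with z in t by ring.
  rewrite Cabs_C1, (Cabs_sub_sym 1) in t. lra.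
Qed.

Lemma log_lip_zeta : log_lip axprod r zetaf.
Proof.
  unfold zetaf, Cdiv. apply log_lip_pi_mul. apply (log_lip_inv r _ (7/8)); [lra| |apply log_lip_X].
  eapply near_axes_mono; [|exact X_near1]. cbn beta. intros s; apply near1_abs.
Qed.

Lemma sigma_low : near_axes r (fun s => 1/2 <= fst (sigmaf s)).
Proof.
  eapply near_axes_mono; [|exact (log_lip_small r r_pos r_lt1 _ (1/8) log_lip_zeta ltac:(lra))]. cbn beta. intros s hs.
  pose proof (csqrt_near (1 - 4 * (zetaf s * zetaf s)) 1 ltac:(simpl; lra)) as g. fold (sigmaf s) in g.
  replace (1 - 4 * (zetaf s * zetaf s) - 1 * 1)%cc with (- (4 * (zetaf s * zetaf s)))%cc in g by ring.
  rewrite Cabs_opp in g. rewrite (Cabs_mul 4 (zetaf s * zetaf s)), (Cabs_mul (zetaf s) (zetaf s)), Cabs_4 in g. simpl (fst 1%cc) in g.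
  pose proof (fst_close (sigmaf s)). pose proof (Cabs_ge0 (zetaf s)).
  unfold Rdiv in g at 1. rewrite Rinv_1, Rmult_1_r in g. nra.
Qed.

Lemma log_lip_sigma : log_lip one r sigmaf.
Proof.
  apply (log_lip_sqrt r r_pos r_lt1 _ (1/2)); [lra|exact sigma_low|]. pose proof (log_lip_weak r _ log_lip_zeta). cls.
Qed.

Lemma one_sigma_low (s : C2) : 1/2 <= fst (sigmaf s) -> 1 <= Cabs (1 + sigmaf s).
Proof.
  intro h. pose proof (Cabs_fst (1 + sigmaf s)%cc) as g. apply Rabs_le_inv in g.
  unfold Cadd, C1 in *; cbn [fst] in *. lra.
Qed.

(** [Ef - 1] splits into a multiple of [Xf - 1] and a multiple of
    [1 - sigmaf = 4 zetaf^2 / (1 + sigmaf)]; both contain the factor [uv]. *)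
Lemma log_lip_E1 : log_lip axprod r (fun s => Ef s - 1)%cc.
Proof.
  pose proof log_lip_sigma as Hs. pose proof log_lip_X as HX.
  assert (I1 : log_lip one r (fun s => Cinv (1 + sigmaf s))).
  { apply (log_lip_inv r _ 1); [lra| |cls]. eapply near_axes_mono; [|exact sigma_low]. intros s; apply one_sigma_low. }
  assert (I2 : log_lip one r (fun s => Cinv (Xf s))).
  { apply (log_lip_inv r _ (7/8)); [lra| |apply log_lip_X].
    eapply near_axes_mono; [|exact X_near1]. cbn beta. intros s; apply near1_abs. }
  apply (log_lip_ext r r_lt1 axprod (fun s => (- ((1 + sigmaf s) * Cinv (1 + sigmaf s) * Cinv (Xf s))) * (Xf s - 1)
     + (4 * zetaf s * Cinv (1 + sigmaf s) * Cinv (1 + sigmaf s) * Cinv (Xf s)) * zetaf s)%cc).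
  - eapply near_axes_mono; [|exact X_near1]. cbn beta. intros s hs. apply near1_abs in hs.
    assert (hX : Xf s <> C0) by (apply Cabs_neq0; lra).
    assert (h1 : (1 + sigmaf s)%cc <> C0) by apply one_add_csqrt_neq0.
    assert (e : (4 * zetaf s * zetaf s = (1 - sigmaf s) * (1 + sigmaf s))%cc).
    { replace ((1 - sigmaf s) * (1 + sigmaf s))%cc with (1 - sigmaf s * sigmaf s)%cc by ring.
      unfold sigmaf; rewrite csqrt_sq. ring. }
    transitivity (- (Xf s - 1) / Xf s + (4 * zetaf s * zetaf s) / ((1 + sigmaf s) * (1 + sigmaf s) * Xf s))%cc.
    { cfield. }
    rewrite e. unfold Ef. cfield.
  - apply log_lip_add; auto using axprod_ge0.
    + apply log_lip_mul; auto using axprod_ge0, log_lip_X1. apply log_lip_opp; auto using one_ge0. cls.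
    + apply log_lip_mul; auto using axprod_ge0, log_lip_zeta. pose proof (log_lip_weak r _ log_lip_zeta). cls.
Qed.

Lemma E_near1 : near_axes r (fun s => Cabs (Ef s - 1) < 1/8).
Proof. apply (log_lip_small r r_pos r_lt1 _ _ log_lip_E1). lra. Qed.

Lemma log_lip_e : log_lip axprod r ef.
Proof. unfold ef. apply log_lip_log; auto using axprod_ge0, E_near1, log_lip_E1. Qed.

Lemma jouk_inv_zeta : near_axes r (fun s => jouk_inv (zetaf s) = (fst s * snd s * cexp (ef s))%cc).
Proof.
  eapply near_axes_mono; [|exact (near_axes_and r _ _ E_near1 X_near1)]. cbn beta. intros s [h1 h2].
  apply near1_abs in h2. assert (hX : Xf s <> C0) by (apply Cabs_neq0; lra).
  unfold ef. rewrite cexp_clog by (pose proof (fst_close (Ef s)); lra).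
  unfold jouk_inv, Ef. fold (sigmaf s). assert (g : (1 + sigmaf s)%cc <> C0) by apply one_add_csqrt_neq0.
  unfold zetaf at 1. cfield.
Qed.

End Bounds.
End Chart.

(** * Monomial maps *)

Lemma Cpow_add z m n : Cpow z (m + n) = (Cpow z m * Cpow z n)%cc.
Proof. induction m as [|m IH]; simpl; [ring|rewrite IH; ring]. Qed.

Lemma Cpow_mul_base z w n : Cpow (z * w)%cc n = (Cpow z n * Cpow w n)%cc.
Proof. induction n as [|n IH]; simpl; [ring|rewrite IH; ring]. Qed.

Lemma Cpow_pow z m n : Cpow (Cpow z m) n = Cpow z (m * n).
Proof.
  induction n as [|n IH]; simpl; [rewrite Nat.mul_0_r; reflexivity|].
  rewrite IH, Nat.mul_succ_r, Nat.add_comm, Cpow_add. reflexivity.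
Qed.

Lemma Cpow_neq0 z n : z <> C0 -> Cpow z n <> C0.
Proof. intro h. induction n; simpl; [apply C1_neq0|apply Cmul_neq0; auto]. Qed.

Lemma Cpow_0_l n : (0 < n)%nat -> Cpow C0 n = C0.
Proof. destruct n; [lia|]. intros _. simpl. ring. Qed.

Lemma Cabs_pow z n : Cabs (Cpow z n) = (Cabs z) ^ n.
Proof. induction n as [|n IH]; simpl; [apply Cabs_C1|rewrite Cabs_mul, IH; reflexivity]. Qed.

Lemma cexp_mul_nat z n : cexp (CR (INR n) * z)%cc = Cpow (cexp z) n.
Proof.
  induction n as [|n IH].
  - simpl. replace (CR 0 * z)%cc with C0 by (change (CR 0) with C0; ring). apply cexp_0.
  - rewrite S_INR. replace (CR (INR n + 1) * z)%cc with (z + CR (INR n) * z)%cc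
      by (apply CC_eq; unfold CR, Cadd, Cmul; simpl; ring).
    rewrite cexp_add, IH. reflexivity.
Qed.

Definition nonneg (N : Mat2) : Prop := let '(a, b, c, d) := N in (0 <= a /\ 0 <= b /\ 0 <= c /\ 0 <= d)%Z.
Definition cols_pos (N : Mat2) : Prop := let '(a, b, c, d) := N in (1 <= a + c /\ 1 <= b + d)%Z.
Definition mact (N : Mat2) (al : C2) : C2 :=
  let '(a, b, c, d) := N in
  (CR (IZR a) * fst al + CR (IZR b) * snd al, CR (IZR c) * fst al + CR (IZR d) * snd al)%cc.

Lemma CR_add x y : CR (x + y) = (CR x + CR y)%cc.
Proof. apply CC_eq; unfold CR, Cadd; simpl; ring. Qed.

Lemma CR_mul x y : CR (x * y) = (CR x * CR y)%cc.
Proof. apply CC_eq; unfold CR, Cmul; simpl; ring. Qed.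

Lemma mact_mmul M N al : mact (mmul M N) al = mact M (mact N al).
Proof.
  destruct M as [[[a b] c] d], N as [[[a' b'] c'] d']. unfold mact, mmul; cbn [fst snd].
  rewrite !plus_IZR, !mult_IZR, !CR_add, !CR_mul. f_equal; ring.
Qed.

Lemma mact_sub N al be : mact N (sub2 al be) = sub2 (mact N al) (mact N be).
Proof. destruct N as [[[a b] c] d]. unfold mact, sub2; cbn [fst snd]. f_equal; ring. Qed.

Lemma mact_mid al : mact mid al = al.
Proof.
  destruct al. unfold mact, mid; cbn [fst snd]. change (CR 1) with C1. change (CR 0) with C0. f_equal; ring.
Qed.

Lemma mact_bound N : exists K, 1 <= K /\ forall al, n2 (mact N al) <= K * n2 al.
Proof.
  destruct N as [[[a b] c] d].
  exists (1 + (Rabs (IZR a) + Rabs (IZR b) + Rabs (IZR c) + Rabs (IZR d))).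
  pose proof (Rabs_pos (IZR a)). pose proof (Rabs_pos (IZR b)). pose proof (Rabs_pos (IZR c)). pose proof (Rabs_pos (IZR d)).
  split; [lra|]. intros [x y]. unfold mact, n2; cbn [fst snd].
  pose proof (Cabs_tri (CR (IZR a) * x) (CR (IZR b) * y)) as t1. pose proof (Cabs_tri (CR (IZR c) * x) (CR (IZR d) * y)) as t2.
  rewrite !Cabs_mul, !Cabs_CR in t1, t2. pose proof (Cabs_ge0 x). pose proof (Cabs_ge0 y). nra.
Qed.

Lemma n2_add al be : n2 (add2 al be) <= n2 al + n2 be.
Proof.
  unfold n2, add2; cbn [fst snd]. pose proof (Cabs_tri (fst al) (fst be)). pose proof (Cabs_tri (snd al) (snd be)). lra.
Qed.

Lemma twist_add s al be : twist (twist s al) be = twist s (add2 al be).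
Proof. unfold twist, add2; cbn [fst snd]. rewrite !cexp_add. f_equal; ring. Qed.

Lemma twist_0 s : twist s (C0, C0) = s.
Proof. destruct s. unfold twist; cbn [fst snd]. rewrite cexp_0. f_equal; ring. Qed.

(** [s^N] turns a factor [exp al] into [exp (N al)]. Nonnegativity matters because [Z.to_nat]
    truncates negative exponents to zero. *)
Lemma monomial_twist N s al : nonneg N -> monomial N (twist s al) = twist (monomial N s) (mact N al).
Proof.
  destruct N as [[[a b] c] d]. intros (ha & hb & hc & hd). unfold monomial, twist, mact; cbn [fst snd].
  rewrite !cexp_add, !Cpow_mul_base.
  rewrite <- (Z2Nat.id a), <- (Z2Nat.id b), <- (Z2Nat.id c), <- (Z2Nat.id d) by auto.
  rewrite <- !INR_IZR_INZ, !cexp_mul_nat, !Nat2Z.id. f_equal; ring.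
Qed.

Lemma monomial_mmul M N s : nonneg M -> nonneg N -> monomial (mmul M N) s = monomial M (monomial N s).
Proof.
  destruct M as [[[a b] c] d], N as [[[a' b'] c'] d']. intros (ha & hb & hc & hd) (ha' & hb' & hc' & hd').
  unfold monomial, mmul; cbn [fst snd].
  rewrite !Z2Nat.inj_add, !Z2Nat.inj_mul by nia.
  rewrite !Cpow_mul_base, !Cpow_pow, !Cpow_add.
  rewrite !(Nat.mul_comm (Z.to_nat a)), !(Nat.mul_comm (Z.to_nat b)), !(Nat.mul_comm (Z.to_nat c)), !(Nat.mul_comm (Z.to_nat d)).
  f_equal; ring.
Qed.

Lemma monomial_mid s : monomial mid s = s.
Proof. destruct s. unfold monomial, mid; simpl. f_equal; ring. Qed.

(** With positive entries, each coordinate of [s^N] is divisible by [uv]. *)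
Lemma monomial_small N s : positive_entries N -> Bidisk s ->
  Cabs (fst (monomial N s)) <= axprod s /\ Cabs (snd (monomial N s)) <= axprod s.
Proof.
  intros hN [h1 h2]. unfold Disk in *. destruct N as [[[a b] c] d]. simpl in hN. unfold monomial; cbn [fst snd].
  assert (pw : forall x n, 0 <= x -> x <= 1 -> (0 < n)%nat -> 0 <= x ^ n <= x).
  { intros x n hx hx1 hn. destruct n as [|n]; [lia|]. simpl.
    assert (0 <= x ^ n <= 1). { split; [apply pow_le; auto|]. rewrite <- (pow1 n). apply pow_incr; lra. }
    nra. }
  assert (key : forall a b, (0 < a)%Z -> (0 < b)%Z -> Cabs (Cpow (fst s) (Z.to_nat a) * Cpow (snd s) (Z.to_nat b)) <= axprod s).
  { intros x y hx hy. rewrite Cabs_mul, !Cabs_pow. unfold axprod.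
    pose proof (pw (Cabs (fst s)) (Z.to_nat x) (Cabs_ge0 _) ltac:(lra) ltac:(lia)).
    pose proof (pw (Cabs (snd s)) (Z.to_nat y) (Cabs_ge0 _) ltac:(lra) ltac:(lia)).
    apply Rmult_le_compat; lra. }
  split; apply key; lia.
Qed.

Lemma nonneg_mmul M N : nonneg M -> nonneg N -> nonneg (mmul M N).
Proof. destruct M as [[[a b] c] d], N as [[[a' b'] c'] d']. simpl. intros; nia. Qed.

Lemma cols_pos_mmul M N : nonneg M -> nonneg N -> cols_pos M -> cols_pos N -> cols_pos (mmul M N).
Proof. destruct M as [[[a b] c] d], N as [[[a' b'] c'] d']. simpl. intros; nia. Qed.

Lemma mdet_mmul M N : mdet (mmul M N) = (mdet M * mdet N)%Z.
Proof. destruct M as [[[a b] c] d], N as [[[a' b'] c'] d']. simpl. ring. Qed.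

Lemma Dif2_monomial N p : Dif2 (fun s => fst (monomial N s)) p /\ Dif2 (fun s => snd (monomial N s)) p.
Proof.
  destruct N as [[[a b] c] d]. unfold monomial; cbn [fst snd].
  split; apply (Dif_mul VC2); apply Dif_pow; first [apply Dif2_fst|apply Dif2_snd].
Qed.

(** * Composition of the involutions in the charts *)

Definition TwMap (N : Mat2) (L : C2 -> C2) (s : C2) : C2 := twist (monomial N s) (L s).

Definition log_monomial (r : R) (N : Mat2) (L : C2 -> C2) : Prop :=
  nonneg N /\ cols_pos N /\ log_lip axprod r (fun s => fst (L s)) /\ log_lip axprod r (fun s => snd (L s)) /\
  exists M, 0 <= M /\ near_axes r (fun s => Cabs (fst (TwMap N L s)) < r /\ Cabs (snd (TwMap N L s)) < r /\
                    axprod (TwMap N L s) <= M * axprod s).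

Lemma TwMap_twist N L s al : nonneg N ->
  TwMap N L (twist s al) = twist (TwMap N L s) (add2 (mact N al) (sub2 (L (twist s al)) (L s))).
Proof.
  intro h. unfold TwMap. rewrite monomial_twist by auto. rewrite !twist_add. f_equal.
  unfold add2, sub2; cbn [fst snd]. f_equal; ring.
Qed.

Lemma Dif2_TwMap N L p : Dif2 (fun s => fst (L s)) p -> Dif2 (fun s => snd (L s)) p ->
  Dif2 (fun s => fst (TwMap N L s)) p /\ Dif2 (fun s => snd (TwMap N L s)) p.
Proof.
  intros h1 h2. destruct (Dif2_monomial N p) as [m1 m2]. unfold TwMap, twist; cbn [fst snd].
  split; apply (Dif_mul VC2); auto; apply (Dif_comp1 VC2); auto using Dif1_cexp.
Qed.

Lemma Dif2_pair (g : C2 -> CC) (F : C2 -> C2) p :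
  Dif2 g (F p) -> Dif2 (fun s => fst (F s)) p -> Dif2 (fun s => snd (F s)) p -> Dif2 (fun s => g (F s)) p.
Proof.
  intros h h1 h2. apply (Dif_ext VC2 (fun s => g (fst (F s), snd (F s)))).
  - intro x. rewrite <- surjective_pairing; reflexivity.
  - apply (Dif_comp2 VC2); auto. rewrite <- surjective_pairing; auto.
Qed.

Definition log_lip_pair (M r e : R) (L : C2 -> C2) : Prop :=
  forall s, axes_nbhd r e s -> n2 (L s) <= M * axprod s /\ Dif2 (fun x => fst (L x)) s /\ Dif2 (fun x => snd (L x)) s /\
    forall al, axes_nbhd r e (twist s al) -> n2 (sub2 (L (twist s al)) (L s)) <= M * (axprod s + axprod (twist s al)) * n2 al.

Lemma log_lip_pair_of_log_lip r L : log_lip axprod r (fun s => fst (L s)) -> log_lip axprod r (fun s => snd (L s)) ->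
  exists e M, 0 < e /\ 0 <= M /\ log_lip_pair M r e L.
Proof.
  intros (e & M & he & hM & H) (e' & M' & he' & hM' & H').
  exists (Rmin e e'), (M + M'). rmin e e'.
  split; [apply Rmin_pos; auto|]. split; [lra|].
  apply (log_lip_on_mono axprod M r e M (Rmin e e')) in H; try lra; auto using axprod_ge0.
  apply (log_lip_on_mono axprod M' r e' M' (Rmin e e')) in H'; try lra; auto using axprod_ge0.
  intros s hs. destruct (H s hs) as (h1 & h2 & h3). destruct (H' s hs) as (k1 & k2 & k3).
  unfold n2 at 1 2, sub2; cbn [fst snd].
  repeat split; auto; [lra|]. intros al hal. specialize (h3 al hal). specialize (k3 al hal). lra.
Qed.

Lemma log_lip_pair_mono M r e M' e' L : M <= M' -> e' <= e -> log_lip_pair M r e L -> log_lip_pair M' r e' L.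
Proof.
  intros hM he H s hs. destruct (H s) as (h1 & h2 & h3 & h4); [eapply axes_nbhd_mono; try eassumption; lra|].
  pose proof (axprod_ge0 s). repeat split; auto; [nra|].
  intros al hal. eapply Rle_trans; [apply h4; eapply axes_nbhd_mono; try eassumption; lra|].
  apply Rmult_le_compat_r; [apply n2_ge0|]. apply Rmult_le_compat_r; auto.
  pose proof (axprod_ge0 (twist s al)). lra.
Qed.

Section LMcomp.
Variable r : R.
Hypothesis r_pos : 0 < r.
Hypothesis r_lt1 : r < 1.

Lemma log_monomial_axes_nbhd N L e : log_monomial r N L -> 0 < e -> near_axes r (fun s => axes_nbhd r e (TwMap N L s)).
Proof.
  intros (_ & _ & _ & _ & M & hM & e0 & he0 & B) he.
  exists (Rmin e0 (e / (M + 1))). rmin e0 (e / (M + 1)).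
  split; [apply Rmin_pos; auto; apply Rdiv_lt_0_compat; lra|]. intros s hs.
  destruct (B s) as (b1 & b2 & b3); [eapply axes_nbhd_mono; try eassumption; lra|].
  repeat split; auto. destruct hs as (_ & _ & hs). pose proof (axprod_ge0 s).
  apply Rle_lt_trans with ((M + 1) * axprod s); [nra|].
  replace e with ((M + 1) * (e / (M + 1))) by (field; lra). apply Rmult_lt_compat_l; lra.
Qed.

Lemma log_lip_TwMap N L g : log_monomial r N L -> log_lip axprod r g -> log_lip axprod r (fun s => g (TwMap N L s)).
Proof.
  intros HL (e1 & M1 & he1 & hM1 & G).
  destruct (log_monomial_axes_nbhd N L e1 HL he1) as (e2 & he2 & HD).
  destruct HL as (nn & _ & c1 & c2 & M3 & hM3 & e3 & he3 & B).
  destruct (log_lip_pair_of_log_lip r L c1 c2) as (e4 & M4 & he4 & hM4 & EL).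
  destruct (mact_bound N) as (K & hK & BK).
  set (e := Rmin (Rmin e2 e3) (Rmin e4 1)).
  assert (he : 0 < e) by (repeat apply Rmin_pos; lra).
  assert (le : e <= e2 /\ e <= e3 /\ e <= e4 /\ e <= 1).
  { unfold e. rmin (Rmin e2 e3) (Rmin e4 1).
    rmin e2 e3. rmin e4 1. lra. }
  destruct le as (l2 & l3 & l4 & l1).
  (* Growth of a logarithmic increment under the map: [K] from the matrix, [2 * M4] from the
     variation of [L], both weights being at most [1] once [e <= 1]. *)
  set (K' := K + 2 * M4).
  exists e, (M1 * M3 * (K' + 1)).
  split; auto. assert (0 <= M1 * M3) by nra. split; [unfold K'; nra|].
  assert (D : forall s e', axes_nbhd r e s -> e <= e' -> axes_nbhd r e' s) by (intros; eapply axes_nbhd_mono; try eassumption; lra).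
  intros s hs.
  destruct (B s (D _ _ hs l3)) as (b1 & b2 & b3). pose proof (HD s (D _ _ hs l2)) as hF.
  destruct (G _ hF) as (g1 & g2 & g3). destruct (EL s (D _ _ hs l4)) as (k1 & k2 & k3 & k4).
  pose proof (axprod_ge0 s) as hp.
  split; [|split].
  - eapply Rle_trans; [exact g1|]. apply Rle_trans with (M1 * (M3 * axprod s)); [apply Rmult_le_compat_l; auto|].
    assert (0 <= M1 * M3 * K' * axprod s) by (unfold K'; repeat apply Rmult_le_pos; try apply Cabs_ge0; lra). lra.
  - destruct (Dif2_TwMap N L s k2 k3). apply (Dif2_pair g (TwMap N L)); auto.
  - intros al hal. destruct (B _ (D _ _ hal l3)) as (_ & _ & b3'). pose proof (HD _ (D _ _ hal l2)) as hF'.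
    pose proof (axprod_ge0 (twist s al)) as hp'.
    rewrite (TwMap_twist N L s al nn) in *. set (be := add2 _ _) in *.
    eapply Rle_trans; [apply g3; exact hF'|].
    assert (hbe : n2 be <= K' * n2 al).
    { unfold be. eapply Rle_trans; [apply n2_add|]. specialize (k4 al (D _ _ hal l4)). specialize (BK al).
      pose proof (n2_ge0 al). destruct hs as (_ & _ & hs). destruct hal as (_ & _ & hal).
      assert (M4 * (axprod s + axprod (twist s al)) * n2 al <= M4 * 2 * n2 al).
      { apply Rmult_le_compat_r; auto. apply Rmult_le_compat_l; lra. }
      unfold K'. lra. }
    pose proof (n2_ge0 al). pose proof (n2_ge0 be). pose proof (axprod_ge0 (TwMap N L s)). pose proof (axprod_ge0 (twist (TwMap N L s) be)).
    apply Rle_trans with (M1 * (M3 * (axprod s + axprod (twist s al))) * (K' * n2 al)).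
    + apply Rmult_le_compat; auto; [|apply Rmult_le_compat_l; lra]. apply Rmult_le_pos; lra.
    + assert (0 <= M1 * M3 * ((axprod s + axprod (twist s al)) * n2 al)).
      { apply Rmult_le_pos; auto. apply Rmult_le_pos; lra. } lra.
Qed.

(** [(s^N exp L)^P exp (l o F) = s^(PN) exp (P L + l o F)]: the class is closed under composition
    and the exponents obey a cocycle rule. *)
Lemma log_monomial_comp N L P l : log_monomial r N L -> log_monomial r P l ->
  log_monomial r (mmul P N) (fun s => add2 (mact P (L s)) (l (TwMap N L s))) /\
  forall s, TwMap (mmul P N) (fun s => add2 (mact P (L s)) (l (TwMap N L s))) s = TwMap P l (TwMap N L s).
Proof.
  intros H1 H2.
  assert (E : forall s, TwMap (mmul P N) (fun s => add2 (mact P (L s)) (l (TwMap N L s))) s = TwMap P l (TwMap N L s)).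
  { intro s. destruct H1 as (n1 & _). destruct H2 as (n2 & _). unfold TwMap at 1 3.
    rewrite monomial_mmul by auto. unfold TwMap at 2. rewrite monomial_twist by auto. rewrite twist_add. reflexivity. }
  split; [|exact E].
  assert (H2' := H2). assert (H1' := H1).
  destruct H2 as (nP & cP & d1 & d2 & M2 & hM2 & e2 & he2 & B2).
  pose proof (log_monomial_axes_nbhd N L e2 H1 he2) as V.
  destruct H1 as (nN & cN & c1 & c2 & M1 & hM1 & V1).
  split; [apply nonneg_mmul; auto|]. split; [apply cols_pos_mmul; auto|].
  split; [|split].
  - destruct P as [[[a b] c] d]. unfold add2, mact; cbn [fst snd].
    apply log_lip_add; auto using axprod_ge0; [|apply (log_lip_TwMap N L (fun s => fst (l s))); auto].
    apply log_lip_add; auto using axprod_ge0; apply (log_lip_mul r axprod (fun _ => _)); auto using axprod_ge0, log_lip_const.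
  - destruct P as [[[a b] c] d]. unfold add2, mact; cbn [fst snd].
    apply log_lip_add; auto using axprod_ge0; [|apply (log_lip_TwMap N L (fun s => snd (l s))); auto].
    apply log_lip_add; auto using axprod_ge0; apply (log_lip_mul r axprod (fun _ => _)); auto using axprod_ge0, log_lip_const.
  - exists (M2 * M1). split; [nra|]. eapply near_axes_mono; [|exact (near_axes_and _ _ _ V V1)]. cbn beta.
    intros s [hd (_ & _ & b)]. rewrite E. destruct (B2 _ hd) as (x1 & x2 & x3). repeat split; auto.
    eapply Rle_trans; [exact x3|]. rewrite Rmult_assoc. apply Rmult_le_compat_l; auto.
Qed.

End LMcomp.

(** * Exponent matrices and logarithmic errors along a word *)

Definition o1 (j : letter) : letter := match j with Lx => Ly | Ly => Lx | Lz => Lx end.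
Definition o2 (j : letter) : letter := match j with Lx => Lz | Ly => Lz | Lz => Ly end.

Section Words.
Variables A B Cc D : CC.

Definition param_at (l : letter) : CC := match l with Lx => A | Ly => B | Lz => Cc end.
Definition log_factor_at (j : letter) : C2 -> CC := ef (param_at j) (param_at (o1 j)) (param_at (o2 j)) D.
Definition X_at (j : letter) : C2 -> CC := Xf (param_at j) (param_at (o1 j)) (param_at (o2 j)) D.
(* In the chart at the vertex [j], the coordinates are [(u_{o1 j}, u_{o2 j})], where the affine coordinate
   indexed by [l] is [-(u_l + 1/u_l)]; [u_coord j s l] is [u_l]. *)
Definition u_coord (j : letter) (s : C2) (l : letter) : CC :=
  if letter_eq_dec l j then (fst s * snd s * cexp (log_factor_at j s))%cc
  else if letter_eq_dec l (o1 j) then fst s else snd s.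
Definition lgt (j : letter) (s : C2) (l : letter) : CC := if letter_eq_dec l j then log_factor_at j s else C0.
(** Exponents of the leading monomial of [u_l] in the chart at [j], with logarithmic error
    [lgt j s l]. Thus [Pm i j] and [lstep i j] describe the passage from the chart at [j] to the
    chart at [i]. *)
Definition rowZ (j l : letter) : Z * Z :=
  if letter_eq_dec l j then (1, 1)%Z else if letter_eq_dec l (o1 j) then (1, 0)%Z else (0, 1)%Z.
Definition Pm (i j : letter) : Mat2 := (fst (rowZ j (o1 i)), snd (rowZ j (o1 i)), fst (rowZ j (o2 i)), snd (rowZ j (o2 i))).
Definition lstep (i j : letter) (s : C2) : C2 := (lgt j s (o1 i), lgt j s (o2 i)).

Lemma TwMap_step i j s : TwMap (Pm i j) (lstep i j) s = (u_coord j s (o1 i), u_coord j s (o2 i)).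
Proof.
  destruct s as [p q]. unfold TwMap, twist, monomial, Pm, lstep, u_coord, lgt, rowZ.
  destruct i, j; simpl; rewrite ?cexp_0; f_equal; ring.
Qed.

(** The head of a word acts last, so the image lies in the chart of the head; the empty word stays
    in the initial chart [c]. *)
Definition chart_of (c : letter) (w : list letter) : letter := match w with [] => c | i :: _ => i end.
Fixpoint Nw (c : letter) (w : list letter) : Mat2 :=
  match w with [] => mid | i :: w' => mmul (Pm i (chart_of c w')) (Nw c w') end.
Fixpoint Lw (c : letter) (w : list letter) : C2 -> C2 :=
  match w with
  | [] => fun _ => (C0, C0)
  | i :: w' => fun s => add2 (mact (Pm i (chart_of c w')) (Lw c w' s))
                             (lstep i (chart_of c w') (TwMap (Nw c w') (Lw c w') s))
  end.

Section Fixedr.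
Variable r : R.
Hypothesis r_pos : 0 < r.
Hypothesis r_lt1 : r < 1.

Lemma log_lip_zero : log_lip axprod r (fun _ => C0).
Proof.
  apply (log_lip_ext r r_lt1 axprod (fun s => C0 * (fst s * snd s))%cc).
  - exists 1; split; [lra|]. intros; ring.
  - apply (log_lip_mul r axprod (fun _ => C0)); auto using axprod_ge0, log_lip_const, log_lip_pi.
Qed.

Lemma log_lip_log_factor j : log_lip axprod r (log_factor_at j).
Proof. unfold log_factor_at. exact (log_lip_e _ _ _ _ r r_pos r_lt1). Qed.

Lemma cexp_le2 z : Cabs z <= 1/2 -> Cabs (cexp z) <= 2.
Proof.
  intro h. rewrite Cabs_cexp. pose proof (Cabs_fst z). pose proof (exp_quad (fst z) ltac:(lra)).
  pose proof (Rle_abs (fst z)). pose proof (Rabs_pos (fst z)).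
  assert (fst z * fst z <= 1/2 * (1/2)). { rewrite <- (Rabs_right (fst z * fst z)) by nra. rewrite Rabs_mult. nra. }
  lra.
Qed.

Lemma tri_near_axes j : near_axes r (fun s => Cabs (u_coord j s j) < r /\ Cabs (u_coord j s j) <= 2 * axprod s).
Proof.
  destruct (log_lip_small r r_pos r_lt1 _ (1/2) (log_lip_log_factor j) ltac:(lra)) as (e & he & H).
  exists (Rmin e (r / 2)). rmin e (r/2).
  split; [apply Rmin_pos; lra|]. intros s hs.
  specialize (H s). cbn beta in H. assert (h : Cabs (log_factor_at j s) < 1/2) by (apply H; eapply axes_nbhd_mono; try eassumption; lra).
  pose proof (cexp_le2 _ (Rlt_le _ _ h)) as g. destruct hs as (_ & _ & hs). pose proof (axprod_ge0 s).
  unfold u_coord. destruct (letter_eq_dec j j) as [_|]; [|congruence].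
  rewrite !Cabs_mul. fold (axprod s). split; nra.
Qed.

Lemma log_monomial_step i j : i <> j -> log_monomial r (Pm i j) (lstep i j).
Proof.
  intro hij.
  split; [destruct i, j; simpl; lia|]. split; [destruct i, j; simpl; try lia; congruence|].
  split; [|split].
  - unfold lstep; cbn [fst]. unfold lgt. destruct (letter_eq_dec (o1 i) j); [apply log_lip_log_factor|apply log_lip_zero].
  - unfold lstep; cbn [snd]. unfold lgt. destruct (letter_eq_dec (o2 i) j); [apply log_lip_log_factor|apply log_lip_zero].
  - exists 2. split; [lra|]. destruct (tri_near_axes j) as (e & he & H). exists e. split; auto.
    intros s hs. rewrite TwMap_step. destruct (H s hs) as [t1 t2]. destruct hs as (h1 & h2 & h3).
    assert (g : forall l, Cabs (u_coord j s l) < r).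
    { intro l. unfold u_coord. destruct (letter_eq_dec l j) as [<-|n].
      - unfold u_coord in t1. destruct (letter_eq_dec l l); [auto|congruence].
      - destruct (letter_eq_dec l (o1 j)); auto. }
    cbn [fst snd]. repeat split; auto. unfold axprod at 1; cbn [fst snd].
    (* As [i <> j], one of the two new coordinates is [u_j], which is [O(uv)]; the other one is
       bounded. *)
    assert (hc : o1 i = j \/ o2 i = j) by (destruct i, j; simpl; auto; congruence).
    pose proof (axprod_ge0 s). pose proof (g (o1 i)). pose proof (g (o2 i)).
    pose proof (Cabs_ge0 (u_coord j s (o1 i))). pose proof (Cabs_ge0 (u_coord j s (o2 i))).
    destruct hc as [e1|e1]; rewrite e1 in *; nra.
Qed.

(** The rightmost letter must differ from [c] as well; when [c] is the first letter, this is cyclic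
    reducedness. *)
Fixpoint reduced_from (c : letter) (w : list letter) : Prop :=
  match w with [] => True | i :: w' => i <> chart_of c w' /\ reduced_from c w' end.

Lemma log_monomial_word c w : reduced_from c w -> log_monomial r (Nw c w) (Lw c w).
Proof.
  induction w as [|i w IH]; intro h.
  - simpl. repeat split; try (simpl; lia); try apply log_lip_zero. exists 1. split; [lra|].
    exists 1; split; [lra|]. intros s (h1 & h2 & h3). unfold TwMap. cbn [Nw Lw].
    rewrite monomial_mid, twist_0. repeat split; auto. lra.
  - destruct h as [h1 h2]. cbn [Nw Lw].
    exact (proj1 (log_monomial_comp r r_pos r_lt1 _ _ _ _ (IH h2) (log_monomial_step i _ h1))).
Qed.

End Fixedr.

Definition Fw (c : letter) (w : list letter) : C2 -> C2 := TwMap (Nw c w) (Lw c w).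

Lemma Fw_nil c s : Fw c [] s = s.
Proof. unfold Fw, TwMap. cbn [Nw Lw]. rewrite monomial_mid, twist_0. reflexivity. Qed.

Lemma Fw_cons c i w s : reduced_from c (i :: w) ->
  Fw c (i :: w) s = (u_coord (chart_of c w) (Fw c w s) (o1 i), u_coord (chart_of c w) (Fw c w s) (o2 i)).
Proof.
  intros [h1 h2]. unfold Fw. rewrite <- TwMap_step.
  (* The identity [E] involves no radius; [1/2] is an arbitrary admissible value. *)
  destruct (log_monomial_comp (1/2) ltac:(lra) ltac:(lra) (Nw c w) (Lw c w) (Pm i (chart_of c w)) (lstep i (chart_of c w))) as [_ E].
  - apply log_monomial_word; auto; lra.
  - apply log_monomial_step; auto; lra.
  - exact (E s).
Qed.

End Words.

(** * Linearization of a map [s^N exp (L s)] *)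

Lemma axes_nbhd_lt1 r e s : r < 1 -> axes_nbhd r e s -> axprod s <= 1.
Proof.
  intros hr (h1 & h2 & _). unfold axprod. pose proof (Cabs_ge0 (fst s)). pose proof (Cabs_ge0 (snd s)). nra.
Qed.

Definition log_lip_map (M r e : R) (g : C2 -> C2) : Prop :=
  forall s, axes_nbhd r e s -> n2 (g s) <= M * axprod s /\
    forall al, axes_nbhd r e (twist s al) -> n2 (sub2 (g (twist s al)) (g s)) <= M * (axprod s + axprod (twist s al)) * n2 al.

(** Passes from multiplicative to additive increments, with constants that depend on [s0] but not on
    [g]. Off the axes a small additive increment is a twist by a logarithm. On an axis a twist
    cannot move a zero coordinate, but there the size bound is enough: [axprod] vanishes at [s0] and
    is at most [n2 k] nearby. *)
Lemma log_lip_map_local r e s0 : r < 1 -> axes_nbhd r e s0 ->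
  exists del C, 0 < del /\ 0 <= C /\ (forall k, n2 k < del -> axes_nbhd r e (add2 s0 k)) /\
    forall M g, 0 <= M -> log_lip_map M r e g -> forall k, n2 k < del -> n2 (sub2 (g (add2 s0 k)) (g s0)) <= C * M * n2 k.
Proof.
  intros hr h0. destruct (axes_nbhd_near r e s0 ltac:(lra) h0) as [d [hd Hd]]. simpl in Hd.
  destruct s0 as [p q].
  assert (axis : (p = C0 \/ q = C0) -> exists del C, 0 < del /\ 0 <= C /\ (forall k, n2 k < del -> axes_nbhd r e (add2 (p, q) k)) /\
    forall M g, 0 <= M -> log_lip_map M r e g -> forall k, n2 k < del -> n2 (sub2 (g (add2 (p, q) k)) (g (p, q))) <= C * M * n2 k).
  { intro hax. exists d, 1. split; auto. split; [lra|]. split; auto. intros M g hM H k hk.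
    destruct (H _ h0) as [g0 _]. destruct (H _ (Hd k hk)) as [g1 _]. destruct (Hd k hk) as (l1 & l2 & _).
    assert (e0 : axprod (p, q) = 0) by (unfold axprod; cbn [fst snd]; destruct hax as [-> | ->]; rewrite Cabs_C0; ring).
    rewrite e0, Rmult_0_r in g0.
    assert (b : axprod (add2 (p, q) k) <= n2 k).
    { unfold axprod, add2, n2 in *; cbn [fst snd] in *. pose proof (Cabs_ge0 (fst k)). pose proof (Cabs_ge0 (snd k)).
      destruct hax as [-> | ->].
      - replace (0 + fst k)%cc with (fst k) in * by ring. pose proof (Cabs_ge0 (q + snd k)%cc). nra.
      - replace (0 + snd k)%cc with (snd k) in * by ring. pose proof (Cabs_ge0 (p + fst k)%cc). nra. }
    unfold n2 at 1, sub2; cbn [fst snd]. unfold n2 in g0, g1 at 1.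
    pose proof (Cabs_sub_tri (fst (g (add2 (p, q) k))) (fst (g (p, q)))).
    pose proof (Cabs_sub_tri (snd (g (add2 (p, q) k))) (snd (g (p, q)))).
    assert (M * axprod (add2 (p, q) k) <= M * n2 k) by (apply Rmult_le_compat_l; auto). lra. }
  destruct (excluded_middle_informative (p = C0)) as [e1|np]; [apply axis; auto|].
  destruct (excluded_middle_informative (q = C0)) as [e1|nq]; [apply axis; auto|].
  clear axis. pose proof (Cabs_pos p np) as hp. pose proof (Cabs_pos q nq) as hq.
  exists (Rmin d (Rmin (Cabs p / 2) (Cabs q / 2))), (8 * (/ Cabs p + / Cabs q)).
  assert (ip : 0 < / Cabs p) by (apply Rinv_0_lt_compat; auto). assert (iq : 0 < / Cabs q) by (apply Rinv_0_lt_compat; auto).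
  split; [repeat apply Rmin_pos; lra|]. split; [lra|].
  rmin d (Rmin (Cabs p / 2) (Cabs q / 2)).
  rmin (Cabs p / 2) (Cabs q / 2).
  split; [intros; apply Hd; lra|]. intros M g hM HG k hk. destruct k as [k1 k2].
  assert (cl : forall z k, z <> C0 -> Cabs k < Cabs z / 2 ->
     (z * cexp (clog ((z + k) / z)) = z + k)%cc /\ Cabs (clog ((z + k) / z)) <= 4 * (/ Cabs z * Cabs k)).
  { intros z k' hz hk'. pose proof (Cabs_pos z hz).
    assert (e' : ((z + k') / z - 1 = k' / z)%cc) by (field; auto).
    assert (b : Cabs ((z + k') / z - 1) = / Cabs z * Cabs k').
    { rewrite e', Cabs_div by auto. unfold Rdiv; ring. }
    assert (b2 : / Cabs z * Cabs k' <= 1/2).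
    { apply (Rmult_le_reg_l (Cabs z)); auto. rewrite <- Rmult_assoc, Rinv_r by lra. lra. }
    split.
    - rewrite cexp_clog by (pose proof (fst_close ((z + k') / z)%cc); lra). field; auto.
    - rewrite <- b. apply clog_bound. lra. }
  assert (hk1 : Cabs k1 <= n2 (k1, k2)) by (unfold n2; simpl; pose proof (Cabs_ge0 k2); lra).
  assert (hk2 : Cabs k2 <= n2 (k1, k2)) by (unfold n2; simpl; pose proof (Cabs_ge0 k1); lra).
  destruct (cl p k1 np ltac:(lra)) as [c1 b1]. destruct (cl q k2 nq ltac:(lra)) as [c2 b2].
  set (al := (clog ((p + k1) / p), clog ((q + k2) / q))%cc : C2).
  assert (e1 : add2 (p, q) (k1, k2) = twist (p, q) al) by (unfold add2, twist, al; cbn [fst snd]; rewrite c1, c2; reflexivity).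
  assert (hD : axes_nbhd r e (twist (p, q) al)) by (rewrite <- e1; apply Hd; lra).
  destruct (HG _ h0) as [_ H']. rewrite e1. eapply Rle_trans; [apply (H' al hD)|].
  pose proof (axes_nbhd_lt1 _ _ _ hr h0). pose proof (axes_nbhd_lt1 _ _ _ hr hD).
  pose proof (axprod_ge0 (p, q)). pose proof (axprod_ge0 (twist (p, q) al)).
  assert (ha : n2 al <= 4 * ((/ Cabs p + / Cabs q) * n2 (k1, k2))).
  { unfold n2 at 1, al; cbn [fst snd].
    pose proof (Rmult_le_compat_l _ _ _ (Rlt_le _ _ ip) hk1). pose proof (Rmult_le_compat_l _ _ _ (Rlt_le _ _ iq) hk2). lra. }
  apply Rle_trans with (M * 2 * (4 * ((/ Cabs p + / Cabs q) * n2 (k1, k2)))).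
  - apply Rmult_le_compat; auto using n2_ge0.
    + apply Rmult_le_pos; lra.
    + apply Rmult_le_compat_l; lra.
  - apply Req_le; ring.
Qed.

Lemma n2_sub_tri (x y z : C2) : n2 (sub2 x z) <= n2 (sub2 x y) + n2 (sub2 y z).
Proof.
  unfold n2, sub2; cbn [fst snd].
  pose proof (Cabs_tri (fst x - fst y) (fst y - fst z)) as t1. pose proof (Cabs_tri (snd x - snd y) (snd y - snd z)) as t2.
  replace (fst x - fst y + (fst y - fst z))%cc with (fst x - fst z)%cc in t1 by ring.
  replace (snd x - snd y + (snd y - snd z))%cc with (snd x - snd z)%cc in t2 by ring. lra.
Qed.

Lemma n2_sub_sym (x y : C2) : n2 (sub2 x y) = n2 (sub2 y x).
Proof. unfold n2, sub2; cbn [fst snd]. rewrite (Cabs_sub_sym (fst x)), (Cabs_sub_sym (snd x)). reflexivity. Qed.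

Lemma n2_sub_0 (x : C2) : n2 (sub2 x (C0, C0)) = n2 x.
Proof.
  unfold n2, sub2; cbn [fst snd]. replace (fst x - 0)%cc with (fst x) by ring. replace (snd x - 0)%cc with (snd x) by ring. reflexivity.
Qed.

Lemma n2_sub_eq (x y : C2) : n2 (sub2 x y) <= 0 -> x = y.
Proof.
  unfold n2, sub2; cbn [fst snd]. pose proof (Cabs_ge0 (fst x - fst y)%cc). pose proof (Cabs_ge0 (snd x - snd y)%cc).
  intro h. destruct x as [x1 x2], y as [y1 y2]; cbn [fst snd] in *.
  f_equal; apply Csub_eq0, Cabs_eq0; lra.
Qed.

Lemma le_of_half (x c : R) : 0 <= c -> (forall n, x <= c * half n) -> x <= 0.
Proof.
  intros hc H. apply Rnot_lt_le. intro hx. destruct (half_small c x hc hx) as [n hn]. specialize (H n). lra.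
Qed.

Lemma geo_limit2 (u : nat -> C2) c : (forall n, n2 (sub2 (u (S n)) (u n)) <= c * half n) ->
  exists l, forall n, n2 (sub2 (u n) l) <= 8 * c * half n.
Proof.
  intro H.
  destruct (geo_limit (fun n => fst (u n)) c) as [l1 h1].
  { intro n. eapply Rle_trans; [|apply H]. unfold n2, sub2; cbn [fst snd].
    pose proof (Cabs_ge0 (snd (u (S n)) - snd (u n))%cc). lra. }
  destruct (geo_limit (fun n => snd (u n)) c) as [l2 h2].
  { intro n. eapply Rle_trans; [|apply H]. unfold n2, sub2; cbn [fst snd].
    pose proof (Cabs_ge0 (fst (u (S n)) - fst (u n))%cc). lra. }
  exists (l1, l2). intro n. unfold n2, sub2; cbn [fst snd]. specialize (h1 n). specialize (h2 n). lra.
Qed.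

(** The adjugate times the determinant, the latter being its own inverse when it is [1] or [-1]. *)
Definition minv (M : Mat2) : Mat2 :=
  let '(a, b, c, d) := M in mscale (mdet M) (d, - b, - c, a)%Z.

Lemma mmul_minv N : inGL2Z N -> mmul N (minv N) = mid /\ mmul (minv N) N = mid.
Proof.
  intro N_inv. destruct N as [[[a b] c] d]. unfold minv, mmul, mscale, mid. unfold inGL2Z in N_inv. simpl in *.
  split; repeat f_equal; destruct N_inv as [e|e]; rewrite e; lia.
Qed.

Section Linearize.
Variables (N : Mat2) (L : C2 -> C2).
Hypothesis N_pos : positive_entries N.
Hypothesis N_inv : inGL2Z N.
Hypothesis HL : forall r, 0 < r -> r < 1 -> log_monomial r N L.

Let F : C2 -> C2 := TwMap N L.

Lemma N_nonneg : nonneg N.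
Proof. destruct N as [[[a b] c] d]. simpl in *. lia. Qed.

Lemma F_small r : 0 < r -> r < 1 -> near_axes r (fun s => Cabs (fst (F s)) <= 2 * axprod s /\ Cabs (snd (F s)) <= 2 * axprod s).
Proof.
  intros h0 h1. destruct (HL r h0 h1) as (_ & _ & c1 & c2 & _).
  pose proof (log_lip_small r h0 h1 _ (1/2) c1 ltac:(lra)) as v1. pose proof (log_lip_small r h0 h1 _ (1/2) c2 ltac:(lra)) as v2.
  destruct (near_axes_and r _ _ v1 v2) as (e & he & V).
  exists e; split; auto. intros s hs. destruct (V s hs) as [l1 l2]. destruct hs as (g1 & g2 & _).
  destruct (monomial_small N s N_pos (conj (Rlt_trans _ _ _ g1 h1) (Rlt_trans _ _ _ g2 h1))) as [m1 m2].
  pose proof (cexp_le2 _ (Rlt_le _ _ l1)). pose proof (cexp_le2 _ (Rlt_le _ _ l2)). pose proof (axprod_ge0 s).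
  unfold F, TwMap, twist; cbn [fst snd]. rewrite !Cabs_mul.
  split; rewrite (Rmult_comm 2); apply Rmult_le_compat; auto using Cabs_ge0.
Qed.

(** Iterates the fixed-point form [h = N^{-1} (L + h o F)] of the conjugacy equation, starting at
    zero; unfolding gives the partial sums of the series. *)
Fixpoint hk (k : nat) (s : C2) : C2 :=
  match k with
  | O => (C0, C0)
  | S k' => mact (minv N) (add2 (L s) (hk k' (F s)))
  end.

(** Convergence is required at the speed [half n], which determines the limit. Where there is none,
    [hh] takes an arbitrary value. *)
Definition hlim (s v : C2) : Prop := exists c, 0 <= c /\ forall n, n2 (sub2 (hk n s) v) <= c * half n.
Definition hh (s : C2) : C2 := epsilon (inhabits (C0, C0)) (hlim s).
Definition Phi0 (s : C2) : C2 := twist s (hh s).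

Lemma hlim_hh s v : hlim s v -> hh s = v.
Proof.
  intro H. assert (H' : hlim s (hh s)) by (exact (epsilon_spec _ (hlim s) (ex_intro _ v H))).
  destruct H as (c & hc & H). destruct H' as (c' & hc' & H').
  apply n2_sub_eq. apply (le_of_half _ (c + c')); [lra|]. intro n.
  eapply Rle_trans; [apply (n2_sub_tri _ (hk n s))|]. rewrite (n2_sub_sym (hh s)).
  specialize (H n). specialize (H' n). lra.
Qed.

(** The bound [4 * M * e <= 1] makes [hh] contract logarithmic increments by one half, whence the
    injectivity of [Phi0]. *)
Definition linearizable_on (r e M : R) : Prop :=
  0 < e /\ 0 <= M /\ log_lip_pair M r e hh /\ 4 * M * e <= 1 /\
  forall s, axes_nbhd r e s -> axes_nbhd r e (F s) /\ Cabs (fst (F s)) <= 2 * axprod s /\ Cabs (snd (F s)) <= 2 * axprod s /\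
    axprod (F s) <= axprod s / 2 /\ Phi0 (F s) = monomial N (Phi0 s).

Lemma linearize r : 0 < r -> r < 1 -> exists e M, linearizable_on r e M.
Proof.
  intros h0 h1.
  destruct (HL r h0 h1) as (_ & _ & c1 & c2 & _).
  destruct (log_lip_pair_of_log_lip r L c1 c2) as (e1 & M & he1 & hM & HEL).
  destruct (F_small r h0 h1) as (e2 & he2 & HF).
  destruct (mact_bound N) as (K0 & hK0 & BK0). destruct (mact_bound (minv N)) as (kap & hkap & Bk).
  set (K := K0 + 2 * M). assert (hK : 1 <= K) by (unfold K; lra).
  (* Chosen to give [kap * K * del = 1/2] in [step]. *)
  set (del := / (2 * kap * K)).
  assert (hkK : 1 <= kap * K) by nra.
  assert (hdel : 0 < del) by (apply Rinv_0_lt_compat; nra).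
  assert (hdel2 : kap * K * del = 1/2) by (unfold del; field; split; lra).
  assert (hdel3 : del <= 1/2) by nra.
  (* The factor [8] is the one of [geo_limit2]. *)
  set (M' := 8 * (kap * M)). assert (hM' : 0 <= M') by (unfold M'; nra).
  set (e := Rmin (Rmin e1 e2) (Rmin (Rmin 1 (r / 4)) (Rmin (del / 4) (/ (4 * (M' + 1)))))).
  assert (hi : 0 < / (4 * (M' + 1))) by (apply Rinv_0_lt_compat; lra).
  assert (he : 0 < e) by (repeat apply Rmin_pos; lra).
  assert (le : e <= e1 /\ e <= e2 /\ e <= 1 /\ e <= r / 4 /\ e <= del / 4 /\ e <= / (4 * (M' + 1))).
  { unfold e.
    rmin (Rmin e1 e2) (Rmin (Rmin 1 (r / 4)) (Rmin (del / 4) (/ (4 * (M' + 1))))).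
    rmin e1 e2.
    rmin (Rmin 1 (r / 4)) (Rmin (del / 4) (/ (4 * (M' + 1)))).
    rmin 1 (r / 4).
    rmin (del / 4) (/ (4 * (M' + 1))). lra. }
  destruct le as (l1 & l2 & l3 & l4 & l5 & l6).
  assert (HFs : forall s, axes_nbhd r e s -> axes_nbhd r e (F s) /\ Cabs (fst (F s)) <= 2 * axprod s /\ Cabs (snd (F s)) <= 2 * axprod s /\
    axprod (F s) <= del * axprod s).
  { intros s hs. destruct (HF s) as [a1 a2]; [eapply axes_nbhd_mono; try eassumption; lra|].
    assert (hs' := hs). destruct hs' as (_ & _ & hs'). pose proof (axprod_ge0 s).
    assert (b : axprod (F s) <= del * axprod s).
    (* Both coordinates of [F s] are at most [2 * axprod s], so their product is at most
       [4 * e * axprod s], and [e <= del / 4]. *)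
    { unfold axprod at 1. apply Rle_trans with ((2 * axprod s) * (2 * axprod s)); [apply Rmult_le_compat; auto using Cabs_ge0|]. nra. }
    repeat split; try lra; nra. }
  assert (EL : log_lip_pair M r e L) by (eapply log_lip_pair_mono; [| |exact HEL]; lra).
  (* The operator [g |-> N^{-1} (g o F)] halves the constant: [F] multiplies the weight by [del] and
     logarithmic increments by [K], and [minv N] costs [kap]. *)
  assert (step : forall m g, 0 <= m -> log_lip_map m r e g -> log_lip_map (m / 2) r e (fun s => mact (minv N) (g (F s)))).
  { intros m g hm H s hs. destruct (HFs s hs) as (d1 & _ & _ & b1). destruct (H _ d1) as [g1 g2].
    pose proof (axprod_ge0 s) as p0. split.
    - eapply Rle_trans; [apply Bk|]. apply Rle_trans with (kap * (m * (del * axprod s))).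
      + apply Rmult_le_compat_l; [lra|]. eapply Rle_trans; [exact g1|]. apply Rmult_le_compat_l; auto.
      + assert (kap * del <= 1/2) by nra. assert (0 <= m * axprod s) by (apply Rmult_le_pos; auto). nra.
    - intros al hal. destruct (HFs _ hal) as (d2 & _ & _ & b2). pose proof (axprod_ge0 (twist s al)) as p1.
      rewrite <- mact_sub. eapply Rle_trans; [apply Bk|].
      pose proof (TwMap_twist N L s al N_nonneg) as eF. fold F in eF. rewrite eF in *. set (be := add2 _ _) in *.
      destruct (EL s hs) as (_ & _ & _ & k4). specialize (k4 al hal). specialize (BK0 al). pose proof (n2_ge0 al) as na.
      assert (hbe : n2 be <= K * n2 al).
      { unfold be. eapply Rle_trans; [apply n2_add|]. destruct hs as (_ & _ & hs). destruct hal as (_ & _ & hal).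
        assert (M * (axprod s + axprod (twist s al)) * n2 al <= M * 2 * n2 al).
        { apply Rmult_le_compat_r; auto. apply Rmult_le_compat_l; lra. }
        unfold K. lra. }
      apply Rle_trans with (kap * (m * (del * (axprod s + axprod (twist s al))) * (K * n2 al))).
      + apply Rmult_le_compat_l; [lra|]. eapply Rle_trans; [apply g2; exact d2|].
        pose proof (axprod_ge0 (F s)). pose proof (axprod_ge0 (twist (F s) be)).
        apply Rmult_le_compat; auto using n2_ge0.
        * apply Rmult_le_pos; lra.
        * apply Rmult_le_compat_l; lra.
      + apply Req_le. transitivity (kap * K * del * (m * (axprod s + axprod (twist s al)) * n2 al)); [ring|]. rewrite hdel2. field. }
  assert (diff : forall k, log_lip_map (kap * M * half k) r e (fun s => sub2 (hk (S k) s) (hk k s))).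
  { induction k as [|k IH].
    - intros s hs. destruct (EL s hs) as (k1 & _ & _ & k4). rewrite half_0, Rmult_1_r.
      assert (e0 : forall s, sub2 (hk 1 s) (hk 0 s) = mact (minv N) (L s)).
      { intro x. simpl hk. replace (add2 (L x) (C0, C0)) with (L x) by (symmetry; apply (vadd_0 VC2)).
        destruct (mact (minv N) (L x)) as [u v]. unfold sub2; cbn [fst snd]. f_equal; ring. }
      split.
      + rewrite e0. eapply Rle_trans; [apply Bk|]. rewrite Rmult_assoc. apply Rmult_le_compat_l; lra.
      + intros al hal. rewrite !e0, <- mact_sub. eapply Rle_trans; [apply Bk|]. rewrite !Rmult_assoc.
        apply Rmult_le_compat_l; [lra|]. rewrite <- Rmult_assoc. auto.
    - assert (e0 : forall s, sub2 (hk (S (S k)) s) (hk (S k) s) = mact (minv N) (sub2 (hk (S k) (F s)) (hk k (F s)))).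
      { intro x. change (hk (S (S k)) x) with (mact (minv N) (add2 (L x) (hk (S k) (F x)))).
        change (hk (S k) x) with (mact (minv N) (add2 (L x) (hk k (F x)))). rewrite <- mact_sub. f_equal.
        unfold sub2, add2; cbn [fst snd]. f_equal; ring. }
      assert (p0 : 0 <= kap * M * half k) by (pose proof (half_pos k); assert (0 <= kap * M) by nra; nra).
      pose proof (step _ _ p0 IH) as S0.
      intros s hs. destruct (S0 s hs) as [s1 s2]. rewrite half_S.
      replace (kap * M * (half k / 2)) with (kap * M * half k / 2) by field. split.
      + rewrite e0. exact s1.
      + intros al hal. rewrite !e0. apply s2; auto. }
  assert (lim : forall s, axes_nbhd r e s -> exists l, forall n, n2 (sub2 (hk n s) l) <= 8 * (kap * M * axprod s) * half n).
  { intros s hs. apply geo_limit2. intro n. destruct (diff n s hs) as [d _]. eapply Rle_trans; [exact d|].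
    apply Req_le; ring. }
  assert (pk : 0 <= kap * M) by nra.
  assert (limh : forall s, axes_nbhd r e s -> forall n, n2 (sub2 (hk n s) (hh s)) <= M' * half n * axprod s).
  { intros s hs n. destruct (lim s hs) as [l hl]. rewrite (hlim_hh s l).
    - eapply Rle_trans; [apply hl|]. unfold M'. apply Req_le; ring.
    - exists (8 * (kap * M * axprod s)). split; auto. pose proof (axprod_ge0 s). nra. }
  (* The increments of the partial sums form a geometric sequence too; its limit is the increment of
     [hh] by uniqueness, so the Lipschitz constant of the remainder decays like [half n]. *)
  assert (tail : forall n, log_lip_map (M' * half n) r e (fun s => sub2 (hh s) (hk n s))).
  { intros n s hs. split; [rewrite n2_sub_sym; apply limh; auto|]. intros al hal.
    destruct (geo_limit2 (fun n => sub2 (hk n (twist s al)) (hk n s)) (kap * M * (axprod s + axprod (twist s al)) * n2 al)) as [l hl].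
    { intro m. destruct (diff m s hs) as [_ d]. specialize (d al hal).
      replace (sub2 (sub2 (hk (S m) (twist s al)) (hk (S m) s)) (sub2 (hk m (twist s al)) (hk m s))) with
        (sub2 (sub2 (hk (S m) (twist s al)) (hk m (twist s al))) (sub2 (hk (S m) s) (hk m s)))
        by (unfold sub2; cbn [fst snd]; f_equal; ring).
      eapply Rle_trans; [exact d|]. apply Req_le; ring. }
    assert (el : l = sub2 (hh (twist s al)) (hh s)).
    { apply n2_sub_eq. pose proof (axprod_ge0 s). pose proof (axprod_ge0 (twist s al)). pose proof (n2_ge0 al).
      apply (le_of_half _ (8 * (kap * M * (axprod s + axprod (twist s al)) * n2 al) + M' * axprod s + M' * axprod (twist s al))).
      { assert (0 <= kap * M * (axprod s + axprod (twist s al)) * n2 al) by (apply Rmult_le_pos; [apply Rmult_le_pos|]; lra). nra. }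
      intro m. eapply Rle_trans; [apply (n2_sub_tri _ (sub2 (hk m (twist s al)) (hk m s)))|].
      rewrite (n2_sub_sym l). specialize (hl m). cbn beta in hl.
      pose proof (limh s hs m) as u1. pose proof (limh _ hal m) as u2.
      assert (n2 (sub2 (sub2 (hk m (twist s al)) (hk m s)) (sub2 (hh (twist s al)) (hh s)))
         <= n2 (sub2 (hk m (twist s al)) (hh (twist s al))) + n2 (sub2 (hk m s) (hh s))).
      { replace (sub2 (sub2 (hk m (twist s al)) (hk m s)) (sub2 (hh (twist s al)) (hh s))) with
          (sub2 (sub2 (hk m (twist s al)) (hh (twist s al))) (sub2 (hk m s) (hh s))) by (unfold sub2; cbn [fst snd]; f_equal; ring).
        rewrite <- (n2_sub_0 (sub2 (hk m (twist s al)) (hh (twist s al)))), <- (n2_sub_0 (sub2 (hk m s) (hh s))).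
        rewrite (n2_sub_sym (sub2 (hk m s) (hh s)) (C0, C0)). apply n2_sub_tri. }
      lra. }
    specialize (hl n). cbn beta in hl. rewrite el in hl.
    replace (sub2 (sub2 (hh (twist s al)) (hk n (twist s al))) (sub2 (hh s) (hk n s))) with
      (sub2 (sub2 (hh (twist s al)) (hh s)) (sub2 (hk n (twist s al)) (hk n s))) by (unfold sub2; cbn [fst snd]; f_equal; ring).
    rewrite n2_sub_sym. eapply Rle_trans; [exact hl|]. unfold M'. apply Req_le; ring. }
  assert (difk : forall k s, axes_nbhd r e s -> Dif2 (fun x => fst (hk k x)) s /\ Dif2 (fun x => snd (hk k x)) s).
  { induction k as [|k IH]; intros s hs.
    - split; exact (Dif_const VC2 C0 s).
    - destruct (EL s hs) as (_ & dl1 & dl2 & _). destruct (Dif2_TwMap N L s dl1 dl2) as [df1 df2].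
      destruct (HFs s hs) as (hd & _). destruct (IH _ hd) as [i1 i2].
      pose proof (Dif2_pair (fun x => fst (hk k x)) F s i1 df1 df2) as j1.
      pose proof (Dif2_pair (fun x => snd (hk k x)) F s i2 df1 df2) as j2.
      cbn [hk]. destruct (minv N) as [[[a b] c] d]. unfold mact, add2; cbn [fst snd].
      split; apply (Dif_comb VC2); apply (Dif_add VC2); auto. }
  exists e, M'. split; auto. split; auto. split; [|split].
  - intros s hs. destruct (tail 0%nat s hs) as [t1 t2]. rewrite half_0, Rmult_1_r in *.
    split; [|split; [|split]].
    + rewrite <- n2_sub_0. exact t1.
    + destruct (log_lip_map_local r e s h1 hs) as (d & C & hd & hC & _ & HC).
      apply (Dif2_limit _ (fun n x => fst (hk n x)) s (C * M') d); auto; [apply Rmult_le_pos; auto|intro n; apply difk; auto|].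
      intros n k hk'. assert (pn : 0 <= M' * half n) by (pose proof (half_pos n); nra).
      specialize (HC _ _ pn (tail n) k hk').
      eapply Rle_trans; [|apply Req_le].
      * eapply Rle_trans; [|exact HC]. unfold n2, sub2; cbn [fst snd]. match goal with |- _ <= _ + ?x => assert (0 <= x) by apply Cabs_ge0 end. lra.
      * ring.
    + destruct (log_lip_map_local r e s h1 hs) as (d & C & hd & hC & _ & HC).
      apply (Dif2_limit _ (fun n x => snd (hk n x)) s (C * M') d); auto; [apply Rmult_le_pos; auto|intro n; apply difk; auto|].
      intros n k hk'. assert (pn : 0 <= M' * half n) by (pose proof (half_pos n); nra).
      specialize (HC _ _ pn (tail n) k hk').
      eapply Rle_trans; [|apply Req_le].
      * eapply Rle_trans; [|exact HC]. unfold n2, sub2; cbn [fst snd]. match goal with |- _ <= ?x + _ => assert (0 <= x) by apply Cabs_ge0 end. lra.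
      * ring.
    + intros al hal. specialize (t2 al hal). simpl hk in t2.
      replace (sub2 (hh (twist s al)) (hh s)) with (sub2 (sub2 (hh (twist s al)) (C0, C0)) (sub2 (hh s) (C0, C0)))
        by (unfold sub2; cbn [fst snd]; f_equal; ring). exact t2.
  - assert (e * (4 * (M' + 1)) <= 1).
    { apply Rle_trans with (/ (4 * (M' + 1)) * (4 * (M' + 1))); [apply Rmult_le_compat_r; lra|]. rewrite Rinv_l; lra. }
    nra.
  - intros s hs. destruct (HFs s hs) as (d1 & b1 & b2 & b3). pose proof (axprod_ge0 s).
    split; [|split; [|split; [|split]]]; auto; [nra|].
    assert (eq : hh s = mact (minv N) (add2 (L s) (hh (F s)))).
    { apply hlim_hh. pose proof (limh _ d1) as lF.
      (* The factor [2] pays for the index shift from [n] to [S n], the last term for [n = 0]. *)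
      exists (2 * (kap * M') + n2 (sub2 (C0, C0) (mact (minv N) (add2 (L s) (hh (F s)))))).
      pose proof (n2_ge0 (sub2 (C0, C0) (mact (minv N) (add2 (L s) (hh (F s)))))) as pn.
      split; [nra|]. intros [|n].
      - rewrite half_0. simpl hk. nra.
      - cbn [hk]. rewrite <- mact_sub. eapply Rle_trans; [apply Bk|].
        replace (sub2 (add2 (L s) (hk n (F s))) (add2 (L s) (hh (F s)))) with (sub2 (hk n (F s)) (hh (F s)))
          by (unfold sub2, add2; cbn [fst snd]; f_equal; ring).
        specialize (lF n). rewrite half_S. pose proof (half_pos n). pose proof (axes_nbhd_lt1 _ _ _ h1 d1). pose proof (axprod_ge0 (F s)).
        apply Rle_trans with (kap * (M' * half n)).
        + apply Rmult_le_compat_l; [lra|]. eapply Rle_trans; [exact lF|].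
          assert (0 <= M' * half n) by nra. nra.
        + nra. }
    unfold Phi0. rewrite (monomial_twist N s (hh s) N_nonneg).
    unfold F at 1, TwMap. rewrite twist_add. f_equal. fold (TwMap N L s). fold F.
    rewrite eq at 1. rewrite <- mact_mmul, (proj1 (mmul_minv N N_inv)), mact_mid. reflexivity.
Qed.

End Linearize.

(** * Injectivity and inverse of the linearizing map *)

Fixpoint iter {T : Type} (k : nat) (f : T -> T) (x : T) : T :=
  match k with O => x | S k' => f (iter k' f x) end.

Lemma iter_add {T : Type} (f : T -> T) m n x : iter (m + n) f x = iter m f (iter n f x).
Proof. induction m as [|m IH]; simpl; [reflexivity|rewrite IH; reflexivity]. Qed.

Lemma iter_succ_r {T : Type} (f : T -> T) k x : iter (S k) f x = iter k f (f x).
Proof. induction k as [|k IH]; simpl in *; [reflexivity|rewrite IH; reflexivity]. Qed.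

Definition opp2 (al : C2) : C2 := (- fst al, - snd al)%cc.

Section Inverse.
Variables (N : Mat2) (L : C2 -> C2).
Hypothesis N_pos : positive_entries N.
Hypothesis N_inv : inGL2Z N.
Hypothesis HL : forall r, 0 < r -> r < 1 -> log_monomial r N L.

(* A further property that the domain [lin_domain] of the linearization is required to have. *)
Variable extra : C2 -> Prop.
Hypothesis HEx : forall r, 0 < r -> r < 1 -> near_axes r extra.

Let F : C2 -> C2 := TwMap N L.
Let Phi : C2 -> C2 := Phi0 N L.

Lemma linearizable_on_mono r e e' M : r < 1 -> 0 < e' -> e' <= e -> linearizable_on N L r e M -> linearizable_on N L r e' M.
Proof.
  intros hr he' hle (he & hM & HE & hs & H). split; auto. split; auto.
  split; [eapply log_lip_pair_mono; [| |exact HE]; lra|]. split; [nra|].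
  intros s ds. destruct (H s) as (a1 & a2 & a3 & a4 & a5); [eapply axes_nbhd_mono; try eassumption; lra|].
  destruct a1 as (b1 & b2 & _). destruct ds as (_ & _ & ds). pose proof (axprod_ge0 s).
  repeat split; auto. lra.
Qed.

Definition linearizable_chart (r : R) (p : R * R) : Prop :=
  linearizable_on N L r (fst p) (snd p) /\ forall s, axes_nbhd r (fst p) s -> extra s.
Definition lin_bounds (r : R) : R * R := epsilon (inhabits (0, 0)) (linearizable_chart r).
Definition lin_radius (r : R) : R := fst (lin_bounds r).

Lemma lin_bounds_spec r : 0 < r -> r < 1 -> linearizable_chart r (lin_bounds r).
Proof.
  intros h0 h1. destruct (linearize N L N_pos N_inv HL r h0 h1) as (e & M & H).
  destruct (HEx r h0 h1) as (e' & he' & H').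
  unfold lin_bounds. apply epsilon_spec. exists (Rmin e e', M). rmin e e'.
  split; cbn [fst snd].
  - apply (linearizable_on_mono r e); auto. apply Rmin_pos; auto. apply H.
  - intros s hs. apply H'. eapply axes_nbhd_mono; try eassumption; lra.
Qed.

Lemma lin_radius_good r : 0 < r -> r < 1 -> linearizable_on N L r (lin_radius r) (snd (lin_bounds r)).
Proof. intros h0 h1. apply (lin_bounds_spec r h0 h1). Qed.

(** The union over all radii contains both axes of the open unit bidisk, which the neighborhood over
    a single radius does not. *)
Definition lin_domain (s : C2) : Prop := exists r, 0 < r /\ r < 1 /\ axes_nbhd r (lin_radius r) s.

Lemma W_Ex s : lin_domain s -> extra s.
Proof. intros (r & h0 & h1 & hs). apply (lin_bounds_spec r h0 h1); auto. Qed.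

Lemma add2_opp2 x : add2 x (opp2 x) = (C0, C0).
Proof. unfold add2, opp2; cbn [fst snd]. f_equal; ring. Qed.

Lemma add2_opp2_l x : add2 (opp2 x) x = (C0, C0).
Proof. unfold add2, opp2; cbn [fst snd]. f_equal; ring. Qed.

(** Equal images give [s' = s exp be] with [be = h s - h s'], and the contraction bound forces
    [be = 0]. The bound compares points over one and the same radius. *)
Lemma Phi_inj r s s' : 0 < r -> r < 1 -> axes_nbhd r (lin_radius r) s -> axes_nbhd r (lin_radius r) s' -> Phi s = Phi s' -> s = s'.
Proof.
  intros h0 h1 hs hs' e. destruct (lin_radius_good r h0 h1) as (he & hM & HE & hsm & _).
  set (M := snd (lin_bounds r)) in *. set (be := sub2 (hh N L s) (hh N L s')).
  assert (e' : s' = twist s be).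
  { transitivity (twist (Phi s') (opp2 (hh N L s'))).
    - unfold Phi, Phi0. rewrite twist_add, add2_opp2, twist_0. reflexivity.
    - rewrite <- e. unfold Phi, Phi0. rewrite twist_add. reflexivity. }
  destruct (HE s hs) as (_ & _ & _ & H). specialize (H be). rewrite <- e' in H. specialize (H hs').
  rewrite n2_sub_sym in H. fold be in H. destruct hs as (_ & _ & hs). destruct hs' as (_ & _ & hs').
  assert (M * (axprod s + axprod s') * n2 be <= 1/2 * n2 be).
  { apply Rmult_le_compat_r; [apply n2_ge0|]. nra. }
  assert (hb : be = (C0, C0)) by (apply n2_sub_eq; rewrite n2_sub_0; lra).
  rewrite e', hb, twist_0. reflexivity.
Qed.

Lemma Phi_axis s : lin_domain s -> axprod s = 0 -> Phi s = s.
Proof.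
  intros (r & h0 & h1 & hs) e. destruct (lin_radius_good r h0 h1) as (_ & _ & HE & _ & _).
  destruct (HE s hs) as (H & _). rewrite e, Rmult_0_r in H.
  assert (hb : hh N L s = (C0, C0)) by (apply n2_sub_eq; rewrite n2_sub_0; lra).
  unfold Phi, Phi0. rewrite hb, twist_0. reflexivity.
Qed.

Lemma W_F s : lin_domain s -> lin_domain (F s) /\ Phi (F s) = monomial N (Phi s).
Proof.
  intros (r & h0 & h1 & hs). destruct (lin_radius_good r h0 h1) as (_ & _ & _ & _ & H).
  destruct (H s hs) as (a & _ & _ & _ & b). split; auto. exists r; auto.
Qed.

(** Iteration brings points found over different radii over a common one, where [Phi_inj] applies.
    The product [axprod] is halved at each step, and the coordinates are bounded by that of the
    previous iterate. *)
Lemma F_iter_small s r0 e0 : lin_domain s -> 0 < r0 -> 0 < e0 ->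
  exists k0, forall k, (k0 <= k)%nat -> axes_nbhd r0 e0 (iter k F s).
Proof.
  intros (r & h0 & h1 & hs) hr0 he0. destruct (lin_radius_good r h0 h1) as (_ & _ & _ & _ & H).
  assert (I : forall k, axes_nbhd r (lin_radius r) (iter k F s) /\ axprod (iter k F s) <= half k).
  { induction k as [|k [I1 I2]]; simpl.
    - split; auto. rewrite half_0. apply (axes_nbhd_lt1 r (lin_radius r)); auto.
    - destruct (H _ I1) as (a & _ & _ & b & _). split; auto. rewrite half_S. change (TwMap N L) with F in b. lra. }
  destruct (half_small 4 (Rmin r0 e0) ltac:(lra) ltac:(apply Rmin_pos; auto)) as [n hn].
  rmin r0 e0.
  assert (mono : forall k, half (n + k) <= half n).
  { induction k as [|k IH]; [rewrite Nat.add_0_r; lra|]. rewrite Nat.add_succ_r, half_S. pose proof (half_pos (n + k)). lra. }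
  exists (S n). intros k hk. destruct k as [|k]; [lia|].
  destruct (I k) as [I1 I2]. destruct (I (S k)) as [_ I3]. destruct (H _ I1) as (_ & a1 & a2 & _ & _).
  specialize (mono (k - n)%nat). replace (n + (k - n))%nat with k in mono by lia. rewrite half_S in I3.
  pose proof (half_pos n). pose proof (half_pos k). change (TwMap N L) with F in a1, a2. change (iter (S k) F s) with (F (iter k F s)) in *. repeat split; lra.
Qed.

Lemma Dif2_Phi s : lin_domain s -> Dif2 (fun x => fst (Phi x)) s /\ Dif2 (fun x => snd (Phi x)) s.
Proof.
  intros (r & h0 & h1 & hs). destruct (lin_radius_good r h0 h1) as (_ & _ & HE & _ & _).
  destruct (HE s hs) as (_ & d1 & d2 & _). unfold Phi, Phi0, twist; cbn [fst snd].
  split.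
  - apply (Dif_mul VC2 fst); [apply Dif2_fst|]. exact (Dif_comp1 VC2 cexp _ s (Dif1_cexp _) d1).
  - apply (Dif_mul VC2 snd); [apply Dif2_snd|]. exact (Dif_comp1 VC2 cexp _ s (Dif1_cexp _) d2).
Qed.

(* The inverse at [t] is [twist t (-al)], where [al] is the fixed point of the contraction
   [al |-> hh (twist t (-al))]. *)
Lemma Phi_inverse r : 0 < r -> r < 1 -> exists e2 (G : C2 -> C2), 0 < e2 /\
  forall t, axes_nbhd r e2 t -> lin_domain (G t) /\ Phi (G t) = t /\ Dif2 (fun x => fst (G x)) t /\ Dif2 (fun x => snd (G x)) t.
Proof.
  (* The inverse moves [t] by a twist, which multiplies moduli by at most [1 + 6 * rho]; the room
     for this is the gap between [r] and [r']. *)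
  intros h0 h1. set (r' := (1 + r) / 2). assert (h0' : 0 < r') by (unfold r'; lra). assert (h1' : r' < 1) by (unfold r'; lra).
  destruct (lin_radius_good r' h0' h1') as (he & hM & HE & _ & _). set (e1 := lin_radius r') in *. set (M := snd (lin_bounds r')) in *.
  set (h := hh N L) in *.
  set (rho := Rmin (1/4) ((r' - r) / 12)).
  assert (hrho : 0 < rho) by (unfold rho; apply Rmin_pos; unfold r'; lra).
  assert (hrho1 : rho <= 1/4) by apply Rmin_l. assert (hrho2 : rho <= (r' - r) / 12) by apply Rmin_r.
  set (e2 := Rmin (e1 / 8) (rho / (16 * (M + 1)))).
  assert (hi : 0 < rho / (16 * (M + 1))) by (apply Rdiv_lt_0_compat; lra).
  assert (he2 : 0 < e2) by (unfold e2; apply Rmin_pos; lra).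
  assert (l1 : e2 <= e1 / 8) by apply Rmin_l.
  assert (l2 : 16 * (M + 1) * e2 <= rho).
  { apply Rle_trans with (16 * (M + 1) * (rho / (16 * (M + 1)))).
    - apply Rmult_le_compat_l; [lra|apply Rmin_r].
    - apply Req_le; field; lra. }
  assert (tD : forall t al, axes_nbhd r e2 t -> n2 al <= rho -> axes_nbhd r' e1 (twist t (opp2 al)) /\ axprod (twist t (opp2 al)) <= 4 * axprod t).
  { intros t al (t1 & t2 & t3) ha.
    assert (b : forall z x, Cabs z < r -> Cabs x <= rho -> Cabs (z * cexp (- x)) < r').
    { intros z x hz hx. rewrite Cabs_mul. pose proof (cexp_m1_bound (- x)) as g. rewrite Cabs_opp in g.
      pose proof (cexp_le2 (- x)%cc ltac:(rewrite Cabs_opp; lra)) as g2.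
      pose proof (Cabs_tri_rev (cexp (- x)) 1) as g3. rewrite Cabs_C1 in g3. pose proof (Cabs_ge0 x). pose proof (Cabs_ge0 z).
      assert (Cabs (cexp (- x)) <= 1 + 6 * rho) by nra.
      apply Rle_lt_trans with (Cabs z * (1 + 6 * rho)); [apply Rmult_le_compat_l; auto|]. nra. }
    unfold n2 in ha. pose proof (Cabs_ge0 (fst al)). pose proof (Cabs_ge0 (snd al)).
    assert (p : axprod (twist t (opp2 al)) <= 4 * axprod t).
    { rewrite axprod_twist. unfold opp2; cbn [fst snd].
      pose proof (cexp_le2 (- fst al)%cc ltac:(rewrite Cabs_opp; lra)). pose proof (cexp_le2 (- snd al)%cc ltac:(rewrite Cabs_opp; lra)).
      pose proof (axprod_ge0 t). pose proof (Cabs_ge0 (cexp (- fst al))). pose proof (Cabs_ge0 (cexp (- snd al))).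
      replace (4 * axprod t) with (axprod t * 2 * 2) by ring. repeat apply Rmult_le_compat; try apply Rmult_le_pos; auto using Cabs_ge0; lra. }
    split; auto. split; [|split]; [apply b; lra|apply b; lra|lra]. }
  (* Varying the base point [t] and the unknown [al] together yields at once the contraction, with
     [ga = 0], and the dependence of the fixed point on [t]. *)
  assert (lip : forall t t' ga al al', axes_nbhd r e2 t -> axes_nbhd r e2 t' -> t' = twist t ga -> n2 al <= rho -> n2 al' <= rho ->
    n2 (sub2 (h (twist t' (opp2 al'))) (h (twist t (opp2 al)))) <= M * (4 * axprod t + 4 * axprod t') * (n2 ga + n2 (sub2 al al'))).
  { intros t t' ga al al' ht ht' et ha ha'.
    destruct (tD t al ht ha) as [d1 p1]. destruct (tD t' al' ht' ha') as [d2 p2].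
    assert (e : twist t' (opp2 al') = twist (twist t (opp2 al)) (add2 ga (sub2 al al'))).
    { rewrite et, !twist_add. f_equal. unfold add2, sub2, opp2; cbn [fst snd]. f_equal; ring. }
    destruct (HE _ d1) as (_ & _ & _ & H). rewrite e in *. eapply Rle_trans; [apply H; auto|].
    pose proof (axprod_ge0 (twist t (opp2 al))). pose proof (axprod_ge0 (twist (twist t (opp2 al)) (add2 ga (sub2 al al')))).
    apply Rmult_le_compat; auto using n2_ge0, n2_add.
    - apply Rmult_le_pos; lra.
    - apply Rmult_le_compat_l; lra. }
  assert (half_lip : forall t al al', axes_nbhd r e2 t -> n2 al <= rho -> n2 al' <= rho ->
    n2 (sub2 (h (twist t (opp2 al'))) (h (twist t (opp2 al)))) <= / 2 * n2 (sub2 al' al)).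
  { intros t al al' ht ha ha'. eapply Rle_trans; [apply (lip t t (C0, C0)); auto; rewrite twist_0; auto|].
    rewrite n2_fst, Cabs_C0, Rplus_0_l, (n2_sub_sym al). apply Rmult_le_compat_r; [apply n2_ge0|].
    destruct ht as (_ & _ & ht). nra. }
  assert (fix_ex : forall t, axes_nbhd r e2 t -> exists al, n2 al <= rho /\ h (twist t (opp2 al)) = al).
  { intros t ht. set (T := fun al => h (twist t (opp2 al))).
    assert (Tb : forall al, n2 al <= rho -> n2 (T al) <= rho / 2).
    { intros al ha. destruct (tD t al ht ha) as [d1 p1]. destruct (HE _ d1) as (H & _). unfold T.
      eapply Rle_trans; [exact H|]. destruct ht as (_ & _ & ht). nra. }
    set (u := fun n => iter n T (C0, C0)).
    assert (ub : forall n, n2 (u n) <= rho).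
    { induction n as [|n IH]; [unfold u; simpl iter; rewrite n2_fst, Cabs_C0; lra|]. specialize (Tb _ IH). unfold u in *. simpl. lra. }
    assert (ud : forall n, n2 (sub2 (u (S n)) (u n)) <= rho * half n).
    { induction n as [|n IH].
      - rewrite half_0. simpl u. unfold u; simpl iter. rewrite n2_sub_0. pose proof (Tb (C0, C0) ltac:(rewrite n2_fst, Cabs_C0; lra)). lra.
      - rewrite half_S. pose proof (half_lip t (u n) (u (S n)) ht (ub n) (ub (S n))) as g.
        change (u (S (S n))) with (T (u (S n))). change (u (S n)) with (T (u n)) at 2. unfold T at 1 2. lra. }
    destruct (geo_limit2 u rho ud) as [al hal].
    assert (ha : n2 al <= rho).
    { apply Rnot_lt_le. intro hlt. enough (n2 al - rho <= 0) by lra. apply (le_of_half _ (8 * rho)); [lra|].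
      intro n. specialize (hal n). specialize (ub n). pose proof (n2_sub_tri al (u n) (C0, C0)) as g.
      rewrite !n2_sub_0, (n2_sub_sym al) in g. lra. }
    exists al. split; auto. apply n2_sub_eq. apply (le_of_half _ (8 * rho)); [lra|]. intro n.
    eapply Rle_trans; [apply (n2_sub_tri _ (T (u n)))|].
    pose proof (half_lip t (u n) al ht (ub n) ha) as g. pose proof (hal n) as g1. pose proof (hal (S n)) as g2.
    rewrite half_S in g2. change (u (S n)) with (T (u n)) in g2. rewrite (n2_sub_sym al) in g. fold (T al) (T (u n)) in g.
    fold (T al). pose proof (half_pos n). lra. }
  set (al := fun t => epsilon (inhabits (C0, C0)) (fun al => n2 al <= rho /\ h (twist t (opp2 al)) = al)).
  assert (al_spec : forall t, axes_nbhd r e2 t -> n2 (al t) <= rho /\ h (twist t (opp2 (al t))) = al t).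
  { intros t ht. exact (epsilon_spec _ (fun al => n2 al <= rho /\ h (twist t (opp2 al)) = al) (fix_ex t ht)). }
  clearbody al. clear fix_ex.
  set (G := fun t => twist t (opp2 (al t))).
  (* In the inequality of [lip] for two fixed points, the increment of [al] also occurs on the
     right, with a coefficient at most [1/2], and is absorbed. *)
  assert (al_lip : log_lip_map (8 * M) r e2 al).
  { intros t ht. destruct (al_spec t ht) as [a1 a2]. split.
    - destruct (tD t _ ht a1) as [d1 p1]. destruct (HE _ d1) as (H & _). fold h in H. rewrite a2 in H.
      pose proof (axprod_ge0 t). nra.
    - intros ga hga. destruct (al_spec _ hga) as [b1 b2].
      pose proof (lip t _ ga _ _ ht hga eq_refl a1 b1) as g. rewrite a2, b2 in g.
      rewrite (n2_sub_sym (al t)) in g. set (x := n2 (sub2 (al (twist t ga)) (al t))) in *.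
      assert (hx : 0 <= x) by apply n2_ge0. pose proof (n2_ge0 ga). pose proof (axprod_ge0 t). pose proof (axprod_ge0 (twist t ga)).
      assert (M * (4 * axprod t + 4 * axprod (twist t ga)) * x <= 1/2 * x).
      { apply Rmult_le_compat_r; auto. destruct ht as (_ & _ & ht). destruct hga as (_ & _ & hga). nra. }
      lra. }
  exists e2, G. split; auto. intros t ht.
  assert (hG : forall t, axes_nbhd r e2 t -> lin_domain (G t) /\ Phi (G t) = t).
  { intros x hx. destruct (al_spec x hx) as [a1 a2]. destruct (tD x _ hx a1) as [d1 _]. split.
    - exists r'; auto.
    - unfold Phi, Phi0. fold h. unfold G. rewrite a2, twist_add, add2_opp2_l, twist_0. reflexivity. }
  destruct (hG t ht) as [w1 w2]. split; auto. split; auto.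
  (* [log_lip_map_local] turns [al_lip] into a bound on additive increments; then [G] is a Lipschitz
     right inverse of [Phi] and [Dif2_inverse] applies. *)
  destruct (Dif2_Phi _ w1) as [D1 D2].
  destruct (log_lip_map_local r e2 t h1 ht) as (d & C & hd & hC & Dn & HC).
  specialize (HC (8 * M) al ltac:(lra) al_lip).
  apply (Dif2_inverse (fun x => fst (Phi x)) (fun x => snd (Phi x)) G t (24 * (C * (8 * M)) + 2) d); auto.
  - assert (0 <= C * (8 * M)) by (apply Rmult_le_pos; lra). lra.
  - intros k hk. specialize (HC k hk). specialize (Dn k hk). destruct (al_spec t ht) as [a1 _]. destruct (al_spec _ Dn) as [b1 _].
    set (t' := add2 t k) in *. set (g := sub2 (al t') (al t)) in *.
    assert (hg : n2 g <= 1/2).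
    { unfold g. eapply Rle_trans; [apply (n2_sub_tri _ (C0, C0))|]. rewrite (n2_sub_sym (C0, C0)), !n2_sub_0. lra. }
    assert (key : forall z z' x x', Cabs z' <= 1 -> Cabs x <= 1/4 -> Cabs (x' - x) <= 1/2 ->
      Cabs (z' * cexp (- x') - z * cexp (- x)) <= 24 * Cabs (x' - x) + 2 * Cabs (z' - z)).
    { intros z z' x x' hz hx hxx.
      replace (z' * cexp (- x') - z * cexp (- x))%cc with (z' * (cexp (- x) * (cexp (- (x' - x)) - 1)) + (z' - z) * cexp (- x))%cc.
      2:{ replace (- x')%cc with (- x + - (x' - x))%cc by ring. rewrite cexp_add. ring. }
      eapply Rle_trans; [apply Cabs_tri|]. rewrite !Cabs_mul.
      pose proof (cexp_le2 (- x)%cc ltac:(rewrite Cabs_opp; lra)) as g1.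
      pose proof (cexp_m1_bound (- (x' - x))) as g2. rewrite Cabs_opp in g2.
      pose proof (cexp_le2 (- (x' - x))%cc ltac:(rewrite Cabs_opp; lra)) as g3.
      pose proof (Cabs_ge0 (x' - x)%cc). pose proof (Cabs_ge0 (z' - z)%cc). pose proof (Cabs_ge0 (cexp (- x))).
      pose proof (Cabs_ge0 (cexp (- (x' - x)) - 1)%cc). pose proof (Cabs_ge0 z').
      assert (Cabs (cexp (- (x' - x)) - 1) <= 6 * Cabs (x' - x)) by nra.
      assert (Cabs (cexp (- x)) * Cabs (cexp (- (x' - x)) - 1) <= 2 * (6 * Cabs (x' - x))) by (apply Rmult_le_compat; auto).
      assert (Cabs z' * (Cabs (cexp (- x)) * Cabs (cexp (- (x' - x)) - 1)) <= 1 * (2 * (6 * Cabs (x' - x)))) by (apply Rmult_le_compat; auto; apply Rmult_le_pos; auto).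
      nra. }
    destruct Dn as (n1 & n3 & _). unfold n2 in a1, hg. pose proof (Cabs_ge0 (fst (al t))). pose proof (Cabs_ge0 (snd (al t))).
    pose proof (Cabs_ge0 (fst g)). pose proof (Cabs_ge0 (snd g)).
    pose proof (key (fst t) (fst t') (fst (al t)) (fst (al t')) ltac:(lra) ltac:(lra) ltac:(change (fst (al t') - fst (al t))%cc with (fst g); lra)) as q1.
    pose proof (key (snd t) (snd t') (snd (al t)) (snd (al t')) ltac:(lra) ltac:(lra) ltac:(change (snd (al t') - snd (al t))%cc with (snd g); lra)) as q2.
    unfold G, twist, opp2, n2 at 1, sub2; cbn [fst snd].
    change (fst (al t') - fst (al t))%cc with (fst g) in q1. change (snd (al t') - snd (al t))%cc with (snd g) in q2.
    assert (k1 : (fst t' - fst t)%cc = fst k) by (unfold t', add2; cbn [fst]; ring).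
    assert (k2 : (snd t' - snd t)%cc = snd k) by (unfold t', add2; cbn [snd]; ring).
    rewrite k1 in q1. rewrite k2 in q2. unfold n2 in *. nra.
  - intros k hk. destruct (hG _ (Dn k hk)) as [_ ->]. auto.
Qed.

End Inverse.

(** * The surface in the charts at infinity *)

Definition jouk (u : CC) : CC := (- ((1 + u * u) / u))%cc.
Definition pt3 (f : letter -> CC) : C3 := (f Lx, f Ly, f Lz).
(** Puts [x] at the place of [j] and [y], [z] at those of [o1 j], [o2 j], so that one computation
    serves the three vertices. *)
Definition cpl (j : letter) (x y z : CC) : C3 :=
  match j with Lx => (x, y, z) | Ly => (y, x, z) | Lz => (y, z, x) end.
Definition cpl4 (j : letter) (x y z t : CC) : C4 :=
  match j with Lx => c4 x y z t | Ly => c4 y x z t | Lz => c4 y z x t end.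
Definition lidx (j : letter) : nat := match j with Lx => 0 | Ly => 1 | Lz => 2 end.

Definition offax (s : C2) : Prop := fst s <> C0 /\ snd s <> C0.

Lemma jouk_inv_jouk z : z <> C0 -> jouk_inv z <> C0 /\ jouk (jouk_inv z) = (- Cinv z)%cc.
Proof.
  intro hz. pose proof (jouk_inv_right z) as h. pose proof (one_add_jouk_inv_sq_neq0 z) as hn.
  set (u := jouk_inv z) in *. clearbody u. subst z.
  assert (hj : u <> C0).
  { intro e. apply hz. rewrite e. unfold Cdiv. ring. }
  split; auto. unfold jouk. field. auto.
Qed.

Lemma jouk_recover u : u <> C0 -> Cabs u < 1 -> jouk_inv (- Cinv (jouk u))%cc = u.
Proof.
  intros hu au. rewrite <- (jouk_inv_left u au) at 2. f_equal. pose proof (one_add_sq_neq0 u au).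
  transitivity (- Cinv ((- (1)) * ((1 + u * u) / u)))%cc; [unfold jouk; do 2 f_equal; ring|].
  assert (hm : (- (1))%cc <> C0) by (intro g; apply C1_neq0; replace C1 with (- - (1))%cc by ring; rewrite g; ring).
  field. auto.
Qed.

Lemma jouk_inj u v : u <> C0 -> v <> C0 -> Cabs u < 1 -> Cabs v < 1 -> jouk u = jouk v -> u = v.
Proof. intros hu hv au av e. rewrite <- (jouk_recover u), <- (jouk_recover v), e; auto. Qed.

Section Surface.
Variables A B Cc D : CC.

Notation par := (param_at A B Cc).
Notation ej := (log_factor_at A B Cc D).
Notation Xj := (X_at A B Cc D).
Notation tri := (u_coord A B Cc D).

Lemma onS_cpl j x y z : onS A B Cc D (cpl j x y z) <->
  (x * x + y * y + z * z + x * (y * z) = par j * x + par (o1 j) * y + par (o2 j) * z + D)%cc.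
Proof.
  unfold onS, cpl. destruct j; cbn [o1 o2 param_at]; split; intro h;
    match goal with |- ?l = _ => match type of h with ?l' = ?r' => transitivity l'; [ring|rewrite h; ring] end end.
Qed.

Definition hom_eqn (j : letter) (x y z t : CC) : Prop :=
  (t * (x * x + y * y + z * z) + x * (y * z) = t * t * (par j * x + par (o1 j) * y + par (o2 j) * z) + D * (t * (t * t)))%cc.

Lemma onbarS_cpl4 j x y z t : onbarS A B Cc D (cpl4 j x y z t) <-> cpl4 j x y z t <> zero4 /\ hom_eqn j x y z t.
Proof.
  unfold onbarS, cpl4, hom_eqn. destruct j; cbn [o1 o2 param_at c4]; (split; intros [h0 h]; (split; [exact h0|]));
    match goal with |- ?l = _ => match type of h with ?l' = ?r' => transitivity l'; [ring|rewrite h; ring] end end.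
Qed.

Definition affine_pt (j : letter) (s : C2) : C3 :=
  cpl j (- (Xj j s / (fst s * snd s)))%cc (jouk (fst s)) (jouk (snd s)).
(** The representative of [affine_pt] scaled by [- uv], which makes sense on the axes and sends them
    to the plane at infinity. *)
Definition proj_pt (j : letter) (s : C2) : C4 :=
  cpl4 j (Xj j s) (snd s * (1 + fst s * fst s))%cc (fst s * (1 + snd s * snd s))%cc (- (fst s * snd s))%cc.

Definition quadj j s := Xf_quad (par j) (par (o1 j)) (par (o2 j)) D s.

Lemma Paff_onS j s : offax s -> onS A B Cc D (affine_pt j s).
Proof.
  destruct s as [p q]. intros [hp hq]; cbn [fst snd] in *. apply onS_cpl. cbn [fst snd].
  pose proof (quadj j (p, q)) as h. change (Xf _ _ _ _ (p, q)) with (Xj j (p, q)) in h.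
  set (X := Xj j (p, q)) in *. unfold Sumf, Prodf in h; cbn [fst snd] in h.
  apply Csub_eq0. unfold jouk. set (a := par j) in *. set (b := par (o1 j)) in *. set (c := par (o2 j)) in *.
  clearbody X a b c.
  match type of h with ?g = _ => transitivity (g / (p * p * (q * q)))%cc end.
  - cfield.
  - rewrite h. unfold Cdiv. ring.
Qed.

Lemma Pi4_eqn j s : hom_eqn j (Xj j s) (snd s * (1 + fst s * fst s))%cc (fst s * (1 + snd s * snd s))%cc (- (fst s * snd s))%cc.
Proof.
  unfold hom_eqn. destruct s as [p q]. cbn [fst snd].
  pose proof (quadj j (p, q)) as h. change (Xf _ _ _ _ (p, q)) with (Xj j (p, q)) in h.
  set (X := Xj j (p, q)) in *. unfold Sumf, Prodf in h; cbn [fst snd] in h.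
  apply Csub_eq0. set (a := par j) in *. set (b := par (o1 j)) in *. set (c := par (o2 j)) in *. clearbody X a b c.
  match type of h with ?g = _ => transitivity (- (p * q) * g)%cc end.
  - ring.
  - rewrite h. ring.
Qed.

Lemma cpl4_neq0 j x y z t : x <> C0 -> cpl4 j x y z t <> zero4.
Proof.
  intros hx e. unfold cpl4, zero4, c4 in e. destruct j; inversion e; auto.
Qed.

Lemma Pi4_onbarS j s : Xj j s <> C0 -> onbarS A B Cc D (proj_pt j s).
Proof. intro h. apply onbarS_cpl4. split; [apply cpl4_neq0; auto|apply Pi4_eqn]. Qed.

Lemma coord3_cpl4 j x y z t : coord 3 (cpl4 j x y z t) = t.
Proof. destruct j; reflexivity. Qed.

Lemma coordj_cpl4 j x y z t : coord (lidx j) (cpl4 j x y z t) = x.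
Proof. destruct j; reflexivity. Qed.

Lemma peq_lift_Paff j s : offax s -> peq (proj_pt j s) (lift3 (affine_pt j s)).
Proof.
  intros [hp hq]. destruct s as [p q]. cbn [fst snd] in *.
  assert (hpq : (- (p * q))%cc <> C0).
  { intro e. apply (Cmul_neq0 p q hp hq). replace (p * q)%cc with (- - (p * q))%cc by ring. rewrite e; ring. }
  split.
  - intro e. apply hpq. apply (f_equal (coord 3)) in e. unfold proj_pt in e. rewrite coord3_cpl4 in e. exact e.
  - exists (Cinv (- (p * q)))%cc. split; [apply Cinv_neq0; auto|].
    assert (e : Cinv (- (p * q))%cc = (- (Cinv (p * q)))%cc).
    { assert (h1 : (p * q)%cc <> C0) by (apply Cmul_neq0; auto). 
      transitivity (Cinv ((- (1)) * (p * q)))%cc; [f_equal; ring|].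
      transitivity (- (1) * (- (1) * Cinv ((- (1)) * (p * q))))%cc; [ring|].
      assert (hm : (- (1))%cc <> C0) by (intro g; apply C1_neq0; replace C1 with (- - (1))%cc by ring; rewrite g; ring).
      field. auto. }
    rewrite e. intros i hi. unfold proj_pt, affine_pt, jouk, cpl4, cpl, c4, lift3; cbn [fst snd].
    destruct j; destruct i as [|[|[|[|i]]]]; simpl coord; try lia; cfield.
Qed.

(** ** The involutions in the charts *)

Lemma s_of_pt3 i f : s_of A B Cc i (pt3 f) =
  cpl i (par i - f (o1 i) * f (o2 i) - f i)%cc (f (o1 i)) (f (o2 i)).
Proof. unfold s_of, pt3, s_x, s_y, s_z, cpl. destruct i; reflexivity. Qed.

Lemma tri_self j s : tri j s j = (fst s * snd s * cexp (ej j s))%cc.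
Proof. unfold u_coord. destruct (letter_eq_dec j j); [reflexivity|congruence]. Qed.

Lemma tri_o1 j s : tri j s (o1 j) = fst s.
Proof. unfold u_coord. destruct j; reflexivity. Qed.

Lemma tri_o2 j s : tri j s (o2 j) = snd s.
Proof. unfold u_coord. destruct j; reflexivity. Qed.

Lemma cpl_pt3 j f : cpl j (f j) (f (o1 j)) (f (o2 j)) = pt3 f.
Proof. destruct j; reflexivity. Qed.

Lemma onS_pt3 i f : onS A B Cc D (pt3 f) <->
  (f i * f i + f (o1 i) * f (o1 i) + f (o2 i) * f (o2 i) + f i * (f (o1 i) * f (o2 i))
   = par i * f i + par (o1 i) * f (o1 i) + par (o2 i) * f (o2 i) + D)%cc.
Proof. rewrite <- (cpl_pt3 i). apply onS_cpl. Qed.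

Section Fixedr.
Variable r : R.
Hypothesis r_pos : 0 < r.
Hypothesis r_lt1 : r < 1.

(** The coordinate at [j] receives the form [jouk u] of the other two, so that the two coordinates
    kept by an involution can be read as chart coordinates at the new vertex. *)
Lemma Paff_tri j : near_axes r (fun s => offax s -> affine_pt j s = pt3 (fun l => jouk (tri j s l))).
Proof.
  pose proof (jouk_inv_zeta (par j) (par (o1 j)) (par (o2 j)) D r r_pos r_lt1) as V1.
  pose proof (X_near1 (par j) (par (o1 j)) (par (o2 j)) D r r_pos r_lt1) as V2.
  eapply near_axes_mono; [|exact (near_axes_and _ _ _ V1 V2)]. cbn beta. intros s [h1 h2] [hp hq].
  rewrite <- (cpl_pt3 j). rewrite tri_self, tri_o1, tri_o2. unfold affine_pt. f_equal.
  apply near1_abs in h2. change (Xf (par j) (par (o1 j)) (par (o2 j)) D s) with (Xj j s) in h2.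
  assert (hX : Xj j s <> C0) by (apply Cabs_neq0; lra).
  change (ef (par j) (par (o1 j)) (par (o2 j)) D s) with (ej j s) in h1. rewrite <- h1.
  assert (hz : zetaf (par j) (par (o1 j)) (par (o2 j)) D s <> C0) by (apply Cdiv_neq0; auto; apply Cmul_neq0; auto).
  rewrite (proj2 (jouk_inv_jouk _ hz)). unfold zetaf. change (Xf (par j) (par (o1 j)) (par (o2 j)) D s) with (Xj j s).
  f_equal. field. repeat split; auto.
Qed.

(* The other root [X'] of the quadratic equation is [q^2(1 + p^2) + O(pq)], which stays away from [X]. *)
Lemma branch_pos j (a : CC) : near_axes r (fun s => forall p q, (p = fst s /\ q = snd s \/ p = snd s /\ q = fst s) ->
  let m := (p * q * cexp (ej j s))%cc in p <> C0 ->
  0 < fst ((1 + m * m) * (1 + q * q) - a * (m * q) + 2 * (m * q) * jouk p)%cc).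
Proof.
  (* Exceeds the sum [18 + 2 * Cabs a] of the coefficients of [eta] in the bounds [b2] to [b5], so
     that these add up to less than [1 - r * r]. *)
  set (k := 40 + 2 * Cabs a). pose proof (Cabs_ge0 a) as ha.
  set (eta := Rmin (1/2) ((1 - r * r) / k)).
  assert (heta : 0 < eta) by (apply Rmin_pos; [lra|apply Rdiv_lt_0_compat; [nra|unfold k; lra]]).
  assert (e1 : eta <= 1/2) by apply Rmin_l.
  assert (e2 : k * eta <= 1 - r * r).
  { apply Rle_trans with (k * ((1 - r * r) / k)); [apply Rmult_le_compat_l; [unfold k; lra|apply Rmin_r]|].
    apply Req_le; field. unfold k; lra. }
  destruct (log_lip_small r r_pos r_lt1 _ eta (log_lip_log_factor A B Cc D r r_pos r_lt1 j) heta) as (e & he & V).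
  exists (Rmin e eta). rmin e eta. split; [apply Rmin_pos; auto|].
  intros s hs p q hpq m hp.
  assert (hE : Cabs (ej j s) < eta) by (apply V; eapply axes_nbhd_mono; try eassumption; lra).
  set (E := cexp (ej j s)) in *.
  assert (hE2 : Cabs E <= 2) by (apply cexp_le2; lra).
  assert (hE1 : Cabs (E - 1) <= 6 * eta).
  { pose proof (cexp_m1_bound (ej j s)) as g. fold E in g. pose proof (Cabs_ge0 (ej j s)). nra. }
  assert (hx : Cabs p < r /\ Cabs q < r /\ Cabs p * Cabs q < eta).
  { destruct hs as (g1 & g2 & g3). unfold axprod in g3. destruct hpq as [[-> ->]|[-> ->]]; repeat split; auto; try lra. }
  destruct hx as (x1 & x2 & x3).
  assert (hm : Cabs m <= 2 * eta).
  { unfold m. rewrite !Cabs_mul. pose proof (Cabs_ge0 p). pose proof (Cabs_ge0 q). pose proof (Cabs_ge0 E). nra. }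
  clearbody E. clear V.
  (* Only the first term of [R0] is not small; it is at most [r * r], and each of the others
     contains [m], [E - 1] or [pq]. *)
  set (R0 := (q * q + (- (m * m) * (1 + q * q)) + a * (m * q) + 2 * (q * q) * (E - 1) + 2 * E * (p * q * (p * q)))%cc).
  replace ((1 + m * m) * (1 + q * q) - a * (m * q) + 2 * (m * q) * jouk p)%cc with (1 - R0)%cc.
  2:{ unfold R0, jouk, m. cfield. }
  enough (Cabs R0 < 1).
  { pose proof (fst_close (1 - R0)) as g. replace (1 - R0 - 1)%cc with (- R0)%cc in g by ring. rewrite Cabs_opp in g. lra. }
  pose proof (Cabs_ge0 p). pose proof (Cabs_ge0 q). pose proof (Cabs_ge0 m). pose proof (Cabs_ge0 E). pose proof (Cabs_ge0 (E - 1)%cc).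
  assert (b1 : Cabs (q * q) <= r * r) by (rewrite Cabs_mul; nra).
  assert (b2 : Cabs (- (m * m) * (1 + q * q)) <= 4 * eta).
  { rewrite Cabs_mul, Cabs_opp, Cabs_mul. pose proof (Cabs_tri 1 (q * q)) as t. rewrite Cabs_C1 in t.
    apply Rle_trans with ((2 * eta) * (2 * eta) * 2).
    - apply Rmult_le_compat; try apply Cabs_ge0; try (apply Rmult_le_pos; apply Cabs_ge0); [|nra]. apply Rmult_le_compat; auto.
    - nra. }
  assert (b3 : Cabs (a * (m * q)) <= 2 * Cabs a * eta).
  { rewrite !Cabs_mul. apply Rle_trans with (Cabs a * (2 * eta * 1)); [|lra].
    apply Rmult_le_compat_l; auto. apply Rmult_le_compat; auto. lra. }
  assert (b4 : Cabs (2 * (q * q) * (E - 1)) <= 12 * eta).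
  { rewrite !(Cabs_mul (2 * (q * q))), (Cabs_mul 2), Cabs_2.
    apply Rle_trans with (2 * 1 * (6 * eta)); [|lra]. apply Rmult_le_compat; auto.
    - pose proof (Cabs_ge0 (q * q)%cc). lra.
    - nra. }
  assert (b5 : Cabs (2 * E * (p * q * (p * q))) <= 2 * eta).
  { rewrite (Cabs_mul (2 * E)), (Cabs_mul 2), Cabs_2, !Cabs_mul.
    apply Rle_trans with (2 * 2 * (eta * eta)); [|nra].
    apply Rmult_le_compat; try lra; [repeat apply Rmult_le_pos; lra|]. apply Rmult_le_compat; try lra; apply Rmult_le_pos; lra. }
  unfold R0.
  pose proof (Cabs_tri (q * q + (- (m * m) * (1 + q * q)) + a * (m * q) + 2 * (q * q) * (E - 1)) (2 * E * (p * q * (p * q)))) as t1.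
  pose proof (Cabs_tri (q * q + (- (m * m) * (1 + q * q)) + a * (m * q)) (2 * (q * q) * (E - 1))) as t2.
  pose proof (Cabs_tri (q * q + (- (m * m) * (1 + q * q))) (a * (m * q))) as t3.
  pose proof (Cabs_tri (q * q) (- (m * m) * (1 + q * q))) as t4.
  unfold k in e2. nra.
Qed.

(* The third coordinate [x_i] before the involution is the small root of the quadratic equation in the
   new chart, hence the new one is the large root. *)
Lemma step_Paff i j : i <> j -> near_axes r (fun s => offax s ->
  s_of A B Cc i (affine_pt j s) = affine_pt i (tri j s (o1 i), tri j s (o2 i)) /\ offax (tri j s (o1 i), tri j s (o2 i))).
Proof.
  intro hij. eapply near_axes_mono; [|exact (near_axes_and _ _ _ (Paff_tri j) (branch_pos j (par i)))]. cbn beta.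
  intros s [h1 h2] ho. specialize (h1 ho). assert (ho' := ho). destruct ho' as [hp hq].
  pose proof (Paff_onS j s ho) as hS. rewrite h1 in *. set (f := fun l => jouk (tri j s l)) in *.
  assert (hm : tri j s j <> C0) by (rewrite tri_self; apply Cmul_neq0; [apply Cmul_neq0; auto|apply cexp_neq0]).
  assert (hn : forall l, tri j s l <> C0).
  { intro l. destruct (letter_eq_dec l j) as [->|n]; auto. unfold u_coord in *.
    destruct (letter_eq_dec l j); [congruence|]. destruct (letter_eq_dec l (o1 j)); auto. }
  split; [|split; apply hn].
  rewrite s_of_pt3. unfold affine_pt. cbn [fst snd]. f_equal.
  apply (onS_pt3 i) in hS.
  set (T1 := tri j s (o1 i)) in *. set (T2 := tri j s (o2 i)) in *.
  assert (n1 : T1 <> C0) by apply hn. assert (nn2 : T2 <> C0) by apply hn.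
  assert (F1 : f (o1 i) = jouk T1) by reflexivity. assert (F2 : f (o2 i) = jouk T2) by reflexivity.
  rewrite F1, F2 in *. set (x := f i) in *.
  assert (key : (- (T1 * T2 * (par i - jouk T1 * jouk T2 - x)))%cc = Xj i (T1, T2)).
  { apply Xf_unique.
    - unfold Sumf, Prodf; cbn [fst snd].
      transitivity (T1 * T1 * (T2 * T2) * ((x * x + jouk T1 * jouk T1 + jouk T2 * jouk T2 + x * (jouk T1 * jouk T2)) -
        (par i * x + par (o1 i) * jouk T1 + par (o2 i) * jouk T2 + D)))%cc.
      + unfold jouk. clear - n1 nn2. field. auto.
      + rewrite hS. ring.
    - unfold Sumf; cbn [fst snd].
      assert (e : (2 * - (T1 * T2 * (par i - jouk T1 * jouk T2 - x)) - ((1 + T1 * T1) * (1 + T2 * T2) - par i * (T1 * T2)) =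
         (1 + T1 * T1) * (1 + T2 * T2) - par i * (T1 * T2) + 2 * (T1 * T2) * x)%cc) by (unfold jouk; clear - n1 nn2; field; auto).
      rewrite e.
      (* The old value [x] of the coordinate that changes is [jouk p]. The new chart keeps [q] and
         the old third parameter [pq exp e], in an order that depends on the letters. *)
      assert (cs : exists p q, (p = fst s /\ q = snd s \/ p = snd s /\ q = fst s) /\ p <> C0 /\ x = jouk p /\
         (T1 = (p * q * cexp (ej j s))%cc /\ T2 = q \/ T1 = q /\ T2 = (p * q * cexp (ej j s))%cc)).
      { unfold x, f, T1, T2, u_coord. destruct i, j; try congruence; simpl;
          first [ exists (fst s), (snd s); repeat split; auto; (left; split; reflexivity) || (right; split; reflexivity)
                | exists (snd s), (fst s); repeat split; auto;
                  (left; split; [ring|reflexivity]) || (right; split; [reflexivity|ring]) ]. }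
      destruct cs as (p & q & hpq & np & -> & hT). specialize (h2 p q hpq np). cbv zeta in h2.
      destruct hT as [[-> ->]|[-> ->]].
      + exact h2.
      + replace ((1 + q * q) * (1 + p * q * cexp (ej j s) * (p * q * cexp (ej j s))) - par i * (q * (p * q * cexp (ej j s))) + 2 * (q * (p * q * cexp (ej j s))) * jouk p)%cc
        with ((1 + p * q * cexp (ej j s) * (p * q * cexp (ej j s))) * (1 + q * q) - par i * (p * q * cexp (ej j s) * q) + 2 * (p * q * cexp (ej j s) * q) * jouk p)%cc by ring.
        exact h2. }
  rewrite <- key. field. auto.
Qed.

Lemma word_Paff c w : reduced_from c w -> near_axes r (fun s => offax s ->
  eval_word A B Cc w (affine_pt c s) = affine_pt (chart_of c w) (Fw A B Cc D c w s) /\ offax (Fw A B Cc D c w s)).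
Proof.
  induction w as [|i w IH]; intro h.
  - exists 1; split; [lra|]. intros s _ ho. rewrite Fw_nil. split; auto.
  - assert (h' := h). destruct h' as [h1 h2]. specialize (IH h2). destruct (step_Paff i (chart_of c w) h1) as (e & he & H).
    pose proof (log_monomial_axes_nbhd r r_pos r_lt1 _ _ e (log_monomial_word A B Cc D r r_pos r_lt1 c w h2) he) as V.
    eapply near_axes_mono; [|exact (near_axes_and _ _ _ IH V)]. cbn beta. intros s [i1 i2] ho. destruct (i1 ho) as [j1 j2].
    destruct (H _ i2 j2) as [k1 k2].
    rewrite (Fw_cons A B Cc D c i w s h). split; auto. cbn [chart_of].
    change (eval_word A B Cc (i :: w) (affine_pt c s)) with (s_of A B Cc i (eval_word A B Cc w (affine_pt c s))).
    rewrite j1. exact k1.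
Qed.

End Fixedr.
End Surface.

(** * Holomorphic inverse of the parametrization near a vertex *)

Lemma Dif3_x p : Dif3 (fun x => fst (fst x)) p.
Proof.
  apply (Dif_lin VC3 (fun x => fst (fst x))).
  - exists C1, C0, C0; intro; ring.
  - intros [[? ?] ?] [[? ?] ?]; reflexivity.
Qed.

Lemma Dif3_y p : Dif3 (fun x => snd (fst x)) p.
Proof.
  apply (Dif_lin VC3 (fun x => snd (fst x))).
  - exists C0, C1, C0; intro; ring.
  - intros [[? ?] ?] [[? ?] ?]; reflexivity.
Qed.

Lemma Dif3_z p : Dif3 (fun x => snd x) p.
Proof.
  apply (Dif_lin VC3 (fun x => snd x)).
  - exists C0, C0, C1; intro; ring.
  - intros [[? ?] ?] [[? ?] ?]; reflexivity.
Qed.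

Lemma near_neq0 (V : nspace) (f : V -> CC) (p : V) : Dif V f p -> f p <> C0 -> near V p (fun x => f x <> C0).
Proof.
  intros h hn. eapply near_mono; [|exact (Dif_cont V f p _ h (Cabs_pos _ hn))]. cbn beta. intros x hx e.
  rewrite e in hx. replace (0 - f p)%cc with (- f p)%cc in hx by ring. rewrite Cabs_opp in hx. lra.
Qed.

Lemma near_fst_pos (V : nspace) (f : V -> CC) (p : V) : Dif V f p -> 0 < fst (f p) -> near V p (fun x => 0 < fst (f x)).
Proof.
  intros h hn. eapply near_mono; [|exact (Dif_cont V f p _ h hn)]. cbn beta. intros x hx.
  pose proof (Cabs_fst (f x - f p)%cc) as g. apply Rabs_le_inv in g. unfold Csub, Cadd, Copp in *; cbn [fst] in *. lra.
Qed.

Section Kappa.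
Variables A B Cc D : CC.

Notation par := (param_at A B Cc).
Notation Xj := (X_at A B Cc D).
Notation Pi4 := (proj_pt A B Cc D).
Notation eqn4 := (hom_eqn A B Cc D).

Definition Qf (j : letter) (x : C3) : CC :=
  (1 + fst (fst x) * fst (fst x) + snd (fst x) * snd (fst x)
   - snd x * (par j + par (o1 j) * fst (fst x) + par (o2 j) * snd (fst x)) - D * (snd x * snd x))%cc.
(* In the affine chart [(Y, Z, W)] at the vertex [j] the surface is [W Qf = - Y Z], and
   [Z / Qf = u / (1 + u^2)], [Y / Qf = v / (1 + v^2)] at the point of coordinates [(u, v)]. *)
Definition chart_inv (j : letter) (x : C3) : C2 :=
  (jouk_inv (snd (fst x) / Qf j x)%cc, jouk_inv (fst (fst x) / Qf j x)%cc).
Definition cub (j : letter) (x : C3) : Prop := eqn4 j C1 (fst (fst x)) (snd (fst x)) (snd x).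
Definition Deltaj (j : letter) : C2 -> CC := Deltaf (par j) (par (o1 j)) (par (o2 j)) D.

Lemma chart_cpl4 j x y z t : chart (lidx j) (cpl4 j x y z t) = (y / x, z / x, t / x)%cc.
Proof. destruct j; reflexivity. Qed.

Lemma C4_cpl4 j (q : C4) : q = cpl4 j (coord (lidx j) q) (coord (lidx (o1 j)) q) (coord (lidx (o2 j)) q) (coord 3 q).
Proof. destruct q as [[[? ?] ?] ?], j; reflexivity. Qed.

Lemma Qf_Pi4 j s : Xj j s <> C0 ->
  Qf j (chart (lidx j) (Pi4 j s)) = ((1 + fst s * fst s) * (1 + snd s * snd s) / Xj j s)%cc.
Proof.
  intro hX. unfold proj_pt. rewrite chart_cpl4. unfold Qf; cbn [fst snd].
  destruct s as [p q]. cbn [fst snd].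
  pose proof (quadj A B Cc D j (p, q)) as h. change (Xf _ _ _ _ (p, q)) with (Xj j (p, q)) in h.
  set (X := Xj j (p, q)) in *. unfold Sumf, Prodf in h; cbn [fst snd] in h.
  set (a := par j) in *. set (b := par (o1 j)) in *. set (c := par (o2 j)) in *. clearbody X a b c.
  apply Csub_eq0. match type of h with ?g = _ => transitivity (g / (X * X))%cc end.
  - cfield.
  - rewrite h. unfold Cdiv. ring.
Qed.

Lemma kap_Pi4 j s : Cabs (fst s) < 1 -> Cabs (snd s) < 1 -> Xj j s <> C0 ->
  Qf j (chart (lidx j) (Pi4 j s)) <> C0 /\
  (snd (fst (chart (lidx j) (Pi4 j s))) / Qf j (chart (lidx j) (Pi4 j s)) = fst s / (1 + fst s * fst s))%cc /\
  (fst (fst (chart (lidx j) (Pi4 j s))) / Qf j (chart (lidx j) (Pi4 j s)) = snd s / (1 + snd s * snd s))%cc /\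
  chart_inv j (chart (lidx j) (Pi4 j s)) = s.
Proof.
  intros hp hq hX. pose proof (one_add_sq_neq0 _ hp) as np. pose proof (one_add_sq_neq0 _ hq) as nq.
  pose proof (Qf_Pi4 j s hX) as eQ.
  assert (e1 : (snd (fst (chart (lidx j) (Pi4 j s))) / Qf j (chart (lidx j) (Pi4 j s)) = fst s / (1 + fst s * fst s))%cc).
  { rewrite eQ. unfold proj_pt. rewrite chart_cpl4. cbn [fst snd]. field. auto. }
  assert (e2 : (fst (fst (chart (lidx j) (Pi4 j s))) / Qf j (chart (lidx j) (Pi4 j s)) = snd s / (1 + snd s * snd s))%cc).
  { rewrite eQ. unfold proj_pt. rewrite chart_cpl4. cbn [fst snd]. field. auto. }
  split; [rewrite eQ; apply Cdiv_neq0; auto; apply Cmul_neq0; auto|]. split; auto. split; auto.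
  unfold chart_inv. rewrite e1, e2, !jouk_inv_left by auto. destruct s; reflexivity.
Qed.

(** By [Qf_Pi4], the value of [X] read off from the ambient point. It also makes sense off the
    surface, so the choice of the root becomes an open condition. *)
Definition Xhat (j : letter) (x : C3) : CC :=
  ((1 + fst (chart_inv j x) * fst (chart_inv j x)) * (1 + snd (chart_inv j x) * snd (chart_inv j x)) / Qf j x)%cc.

(** [chart_inv] recovers [u] and [v] from two ratios that do not see which root [X] is; it inverts
    the chart where [Xhat] lies on the branch of [Xf], which is the third hypothesis. *)
Lemma kap_cub j x : cub j x -> Qf j x <> C0 -> 0 < fst (2 * Xhat j x - Sumf (par j) (chart_inv j x))%cc ->
  Xj j (chart_inv j x) <> C0 /\ chart (lidx j) (Pi4 j (chart_inv j x)) = x.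
Proof.
  intros hc hQ hp.
  pose proof (one_add_jouk_inv_sq_neq0 (snd (fst x) / Qf j x)%cc) as n1. pose proof (one_add_jouk_inv_sq_neq0 (fst (fst x) / Qf j x)%cc) as n2.
  pose proof (jouk_inv_right (snd (fst x) / Qf j x)%cc) as r1. pose proof (jouk_inv_right (fst (fst x) / Qf j x)%cc) as r2.
  assert (eW : (snd x * Qf j x = - (fst (fst x) * snd (fst x)))%cc).
  { unfold cub, hom_eqn in hc. apply Csub_eq0. unfold Qf.
    match type of hc with ?l = ?rr => transitivity (l - rr)%cc; [ring|rewrite hc; ring] end. }
  assert (eX : Xhat j x = Xj j (chart_inv j x) /\ Xhat j x <> C0 /\
     (snd (chart_inv j x) * (1 + fst (chart_inv j x) * fst (chart_inv j x)) / Xhat j x = fst (fst x))%cc /\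
     (fst (chart_inv j x) * (1 + snd (chart_inv j x) * snd (chart_inv j x)) / Xhat j x = snd (fst x))%cc /\
     (- (fst (chart_inv j x) * snd (chart_inv j x)) / Xhat j x = snd x)%cc).
  { assert (nX : Xhat j x <> C0) by (apply Cdiv_neq0; auto; apply Cmul_neq0; auto).
    revert hp nX. unfold Xhat, chart_inv; cbn [fst snd].
    set (u := jouk_inv (snd (fst x) / Qf j x)%cc) in *. set (v := jouk_inv (fst (fst x) / Qf j x)%cc) in *.
    assert (eQ : Qf j x = (1 + fst (fst x) * fst (fst x) + snd (fst x) * snd (fst x)
       - snd x * (par j + par (o1 j) * fst (fst x) + par (o2 j) * snd (fst x)) - D * (snd x * snd x))%cc) by reflexivity.
    set (Q := Qf j x) in *. destruct x as [[Y Z] Wc]; cbn [fst snd] in *. clearbody Q u v.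
    assert (eZ : Z = (Q * (u / (1 + u * u)))%cc) by (rewrite r1; field; auto).
    assert (eY : Y = (Q * (v / (1 + v * v)))%cc) by (rewrite r2; field; auto).
    assert (eW' : Wc = (- (Q * (u / (1 + u * u)) * (v / (1 + v * v))))%cc).
    { replace Wc with (Wc * Q / Q)%cc by (field; auto). rewrite eW, eY, eZ. field. auto. }
    intros hp nX. split; [|split; [exact nX|]].
    - apply Xf_unique; [|exact hp].
      transitivity ((1 + u * u) * (1 + u * u) * ((1 + v * v) * (1 + v * v)) / (Q * Q) *
         ((1 + Y * Y + Z * Z - Wc * (par j + par (o1 j) * Y + par (o2 j) * Z) - D * (Wc * Wc)) - Q))%cc.
      + rewrite eW', eY, eZ. unfold Sumf, Prodf; cbn [fst snd]. set (a := par j). set (b := par (o1 j)). set (c := par (o2 j)).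
        clear - hQ n1 n2. field. auto.
      + rewrite <- eQ. unfold Cdiv. ring.
    - split; [|split].
      + rewrite eY. field. auto.
      + rewrite eZ. field. auto.
      + rewrite eW'. field. auto. }
  destruct eX as (e1 & nX & e2 & e3 & e4). rewrite e1 in *. split; auto.
  unfold proj_pt. rewrite chart_cpl4, e2, e3, e4. destruct x as [[? ?] ?]; reflexivity.
Qed.

Lemma Dif3_Qf j x : Dif3 (Qf j) x.
Proof.
  unfold Qf.
  repeat first [apply (Dif_const VC3) | exact (Dif3_x x) | exact (Dif3_y x) | exact (Dif3_z x)
    | apply (Dif_sub VC3) | apply (Dif_add VC3) | apply (Dif_mul VC3)].
Qed.

(** The hypotheses of [kap_cub] other than the equation are open conditions, and hold at the image
    of [s], where the branch condition reduces to [two_X_sub_sum]. *)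
Lemma kap_near j s : Cabs (fst s) < 1 -> Cabs (snd s) < 1 -> Xj j s <> C0 -> 0 < fst (Deltaj j s) ->
  near3 (chart (lidx j) (Pi4 j s)) (fun x =>
    Dif3 (fun y => fst (chart_inv j y)) x /\ Dif3 (fun y => snd (chart_inv j y)) x /\
    (cub j x -> Xj j (chart_inv j x) <> C0 /\ chart (lidx j) (Pi4 j (chart_inv j x)) = x)).
Proof.
  intros hp hq hX hD. destruct (kap_Pi4 j s hp hq hX) as (nQ & eu & near_axes' & ek).
  set (x0 := chart (lidx j) (Pi4 j s)) in *.
  assert (DQ : forall x, Dif3 (Qf j) x) by (intro; apply Dif3_Qf).
  assert (D1 : forall x, Qf j x <> C0 -> Dif3 (fun y => snd (fst y) / Qf j y)%cc x).
  { intros x hx. apply (Dif_div VC3); [exact hx|exact (Dif3_y x)|exact (DQ x)]. }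
  assert (D2 : forall x, Qf j x <> C0 -> Dif3 (fun y => fst (fst y) / Qf j y)%cc x).
  { intros x hx. apply (Dif_div VC3); [exact hx|exact (Dif3_x x)|exact (DQ x)]. }
  assert (Ds : forall (g : C3 -> CC) x, Dif3 g x -> 0 < fst (csqrt (1 - 4 * (g x * g x))%cc) ->
     Dif3 (fun y => csqrt (1 - 4 * (g y * g y)))%cc x).
  { intros g x dg hg. apply (Dif_sqrt VC3 (fun y => 1 - 4 * (g y * g y))%cc); auto.
    apply (Dif_sub VC3 (fun _ => C1)); [apply (Dif_const VC3)|].
    apply (Dif_mul VC3 (fun _ => (4)%cc)); [apply (Dif_const VC3)|]. exact (Dif_mul VC3 g g x dg dg). }
  assert (P1 : 0 < fst (csqrt (1 - 4 * (snd (fst x0) / Qf j x0 * (snd (fst x0) / Qf j x0)))%cc)).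
  { rewrite eu, sqrt_of_joukowski by auto. apply fst_cayley_pos. rewrite Cabs_mul. pose proof (Cabs_ge0 (fst s)). nra. }
  assert (P2 : 0 < fst (csqrt (1 - 4 * (fst (fst x0) / Qf j x0 * (fst (fst x0) / Qf j x0)))%cc)).
  { rewrite near_axes', sqrt_of_joukowski by auto. apply fst_cayley_pos. rewrite Cabs_mul. pose proof (Cabs_ge0 (snd s)). nra. }
  assert (N0 : near3 x0 (fun x => Qf j x <> C0)) by exact (near_neq0 VC3 _ _ (DQ x0) nQ).
  assert (N1 : near3 x0 (fun x => 0 < fst (csqrt (1 - 4 * (snd (fst x) / Qf j x * (snd (fst x) / Qf j x)))%cc))).
  { apply (near_fst_pos VC3 (fun x => csqrt (1 - 4 * (snd (fst x) / Qf j x * (snd (fst x) / Qf j x))))%cc); auto.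
    exact (Ds (fun x => snd (fst x) / Qf j x)%cc x0 (D1 x0 nQ) P1). }
  assert (N2 : near3 x0 (fun x => 0 < fst (csqrt (1 - 4 * (fst (fst x) / Qf j x * (fst (fst x) / Qf j x)))%cc))).
  { apply (near_fst_pos VC3 (fun x => csqrt (1 - 4 * (fst (fst x) / Qf j x * (fst (fst x) / Qf j x))))%cc); auto.
    exact (Ds (fun x => fst (fst x) / Qf j x)%cc x0 (D2 x0 nQ) P2). }
  assert (Dk1 : forall x, Qf j x <> C0 -> 0 < fst (csqrt (1 - 4 * (snd (fst x) / Qf j x * (snd (fst x) / Qf j x)))%cc) ->
     Dif3 (fun y => fst (chart_inv j y)) x).
  { intros x h1 h2. exact (Dif_comp1 VC3 jouk_inv _ x (Dif1_jouk_inv _ h2) (D1 x h1)). }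
  assert (Dk2 : forall x, Qf j x <> C0 -> 0 < fst (csqrt (1 - 4 * (fst (fst x) / Qf j x * (fst (fst x) / Qf j x)))%cc) ->
     Dif3 (fun y => snd (chart_inv j y)) x).
  { intros x h1 h2. exact (Dif_comp1 VC3 jouk_inv _ x (Dif1_jouk_inv _ h2) (D2 x h1)). }
  assert (N3 : near3 x0 (fun x => 0 < fst (2 * Xhat j x - Sumf (par j) (chart_inv j x))%cc)).
  { pose proof (Dk1 x0 nQ P1) as k1. pose proof (Dk2 x0 nQ P2) as k2.
    apply (near_fst_pos VC3 (fun x => 2 * Xhat j x - Sumf (par j) (chart_inv j x))%cc).
    - unfold Xhat, Sumf. 
      repeat lazymatch goal with
        | |- Dif _ (fun y => fst (chart_inv j y)) _ => exact k1
        | |- Dif _ (fun y => snd (chart_inv j y)) _ => exact k2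
        | |- Dif _ (fun y => Csub _ _) _ => apply (Dif_sub VC3)
        | |- Dif _ (fun y => Cadd _ _) _ => apply (Dif_add VC3)
        | |- Dif _ (fun y => Cmul _ _) _ => apply (Dif_mul VC3)
        | |- Dif _ (fun y => Cdiv _ _) _ => apply (Dif_div VC3); [exact nQ| |exact (DQ x0)]
        | |- _ => apply (Dif_const VC3)
        end.
    - assert (eX : Xhat j x0 = Xj j s).
      { unfold Xhat. rewrite ek. unfold x0. rewrite Qf_Pi4 by auto.
        pose proof (one_add_sq_neq0 _ hp). pose proof (one_add_sq_neq0 _ hq). field. auto. }
      rewrite eX, ek. unfold X_at. rewrite two_X_sub_sum. exact hD. }
  pose proof (near_and VC3 _ _ _ (near_and VC3 _ _ _ N0 N1) (near_and VC3 _ _ _ N2 N3)) as NN.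
  eapply near_mono; [|exact NN]. cbn beta. intros x [[a0 a1] [a2 a3]].
  split; auto. split; auto. intro hc. apply kap_cub; auto.
Qed.

Lemma cub_chart j (q : C4) : onbarS A B Cc D q -> coord (lidx j) q <> C0 -> cub j (chart (lidx j) q).
Proof.
  intros hS hn. rewrite (C4_cpl4 j q) in *. set (x := coord (lidx j) q) in *. set (y := coord (lidx (o1 j)) q) in *.
  set (z := coord (lidx (o2 j)) q) in *. set (t := coord 3 q) in *. rewrite coordj_cpl4 in hn.
  rewrite chart_cpl4. apply onbarS_cpl4 in hS. destruct hS as [_ hS]. unfold cub; cbn [fst snd].
  unfold hom_eqn in *. apply Csub_eq0. clearbody x y z t. set (a := par j) in *. set (b := par (o1 j)) in *. set (c := par (o2 j)) in *.
  match type of hS with ?l = ?rr => transitivity ((l - rr) / (x * x * x))%cc end.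
  - clear - hn. field. auto.
  - rewrite hS. unfold Cdiv. ring.
Qed.

Lemma cpl4_peq j x y z t x' y' z' t' : x <> C0 -> x' <> C0 ->
  (y / x = y' / x')%cc -> (z / x = z' / x')%cc -> (t / x = t' / x')%cc -> peq (cpl4 j x y z t) (cpl4 j x' y' z' t').
Proof.
  intros hx hx' e1 e2 e3. split; [apply cpl4_neq0; auto|]. exists (x' / x)%cc. split; [apply Cdiv_neq0; auto|].
  assert (f1 : y' = (x' / x * y)%cc) by (transitivity (x' * (y' / x'))%cc; [field; auto|rewrite <- e1; field; auto]).
  assert (f2 : z' = (x' / x * z)%cc) by (transitivity (x' * (z' / x'))%cc; [field; auto|rewrite <- e2; field; auto]).
  assert (f3 : t' = (x' / x * t)%cc) by (transitivity (x' * (t' / x'))%cc; [field; auto|rewrite <- e3; field; auto]).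
  assert (f0 : x' = (x' / x * x)%cc) by (field; auto).
  intros i hi. destruct j; destruct i as [|[|[|[|i]]]]; simpl coord; try lia; assumption.
Qed.

Lemma peq_of_chart j (q q' : C4) : coord (lidx j) q <> C0 -> coord (lidx j) q' <> C0 ->
  chart (lidx j) q = chart (lidx j) q' -> peq q q'.
Proof.
  intros h h' e. rewrite (C4_cpl4 j q), (C4_cpl4 j q'). rewrite (C4_cpl4 j q), (C4_cpl4 j q'), !chart_cpl4 in e.
  apply cpl4_peq; auto.
  - exact (f_equal (fun x => fst (fst x)) e).
  - exact (f_equal (fun x => snd (fst x)) e).
  - exact (f_equal snd e).
Qed.

End Kappa.

(** * The projective distance *)

Definition crs (i k : nat) (p q : C4) : CC := (coord i p * coord k q - coord k p * coord i q)%cc.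

(** Lagrange's identity: the defect in the Cauchy-Schwarz inequality is the sum of the squared
    minors. It translates [pdist] into differences of ratios of coordinates. *)
Lemma lagrange p q : pn2 p * pn2 q - Cnorm2 (herm p q) =
  Cnorm2 (crs 0 1 p q) + Cnorm2 (crs 0 2 p q) + Cnorm2 (crs 0 3 p q) +
  Cnorm2 (crs 1 2 p q) + Cnorm2 (crs 1 3 p q) + Cnorm2 (crs 2 3 p q).
Proof.
  destruct p as [[[[x1 x2] [y1 y2]] [z1 z2]] [w1 w2]], q as [[[[x1' x2'] [y1' y2']] [z1' z2']] [w1' w2']].
  unfold crs, coord, pn2, herm, Cnorm2, Csub, Cadd, Copp, Cmul, Cconj; cbn [fst snd]. ring.
Qed.

Lemma crs_diag i p q : crs i i p q = C0.
Proof. unfold crs; ring. Qed.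

Lemma Cnorm2_crs_sym i k p q : Cnorm2 (crs i k p q) = Cnorm2 (crs k i p q).
Proof. unfold crs, Cnorm2, Csub, Cadd, Copp; cbn [fst snd]. ring. Qed.

Lemma pn2_coord p : pn2 p = Cnorm2 (coord 0 p) + Cnorm2 (coord 1 p) + Cnorm2 (coord 2 p) + Cnorm2 (coord 3 p).
Proof. destruct p as [[[x y] z] w]. reflexivity. Qed.

Lemma C4_eq0 p : (forall i, (i < 4)%nat -> coord i p = C0) -> p = zero4.
Proof.
  destruct p as [[[x y] z] w]. intro H. pose proof (H 0%nat ltac:(lia)). pose proof (H 1%nat ltac:(lia)).
  pose proof (H 2%nat ltac:(lia)). pose proof (H 3%nat ltac:(lia)). simpl in *. subst. reflexivity.
Qed.

Lemma C4_neq0_coord p : p <> zero4 -> exists i, (i < 4)%nat /\ coord i p <> C0.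
Proof.
  intro h. apply NNPP. intro H. apply h, C4_eq0. intros i hi.
  apply NNPP. intro hn. apply H. exists i; auto.
Qed.

Lemma coord_neq0 i p : coord i p <> C0 -> p <> zero4.
Proof. intros h e. apply h. rewrite e. destruct i as [|[|[|i]]]; reflexivity. Qed.

Lemma coord_pn2 i p : (i < 4)%nat -> Cnorm2 (coord i p) <= pn2 p.
Proof.
  intro hi. rewrite pn2_coord.
  pose proof (Cnorm2_ge0 (coord 0 p)). pose proof (Cnorm2_ge0 (coord 1 p)).
  pose proof (Cnorm2_ge0 (coord 2 p)). pose proof (Cnorm2_ge0 (coord 3 p)).
  destruct i as [|[|[|[|i]]]]; try lia; lra.
Qed.

Lemma pn2_pos p : p <> zero4 -> 0 < pn2 p.
Proof.
  intro h. destruct (C4_neq0_coord p h) as [i [hi hn]]. pose proof (coord_pn2 i p hi). pose proof (Cnorm2_pos _ hn). lra.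
Qed.

Lemma pdist_lagrange p q : p <> zero4 -> q <> zero4 -> pdist p q * (pn2 p * pn2 q) = pn2 p * pn2 q - Cnorm2 (herm p q).
Proof.
  intros hp hq. pose proof (pn2_pos p hp). pose proof (pn2_pos q hq). unfold pdist. field. lra.
Qed.

Lemma crs_le i k p q : (i < 4)%nat -> (k < 4)%nat -> p <> zero4 -> q <> zero4 ->
  Cnorm2 (crs i k p q) <= pdist p q * (pn2 p * pn2 q).
Proof.
  intros hi hk hp hq. rewrite pdist_lagrange, lagrange by auto.
  pose proof (Cnorm2_ge0 (crs 0 1 p q)). pose proof (Cnorm2_ge0 (crs 0 2 p q)). pose proof (Cnorm2_ge0 (crs 0 3 p q)).
  pose proof (Cnorm2_ge0 (crs 1 2 p q)). pose proof (Cnorm2_ge0 (crs 1 3 p q)). pose proof (Cnorm2_ge0 (crs 2 3 p q)).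
  assert (h0 : Cnorm2 C0 = 0) by (unfold Cnorm2, C0; simpl; ring).
  destruct i as [|[|[|[|i]]]]; try lia; destruct k as [|[|[|[|k]]]]; try lia;
    rewrite ?crs_diag, ?h0; try lra; rewrite Cnorm2_crs_sym; lra.
Qed.

Definition n4 (p : C4) : R := Cabs (coord 0 p) + Cabs (coord 1 p) + Cabs (coord 2 p) + Cabs (coord 3 p).

Lemma coord_n4 i p : (i < 4)%nat -> Cabs (coord i p) <= n4 p.
Proof.
  intro hi. unfold n4.
  pose proof (Cabs_ge0 (coord 0 p)). pose proof (Cabs_ge0 (coord 1 p)).
  pose proof (Cabs_ge0 (coord 2 p)). pose proof (Cabs_ge0 (coord 3 p)).
  destruct i as [|[|[|[|i]]]]; try lia; lra.
Qed.

Lemma pn2_n4 p : pn2 p <= n4 p * n4 p.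
Proof.
  rewrite pn2_coord, <- !Cabs_sq. unfold n4.
  pose proof (Cabs_ge0 (coord 0 p)). pose proof (Cabs_ge0 (coord 1 p)).
  pose proof (Cabs_ge0 (coord 2 p)). pose proof (Cabs_ge0 (coord 3 p)). nra.
Qed.

Lemma n4_ge0 p : 0 <= n4 p.
Proof. pose proof (Cabs_ge0 (coord 0 p)). pose proof (coord_n4 0 p ltac:(lia)). lra. Qed.

Lemma Cabs_le_of_Cnorm2 z x : 0 <= x -> Cnorm2 z <= x * x -> Cabs z <= x.
Proof. intros hx h. rewrite <- Cabs_sq in h. pose proof (Cabs_ge0 z). nra. Qed.

Lemma crs_Cabs_le i k p q del : (i < 4)%nat -> (k < 4)%nat -> p <> zero4 -> q <> zero4 -> 0 <= del ->
  pdist p q <= del * del -> Cabs (crs i k p q) <= del * n4 p * n4 q.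
Proof.
  intros hi hk hp hq hd h. pose proof (n4_ge0 p). pose proof (n4_ge0 q).
  apply Cabs_le_of_Cnorm2; [repeat apply Rmult_le_pos; auto|].
  eapply Rle_trans; [apply crs_le; auto|].
  pose proof (pn2_n4 p). pose proof (pn2_n4 q). pose proof (pn2_pos p hp). pose proof (pn2_pos q hq).
  apply Rle_trans with (del * del * ((n4 p * n4 p) * (n4 q * n4 q))).
  - apply Rle_trans with (del * del * (pn2 p * pn2 q)).
    + apply Rmult_le_compat_r; [apply Rmult_le_pos; lra|auto].
    + apply Rmult_le_compat_l; [nra|]. apply Rmult_le_compat; lra.
  - apply Req_le; ring.
Qed.

Lemma pdist_ratio i q eps : (i < 4)%nat -> coord i q <> C0 -> 0 < eps -> exists del, 0 < del /\
  forall q', q' <> zero4 -> pdist q q' < del -> coord i q' <> C0 /\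
    forall k, (k < 4)%nat -> Cabs (coord k q' / coord i q' - coord k q / coord i q) < eps.
Proof.
  intros hi hn he. pose proof (Cabs_pos _ hn) as h0. set (a := Cabs (coord i q)) in *. set (m := n4 q).
  assert (hm : a <= m) by (apply coord_n4; auto).
  (* The first bound keeps [coord i q'] comparable with [n4 q'], the second makes the ratios
     [eps]-close. The radius is [d * d] because [pdist] is quadratic in the minors. *)
  set (d := Rmin (a / (8 * m)) (eps * (a * a) / (4 * (m * m)))).
  assert (hd : 0 < d).
  { unfold d. apply Rmin_pos; apply Rdiv_lt_0_compat; try lra; [repeat apply Rmult_lt_0_compat; lra|nra]. }
  assert (d1 : 8 * m * d <= a).
  { apply Rle_trans with (8 * m * (a / (8 * m))); [apply Rmult_le_compat_l; [lra|apply Rmin_l]|]. apply Req_le; field; lra. }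
  assert (d2 : 4 * (m * m) * d <= eps * (a * a)).
  { apply Rle_trans with (4 * (m * m) * (eps * (a * a) / (4 * (m * m)))); [apply Rmult_le_compat_l; [nra|apply Rmin_r]|].
    apply Req_le; field; lra. }
  exists (d * d). split; [nra|]. intros q' hq' hpd.
  assert (hq : q <> zero4) by (apply (coord_neq0 i); auto).
  assert (C : forall k, (k < 4)%nat -> Cabs (crs i k q q') <= d * m * n4 q').
  { intros k hk. apply crs_Cabs_le; auto; lra. }
  set (m' := n4 q') in *.
  assert (hm' : 0 < m').
  { destruct (C4_neq0_coord q' hq') as [k [hk hkn]]. pose proof (coord_n4 k q' hk). pose proof (Cabs_pos _ hkn). unfold m'. lra. }
  set (b := Cabs (coord i q')).
  assert (S : forall k, (k < 4)%nat -> a * Cabs (coord k q') <= Cabs (coord k q) * b + d * m * m').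
  { intros k hk. specialize (C k hk). unfold a, b. rewrite <- !Cabs_mul.
    pose proof (Cabs_tri_rev (coord i q * coord k q') (coord k q * coord i q')) as t. fold (crs i k q q') in t. lra. }
  assert (S4 : a * m' <= m * b + 4 * (d * m * m')).
  { pose proof (S 0%nat ltac:(lia)). pose proof (S 1%nat ltac:(lia)). pose proof (S 2%nat ltac:(lia)). pose proof (S 3%nat ltac:(lia)).
    unfold m', m, n4 in *. lra. }
  assert (S5 : a * m' <= 2 * m * b).
  { assert (8 * m * d * m' <= a * m') by (apply Rmult_le_compat_r; lra). lra. }
  assert (hb : 0 < b).
  { apply Rnot_le_lt. intro hb. assert (0 < a * m') by (apply Rmult_lt_0_compat; auto). nra. }
  assert (hn' : coord i q' <> C0) by (apply Cabs_neq0; auto).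
  split; auto. intros k hk.
  replace (coord k q' / coord i q' - coord k q / coord i q)%cc with (crs i k q q' / (coord i q * coord i q'))%cc by (unfold crs; field; auto).
  rewrite Cabs_div by (apply Cmul_neq0; auto). rewrite Cabs_mul. fold a b.
  apply (Rmult_lt_reg_r (a * b)); [apply Rmult_lt_0_compat; auto|].
  unfold Rdiv. rewrite Rmult_assoc, Rinv_l, Rmult_1_r by (apply Rgt_not_eq, Rmult_lt_0_compat; auto).
  eapply Rle_lt_trans; [apply C; auto|].
  apply (Rmult_lt_reg_l a); auto.
  apply Rle_lt_trans with (2 * (m * m) * d * b).
  - replace (a * (d * m * m')) with (d * m * (a * m')) by ring.
    replace (2 * (m * m) * d * b) with (d * m * (2 * m * b)) by ring. apply Rmult_le_compat_l; auto. apply Rmult_le_pos; lra.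
  - assert (2 * (m * m) * d < eps * (a * a)).
    { assert (0 < eps * (a * a)) by (apply Rmult_lt_0_compat; nra). lra. }
    replace (a * (eps * (a * b))) with (eps * (a * a) * b) by ring. apply Rmult_lt_compat_r; auto.
Qed.

Lemma pdist_chart i q eps : (i < 4)%nat -> coord i q <> C0 -> 0 < eps -> exists del, 0 < del /\
  forall q', q' <> zero4 -> pdist q q' < del -> coord i q' <> C0 /\ n3 (sub3 (chart i q') (chart i q)) < eps.
Proof.
  intros hi hn he. destruct (pdist_ratio i q (eps / 3) hi hn ltac:(lra)) as [d [hd H]].
  exists d. split; auto. intros q' h1 h2. destruct (H q' h1 h2) as [h3 h4]. split; auto.
  pose proof (h4 0%nat ltac:(lia)). pose proof (h4 1%nat ltac:(lia)). pose proof (h4 2%nat ltac:(lia)). pose proof (h4 3%nat ltac:(lia)).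
  destruct q as [[[x y] z] t], q' as [[[x' y'] z'] t'].
  destruct i as [|[|[|[|i]]]]; try lia; unfold chart, sub3, n3; simpl coord in *; lra.
Qed.

Lemma pdist_close q eps : q <> zero4 -> 0 < eps -> exists del, 0 < del /\
  forall q', (forall k, (k < 4)%nat -> Cabs (coord k q' - coord k q) < del) -> pdist q q' < eps.
Proof.
  intros hq he. destruct (C4_neq0_coord q hq) as [i [hi hn]]. pose proof (Cabs_pos _ hn) as h0.
  set (a := Cabs (coord i q)) in *. set (m := n4 q). assert (hm : a <= m) by (apply coord_n4; auto).
  (* Six minors, each of square at most [4 m^2 d], divided by the lower bound [a^4 / 4] for the
     product of the squared norms. *)
  set (c := 96 * (m * m) / (a * a * (a * a))).
  assert (hc : 0 < c) by (apply Rdiv_lt_0_compat; [nra|repeat apply Rmult_lt_0_compat; auto]).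
  set (d := Rmin 1 (Rmin (a / 2) (eps / (2 * c)))).
  assert (hd : 0 < d) by (repeat apply Rmin_pos; try lra; apply Rdiv_lt_0_compat; lra).
  assert (d1 : d <= 1) by apply Rmin_l.
  assert (d2 : d <= a / 2) by (unfold d; pose proof (Rmin_r 1 (Rmin (a/2) (eps/(2*c)))); pose proof (Rmin_l (a/2) (eps/(2*c))); lra).
  assert (d3 : c * d < eps).
  { apply Rle_lt_trans with (c * (eps / (2 * c))).
    - apply Rmult_le_compat_l; [lra|]. unfold d; pose proof (Rmin_r 1 (Rmin (a/2) (eps/(2*c)))); pose proof (Rmin_r (a/2) (eps/(2*c))); lra.
    - replace (c * (eps / (2 * c))) with (eps / 2) by (field; lra). lra. }
  exists d. split; auto. intros q' H.
  assert (hb : a / 2 <= Cabs (coord i q')).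
  { pose proof (Cabs_tri_rev (coord i q) (coord i q - coord i q')) as t.
    replace (coord i q - (coord i q - coord i q'))%cc with (coord i q') in t by ring.
    rewrite (Cabs_sub_sym (coord i q)) in t. specialize (H i hi). fold a in t. lra. }
  assert (hq' : q' <> zero4) by (apply (coord_neq0 i), Cabs_neq0; lra).
  assert (C : forall j k, (j < 4)%nat -> (k < 4)%nat -> Cnorm2 (crs j k q q') <= 4 * (m * m) * d).
  { intros j k hj hk. rewrite <- Cabs_sq.
    assert (Cabs (crs j k q q') <= 2 * m * d).
    { replace (crs j k q q') with (coord j q * (coord k q' - coord k q) - coord k q * (coord j q' - coord j q))%cc by (unfold crs; ring).
      eapply Rle_trans; [apply Cabs_sub_tri|]. rewrite !Cabs_mul.
      pose proof (coord_n4 j q hj). pose proof (coord_n4 k q hk). pose proof (H j hj). pose proof (H k hk).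
      fold m in H0, H1. pose proof (Cabs_ge0 (coord j q)). pose proof (Cabs_ge0 (coord k q)).
      pose proof (Cabs_ge0 (coord j q' - coord j q)%cc). pose proof (Cabs_ge0 (coord k q' - coord k q)%cc).
      assert (Cabs (coord j q) * Cabs (coord k q' - coord k q) <= m * d) by (apply Rmult_le_compat; lra).
      assert (Cabs (coord k q) * Cabs (coord j q' - coord j q) <= m * d) by (apply Rmult_le_compat; lra). lra. }
    pose proof (Cabs_ge0 (crs j k q q')).
    apply Rle_trans with ((2 * m * d) * (2 * m * d)); [apply Rmult_le_compat; auto|].
    replace (2 * m * d * (2 * m * d)) with (4 * (m * m) * d * d) by ring.
    assert (0 <= 4 * (m * m) * d) by nra. nra. }
  pose proof (pdist_lagrange q q' hq hq') as L. rewrite lagrange in L.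
  pose proof (C 0%nat 1%nat ltac:(lia) ltac:(lia)). pose proof (C 0%nat 2%nat ltac:(lia) ltac:(lia)).
  pose proof (C 0%nat 3%nat ltac:(lia) ltac:(lia)). pose proof (C 1%nat 2%nat ltac:(lia) ltac:(lia)).
  pose proof (C 1%nat 3%nat ltac:(lia) ltac:(lia)). pose proof (C 2%nat 3%nat ltac:(lia) ltac:(lia)).
  assert (P1 : a * a <= pn2 q) by (unfold a; rewrite Cabs_sq; apply coord_pn2; auto).
  assert (P2 : a * a / 4 <= pn2 q').
  { eapply Rle_trans; [|apply (coord_pn2 i); auto]. rewrite <- Cabs_sq. nra. }
  assert (P3 : a * a * (a * a / 4) <= pn2 q * pn2 q') by (apply Rmult_le_compat; nra).
  assert (hp0 : 0 < a * a * (a * a / 4)) by (apply Rmult_lt_0_compat; nra).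
  eapply Rle_lt_trans; [|exact d3].
  apply (Rmult_le_reg_r (pn2 q * pn2 q')); [lra|]. rewrite L.
  apply Rle_trans with (24 * (m * m) * d); [lra|].
  apply Rle_trans with (c * d * (a * a * (a * a / 4))).
  - apply Req_le. unfold c. field. lra.
  - apply Rmult_le_compat_l; [apply Rmult_le_pos; lra|auto].
Qed.

Definition scale4 (l : CC) (p : C4) : C4 := let '(x, y, z, w) := p in (l * x, l * y, l * z, l * w)%cc.

Lemma peq_scale p q : peq p q -> exists l, l <> C0 /\ q = scale4 l p.
Proof.
  intros [h [l [hl H]]]. exists l; split; auto. destruct p as [[[x y] z] w], q as [[[x' y'] z'] w'].
  pose proof (H 0%nat ltac:(lia)). pose proof (H 1%nat ltac:(lia)). pose proof (H 2%nat ltac:(lia)). pose proof (H 3%nat ltac:(lia)).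
  simpl in *. subst. reflexivity.
Qed.

Lemma peq_neq0 p q : peq p q -> q <> zero4.
Proof.
  intros [h [l [hl H]]]. destruct (C4_neq0_coord p h) as [i [hi hn]].
  apply (coord_neq0 i). rewrite H by auto. apply Cmul_neq0; auto.
Qed.

Lemma peq_refl p : p <> zero4 -> peq p p.
Proof. intro h. split; auto. exists C1. split; [apply C1_neq0|]. intros; ring. Qed.

Lemma peq_sym p q : peq p q -> peq q p.
Proof.
  intro h. pose proof (peq_neq0 _ _ h). destruct h as [h [l [hl H']]]. split; auto.
  exists (Cinv l). split; [apply Cinv_neq0; auto|]. intros i hi. rewrite H' by auto. field; auto.
Qed.

Lemma peq_trans p q t : peq p q -> peq q t -> peq p t.
Proof.
  intros [h [l [hl H]]] [h' [l' [hl' H']]]. split; auto. exists (l' * l)%cc. split; [apply Cmul_neq0; auto|].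
  intros i hi. rewrite H', H by auto. ring.
Qed.

Lemma Cnorm2_mul (z w : CC) : Cnorm2 (z * w)%cc = Cnorm2 z * Cnorm2 w.
Proof. unfold Cnorm2, Cmul; cbn [fst snd]. ring. Qed.

Lemma pdist_peq_l p p' q : peq p p' -> q <> zero4 -> pdist p' q = pdist p q.
Proof.
  intros h hq. pose proof (proj1 h) as hp. destruct (peq_scale _ _ h) as [l [hl ->]].
  pose proof (pn2_pos p hp). pose proof (pn2_pos q hq). pose proof (Cnorm2_pos l hl).
  unfold pdist.
  assert (e1 : pn2 (scale4 l p) = Cnorm2 l * pn2 p).
  { destruct p as [[[x y] z] w]. unfold pn2, scale4, Cnorm2, Cmul; simpl; ring. }
  assert (e2 : Cnorm2 (herm (scale4 l p) q) = Cnorm2 l * Cnorm2 (herm p q)).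
  { destruct p as [[[x y] z] w], q as [[[x' y'] z'] w']. unfold herm, scale4.
    replace (l * x * Cconj x' + l * y * Cconj y' + l * z * Cconj z' + l * w * Cconj w')%cc with
      (l * (x * Cconj x' + y * Cconj y' + z * Cconj z' + w * Cconj w'))%cc by ring.
    apply Cnorm2_mul. }
  rewrite e1, e2. field. repeat split; lra.
Qed.

Lemma Cnorm2_herm_sym p q : Cnorm2 (herm p q) = Cnorm2 (herm q p).
Proof.
  destruct p as [[[[x1 x2] [y1 y2]] [z1 z2]] [w1 w2]], q as [[[[x1' x2'] [y1' y2']] [z1' z2']] [w1' w2']].
  unfold herm, Cnorm2, Cadd, Cmul, Cconj; cbn [fst snd]. ring.
Qed.

Lemma pdist_sym p q : pdist p q = pdist q p.
Proof. unfold pdist. rewrite Cnorm2_herm_sym, (Rmult_comm (pn2 p)). reflexivity. Qed.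

Lemma pdist_peq_r p q q' : peq q q' -> p <> zero4 -> pdist p q' = pdist p q.
Proof. intros h hp. rewrite (pdist_sym p q'), (pdist_sym p q). apply pdist_peq_l; auto. Qed.

Lemma peq_coord i p q : (i < 4)%nat -> peq p q -> coord i p <> C0 -> coord i q <> C0.
Proof. intros hi [h [l [hl H]]] hn. rewrite H by auto. apply Cmul_neq0; auto. Qed.

Lemma peq_ratio i k p q : (i < 4)%nat -> (k < 4)%nat -> peq p q -> coord i p <> C0 ->
  (coord k q / coord i q = coord k p / coord i p)%cc.
Proof. intros hi hk [h [l [hl H]]] hn. rewrite !H by auto. field. auto. Qed.

Lemma peq_chart i p q : (i < 4)%nat -> peq p q -> coord i p <> C0 -> chart i q = chart i p.
Proof.
  intros hi h hn.
  pose proof (peq_ratio i 0 p q hi ltac:(lia) h hn) as e0. pose proof (peq_ratio i 1 p q hi ltac:(lia) h hn) as e1.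
  pose proof (peq_ratio i 2 p q hi ltac:(lia) h hn) as e2. pose proof (peq_ratio i 3 p q hi ltac:(lia) h hn) as e3.
  destruct p as [[[x y] z] w], q as [[[x' y'] z'] w'].
  destruct i as [|[|[|[|i]]]]; try lia; simpl coord in *; unfold chart; rewrite ?e0, ?e1, ?e2, ?e3; reflexivity.
Qed.

Lemma peq_of_ratio i p q : (i < 4)%nat -> coord i p <> C0 -> coord i q <> C0 ->
  (forall k, (k < 4)%nat -> coord k p / coord i p = coord k q / coord i q)%cc -> peq p q.
Proof.
  intros hi hp hq H. split; [apply (coord_neq0 i); auto|]. exists (coord i q / coord i p)%cc.
  split; [apply Cdiv_neq0; auto|]. intros k hk. specialize (H k hk).
  transitivity (coord i q * (coord k q / coord i q))%cc; [field; auto|]. rewrite <- H. field; auto.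
Qed.

Lemma eq_of_close (a b : CC) : (forall eps, 0 < eps -> Cabs (a - b) < eps) -> a = b.
Proof.
  intro H. apply Csub_eq0, Cabs_eq0. apply Rle_antisym; [|apply Cabs_ge0]. apply Rnot_lt_le. intro h.
  specialize (H _ h). lra.
Qed.

(** Limits in projective space are unique. The point is to find a common affine chart: a coordinate
    that is nonzero at [q] is nonzero at [p] too. *)
Lemma peq_limit p q : p <> zero4 -> q <> zero4 ->
  (forall eps, 0 < eps -> exists q', q' <> zero4 /\ pdist p q' < eps /\ pdist q q' < eps) -> peq p q.
Proof.
  intros hp hq H.
  destruct (C4_neq0_coord p hp) as (a & ha & na). destruct (C4_neq0_coord q hq) as (b & hb & nb).
  assert (R : forall eps, 0 < eps -> exists q', coord a q' <> C0 /\ coord b q' <> C0 /\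
     (forall k, (k < 4)%nat -> Cabs (coord k q' / coord a q' - coord k p / coord a p) < eps)%cc /\
     (forall k, (k < 4)%nat -> Cabs (coord k q' / coord b q' - coord k q / coord b q) < eps)%cc).
  { intros eps he. destruct (pdist_ratio a p eps ha na he) as (d1 & hd1 & H1). destruct (pdist_ratio b q eps hb nb he) as (d2 & hd2 & H2).
    destruct (H (Rmin d1 d2)) as (q' & h0 & h1 & h2); [apply Rmin_pos; auto|].
    rmin d1 d2.
    destruct (H1 q' h0 ltac:(lra)) as [k1 k2]. destruct (H2 q' h0 ltac:(lra)) as [k3 k4]. exists q'. auto. }
  assert (nab : coord b p <> C0).
  (* Otherwise the ratio [x] of the coordinates [b] and [a] of [q'] would tend to zero while its
     inverse [y] stays bounded. *)
  { intro e0. set (z := (coord a q / coord b q)%cc). set (M := Cabs z + 1). pose proof (Cabs_ge0 z).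
    destruct (R (/ (2 * M))) as (q' & k1 & k2 & k3 & k4); [apply Rinv_0_lt_compat; unfold M; lra|].
    specialize (k3 b hb). specialize (k4 a ha). rewrite e0 in k3. fold z in k4.
    set (x := (coord b q' / coord a q')%cc) in *. set (y := (coord a q' / coord b q')%cc) in *.
    assert (exy : (x * y)%cc = C1) by (unfold x, y; field; auto).
    replace (x - 0 / coord a p)%cc with x in k3 by (field; auto).
    assert (hM : / (2 * M) <= 1/2).
    { replace (1/2) with (/ 2) by field. apply Rinv_le_contravar; unfold M; lra. }
    assert (hy : Cabs y < M) by (pose proof (Cabs_tri_rev y z); unfold M; lra).
    assert (h1 : Cabs x * Cabs y = 1) by (rewrite <- Cabs_mul, exy; apply Cabs_C1).
    pose proof (Cabs_ge0 x). pose proof (Cabs_ge0 y).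
    assert (Cabs x * Cabs y <= / (2 * M) * M) by (apply Rmult_le_compat; lra).
    replace (/ (2 * M) * M) with (1/2) in * by (field; unfold M; lra). lra. }
  apply (peq_of_ratio b); auto. intros k hk. apply eq_of_close. intros eps he.
  destruct (pdist_ratio b p (eps / 2) hb nab ltac:(lra)) as (d1 & hd1 & H1). destruct (pdist_ratio b q (eps / 2) hb nb ltac:(lra)) as (d2 & hd2 & H2).
  destruct (H (Rmin d1 d2)) as (q' & h0 & h1 & h2); [apply Rmin_pos; auto|].
  rmin d1 d2.
  destruct (H1 q' h0 ltac:(lra)) as [_ k2]. destruct (H2 q' h0 ltac:(lra)) as [_ k4].
  specialize (k2 k hk). specialize (k4 k hk).
  replace (coord k p / coord b p - coord k q / coord b q)%cc with
    ((coord k q' / coord b q' - coord k q / coord b q) - (coord k q' / coord b q' - coord k p / coord b p))%cc by ring.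
  eapply Rle_lt_trans; [apply Cabs_sub_tri|]. lra.
Qed.

Lemma lift3_neq0 P : lift3 P <> zero4.
Proof. destruct P as [[x y] z]. apply (coord_neq0 3). simpl. apply C1_neq0. Qed.

Lemma chart3_lift3 P : chart 3 (lift3 P) = P.
Proof.
  destruct P as [[x y] z]. unfold chart, lift3, c4.
  assert (e : forall u, (u / 1)%cc = u) by (intro; field; apply C1_neq0). rewrite !e. reflexivity.
Qed.

Lemma peq_lift3_inj P P' : peq (lift3 P) (lift3 P') -> P = P'.
Proof.
  intro h. rewrite <- (chart3_lift3 P), <- (chart3_lift3 P'). symmetry. apply peq_chart; [lia|auto|].
  destruct P as [[? ?] ?]. simpl. apply C1_neq0.
Qed.

Lemma lift3_chart3 q : coord 3 q <> C0 -> peq q (lift3 (chart 3 q)).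
Proof.
  intro h. destruct q as [[[x y] z] w]. simpl in h. split; [apply (coord_neq0 3); auto|].
  exists (Cinv w). split; [apply Cinv_neq0; auto|].
  intros [|[|[|[|i]]]] hi; try lia; simpl; field; auto.
Qed.

Lemma onbarS_lift3 A B Cc D P : onbarS A B Cc D (lift3 P) <-> onS A B Cc D P.
Proof.
  pose proof (lift3_neq0 P) as hn. destruct P as [[x y] z]. unfold onbarS, onS, lift3, c4 in *. split.
  - intros [_ h]. match goal with |- ?l = _ => match type of h with ?l' = ?r' => transitivity l'; [ring|rewrite h; ring] end end.
  - intro h. split; [exact hn|].
    match goal with |- ?l = _ => match type of h with ?l' = ?r' => transitivity l'; [ring|rewrite h; ring] end end.
Qed.

Lemma onbarS_peq A B Cc D p q : peq p q -> onbarS A B Cc D p -> onbarS A B Cc D q.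
Proof.
  intros h hp. pose proof (peq_neq0 _ _ h) as hq. destruct (peq_scale _ _ h) as [l [hl ->]].
  destruct p as [[[x y] z] w]. destruct hp as [_ hp]. split; [exact hq|]. unfold scale4.
  match type of hp with ?l1 = ?r1 => transitivity (l * (l * l) * l1)%cc; [ring|rewrite hp; ring] end.
Qed.

Lemma n3_sub3_add3 (P h : C3) : n3 (sub3 (add3 P h) P) = n3 h.
Proof.
  destruct P as [[x y] z], h as [[a b] c]. unfold add3, sub3, n3.
  replace (x + a - x)%cc with a by ring. replace (y + b - y)%cc with b by ring. replace (z + c - z)%cc with c by ring. reflexivity.
Qed.

Lemma add3_sub3 (P Q : C3) : add3 P (sub3 Q P) = Q.
Proof. destruct P as [[x y] z], Q as [[a b] c]. unfold add3, sub3. repeat f_equal; ring. Qed.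

Lemma near3_ball (P : C3) (Q : C3 -> Prop) : near3 P Q <-> exists r, 0 < r /\ forall x, n3 (sub3 x P) < r -> Q x.
Proof.
  split; intros [r [hr H]]; exists r; split; auto.
  - intros x hx. rewrite <- (add3_sub3 P x). apply H; auto.
  - intros h hh. apply H. simpl. rewrite n3_sub3_add3. exact hh.
Qed.

Lemma n3_tri (P Q T : C3) : n3 (sub3 P T) <= n3 (sub3 P Q) + n3 (sub3 Q T).
Proof.
  destruct P as [[x y] z], Q as [[a b] c], T as [[u v] w]. unfold sub3, n3.
  pose proof (Cabs_tri (x - a) (a - u)) as h1. pose proof (Cabs_tri (y - b) (b - v)) as h2. pose proof (Cabs_tri (z - c) (c - w)) as h3.
  replace (x - a + (a - u))%cc with (x - u)%cc in h1 by ring. replace (y - b + (b - v))%cc with (y - v)%cc in h2 by ring.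
  replace (z - c + (c - w))%cc with (z - w)%cc in h3 by ring. lra.
Qed.

Lemma open3_ball c r : open3 (ball3 c r).
Proof.
  intros p hp. unfold ball3 in *. exists (r - n3 (sub3 p c)). split; [lra|]. intros h hh.
  pose proof (n3_tri (add3 p h) p c) as t. rewrite n3_sub3_add3 in t. lra.
Qed.

(** * The matrix of a cyclically reduced word *)

Lemma reduced_from_nth c w :
  (forall i, (S i < length w)%nat -> nth i w Lx <> nth (S i) w Lx) ->
  (w <> [] -> nth (pred (length w)) w Lx <> c) -> reduced_from c w.
Proof.
  induction w as [|i w IH]; intros H hl; [exact I|]. split.
  - destruct w as [|i' w]; simpl.
    + apply (hl ltac:(discriminate)).
    + apply (H 0%nat). simpl; lia.
  - apply IH.
    + intros k hk. apply (H (S k)). simpl; lia.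
    + intro hw. destruct w as [|i' w]; [congruence|]. apply (hl ltac:(discriminate)).
Qed.

Definition rows_pos (N : Mat2) : Prop := let '(a, b, c, d) := N in (1 <= a + b /\ 1 <= c + d)%Z.
(** In the chart at [j] the rows of [N] are the exponents of [u_(o1 j)] and [u_(o2 j)]; the row
    selected is that of [u_m]. *)
Definition row_full (j : letter) (N : Mat2) (m : letter) : Prop :=
  let '(a, b, c, d) := N in
  if letter_eq_dec m (o1 j) then (1 <= a /\ 1 <= b)%Z else (1 <= c /\ 1 <= d)%Z.

(* As long as only two letters occur, one row of the matrix is full; the third letter fills the other. *)
Definition word_inv (c : letter) (w : list letter) : Prop :=
  nonneg (Nw c w) /\ rows_pos (Nw c w) /\
  (positive_entries (Nw c w) \/ w = [] \/
   exists k, k <> chart_of c w /\ (forall m, In m (c :: w) -> m = chart_of c w \/ m = k) /\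
             row_full (chart_of c w) (Nw c w) k).

Lemma word_inv_all c w : reduced_from c w -> word_inv c w.
Proof.
  induction w as [|i w IH]; intro h.
  - split; [simpl; lia|]. split; [simpl; lia|]. right; left; reflexivity.
  - destruct h as [h1 h2]. destruct (IH h2) as (n0 & rp & H). clear IH.
    unfold word_inv. cbn [Nw chart_of].
    set (j := chart_of c w) in *. destruct (Nw c w) as [[[x y] z] t] eqn:eN. simpl in n0, rp.
    split; [destruct i, j; try congruence; cbn -[Z.mul Z.add Z.le Z.lt]; lia|].
    split; [destruct i, j; try congruence; cbn -[Z.mul Z.add Z.le Z.lt]; lia|].
    destruct H as [H|[H|(k & hk & hm & hr)]].
    + left. simpl in H. destruct i, j; try congruence; cbn -[Z.mul Z.add Z.le Z.lt]; lia.
    + right; right. subst w. simpl in j. exists c. split; [auto|]. split.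
      * intros m [<-|[<-|[]]]; auto.
      * simpl in eN. unfold mid in eN. injection eN as <- <- <- <-. subst j. destruct i, c; try congruence; cbn -[Z.mul Z.add Z.le Z.lt]; lia.
    (* In both cases the exponents of the new [u_j] are the sum of the two rows, which is full
       because one of them is. If the new letter is [k], this is the full row asked for; if it is
       the third letter, the full row of [u_k] is kept as well and the matrix is positive. *)
    + destruct (letter_eq_dec i k) as [->|nik].
      * right; right. exists j. split; [auto|]. split.
        -- intros m [<-|[<-|hin]]; auto.
           ++ destruct (hm c) as [|]; simpl; auto.
           ++ destruct (hm m); simpl; auto.
        -- unfold row_full in hr. destruct k, j; try congruence; cbn -[Z.mul Z.add Z.le Z.lt] in *; lia.
      * left. unfold row_full in hr. destruct i, j, k; try congruence; cbn -[Z.mul Z.add Z.le Z.lt] in *; lia.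
Qed.

Lemma Nw_positive c w : reduced_from c w -> In Lx w -> In Ly w -> In Lz w -> positive_entries (Nw c w).
Proof.
  intros h hx hy hz. destruct (word_inv_all c w h) as (_ & _ & [H|[H|(k & hk & hm & _)]]); auto.
  - subst; destruct hx.
  - exfalso. pose proof (hm Lx (or_intror hx)). pose proof (hm Ly (or_intror hy)). pose proof (hm Lz (or_intror hz)).
    destruct (chart_of c w), k; intuition congruence.
Qed.

Lemma Nw_det c w : reduced_from c w -> inGL2Z (Nw c w).
Proof.
  induction w as [|i w IH]; intro h; [left; reflexivity|]. destruct h as [h1 h2].
  unfold inGL2Z in *. cbn [Nw]. rewrite mdet_mmul.
  assert (mdet (Pm i (chart_of c w)) = 1 \/ mdet (Pm i (chart_of c w)) = -1)%Z
    by (destruct i, (chart_of c w); try congruence; simpl; auto).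
  destruct (IH h2) as [-> | ->]; destruct H as [-> | ->]; simpl; auto.
Qed.

(** * Conjugacy with the matrix of the word *)

Ltac mat_eq := repeat match goal with |- (_, _) = (_, _) => apply f_equal2 end; ring.

Lemma mmul_assoc M N P : mmul M (mmul N P) = mmul (mmul M N) P.
Proof.
  destruct M as [[[? ?] ?] ?], N as [[[? ?] ?] ?], P as [[[? ?] ?] ?]. unfold mmul. mat_eq.
Qed.

Lemma mscale_mmul_l s M N : mmul (mscale s M) N = mscale s (mmul M N).
Proof. destruct M as [[[? ?] ?] ?], N as [[[? ?] ?] ?]. unfold mmul, mscale. mat_eq. Qed.

Lemma mscale_mmul_r s M N : mmul M (mscale s N) = mscale s (mmul M N).
Proof. destruct M as [[[? ?] ?] ?], N as [[[? ?] ?] ?]. unfold mmul, mscale. mat_eq. Qed.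

Lemma mscale_mscale s t M : mscale s (mscale t M) = mscale (s * t) M.
Proof. destruct M as [[[? ?] ?] ?]. unfold mscale. mat_eq. Qed.

Lemma mscale_1 M : mscale 1 M = M.
Proof. destruct M as [[[? ?] ?] ?]. unfold mscale. mat_eq. Qed.

Lemma mmul_mid_l M : mmul mid M = M.
Proof. destruct M as [[[? ?] ?] ?]. unfold mmul, mid. mat_eq. Qed.

Lemma mmul_mid_r M : mmul M mid = M.
Proof. destruct M as [[[? ?] ?] ?]. unfold mmul, mid. mat_eq. Qed.

(* In the basis in which the involutions act by [M_of], the rows of [Rm j] are, up to sign, the growth rates
   of [log] of the two affine coordinates other than [j]. *)
Definition Rm (j : letter) : Mat2 :=
  match j with Lx => (1, 1, 0, -1)%Z | Ly => (1, 0, 0, 1)%Z | Lz => (-1, 0, 1, 1)%Z end.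

(** Letter by letter, [M_of] and [Pm] are intertwined by the matrices [Rm] up to a sign; the
    intermediate [Rm] telescope and the signs multiply. *)
Lemma Rm_word c w : reduced_from c w -> exists s, (s = 1 \/ s = -1)%Z /\
  mmul (Rm (chart_of c w)) (M_word w) = mscale s (mmul (Nw c w) (Rm c)).
Proof.
  induction w as [|i w IH]; intro h.
  - exists 1%Z. split; auto. cbn [chart_of Nw M_word fold_right]. rewrite mscale_1, mmul_mid_l, mmul_mid_r. reflexivity.
  - destruct h as [h1 h2]. destruct (IH h2) as (s & hs & e).
    assert (st : exists t, (t = 1 \/ t = -1)%Z /\ mmul (Rm i) (M_of i) = mscale t (mmul (Pm i (chart_of c w)) (Rm (chart_of c w)))).
    { destruct i, (chart_of c w); try congruence;
        first [exists 1%Z; split; [auto|reflexivity] | exists (-1)%Z; split; [auto|reflexivity]]. }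
    destruct st as (t & ht & et). exists (t * s)%Z. split; [lia|].
    cbn [chart_of Nw]. change (M_word (i :: w)) with (mmul (M_of i) (M_word w)).
    rewrite mmul_assoc, et, mscale_mmul_l, <- mmul_assoc, e, mscale_mmul_r, mscale_mscale, mmul_assoc. reflexivity.
Qed.

Lemma Nw_conj c w : reduced_from c w -> chart_of c w = c -> conj_PGL (Nw c w) (M_word w).
Proof.
  intros h hc. destruct (Rm_word c w h) as (s & hs & e). rewrite hc in e.
  assert (hR : inGL2Z (Rm c)) by (destruct c; unfold inGL2Z; simpl; auto).
  destruct (mmul_minv (Rm c) hR) as [i1 i2].
  exists (minv (Rm c)). split.
  - destruct c; unfold inGL2Z; simpl; auto.
  - exists s. split; auto.
    assert (ss : (s * s = 1)%Z) by (destruct hs; subst; reflexivity).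
    transitivity (mmul (minv (Rm c)) (mmul (mmul (Nw c w) (Rm c)) (minv (Rm c)))).
    { rewrite <- (mmul_assoc (Nw c w)), i1, mmul_mid_r. reflexivity. }
    assert (e' : mmul (Nw c w) (Rm c) = mscale s (mmul (Rm c) (M_word w))).
    { rewrite e, mscale_mscale, ss, mscale_1. reflexivity. }
    rewrite e', mscale_mmul_l, mscale_mmul_r, !mmul_assoc, i2, mmul_mid_l. reflexivity.
Qed.

(** * Differentiable maps into [C2] and [C3] *)

Definition DifC2 (V : nspace) (F : V -> C2) (p : V) : Prop :=
  Dif V (fun x => fst (F x)) p /\ Dif V (fun x => snd (F x)) p.
Definition DifC3 (V : nspace) (F : V -> C3) (p : V) : Prop :=
  Dif V (fun x => fst (fst (F x))) p /\ Dif V (fun x => snd (fst (F x))) p /\ Dif V (fun x => snd (F x)) p.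

Lemma near_comp2 (V : nspace) (F : V -> C2) (p : V) (Q : C2 -> Prop) :
  DifC2 V F p -> near2 (F p) Q -> near V p (fun x => Q (F x)).
Proof.
  intros [h1 h2] [d [hd H]].
  eapply near_mono; [|exact (near_and V _ _ _ (Dif_cont V _ _ (d / 2) h1 ltac:(lra)) (Dif_cont V _ _ (d / 2) h2 ltac:(lra)))].
  cbn beta. intros x [a b]. rewrite <- (add2_sub2 (F x) (F p)). apply H. simpl. unfold n2, sub2; cbn [fst snd]. lra.
Qed.

Lemma near_comp3 (V : nspace) (F : V -> C3) (p : V) (Q : C3 -> Prop) :
  DifC3 V F p -> near3 (F p) Q -> near V p (fun x => Q (F x)).
Proof.
  intros (h1 & h2 & h3) [d [hd H]].
  eapply near_mono; [|exact (near_and V _ _ _ (Dif_cont V _ _ (d / 3) h1 ltac:(lra))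
    (near_and V _ _ _ (Dif_cont V _ _ (d / 3) h2 ltac:(lra)) (Dif_cont V _ _ (d / 3) h3 ltac:(lra))))].
  cbn beta. intros x (a & b & c). rewrite <- (add3_sub3 (F p) (F x)). apply H. simpl.
  destruct (F x) as [[? ?] ?], (F p) as [[? ?] ?]. unfold sub3, n3. cbn [fst snd] in *. lra.
Qed.

Lemma DifC2_comp2 (V : nspace) (G : C2 -> C2) (F : V -> C2) (p : V) :
  DifC2 VC2 G (F p) -> DifC2 V F p -> DifC2 V (fun x => G (F x)) p.
Proof.
  intros [g1 g2] [f1 f2]. split.
  - apply (Dif_ext V (fun x => fst (G (fst (F x), snd (F x))))); [intro x; rewrite <- surjective_pairing; auto|].
    apply (Dif_comp2 V (fun s => fst (G s))); auto. rewrite <- surjective_pairing. exact g1.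
  - apply (Dif_ext V (fun x => snd (G (fst (F x), snd (F x))))); [intro x; rewrite <- surjective_pairing; auto|].
    apply (Dif_comp2 V (fun s => snd (G s))); auto. rewrite <- surjective_pairing. exact g2.
Qed.

Lemma DifC2_comp3 (V : nspace) (G : C3 -> C2) (F : V -> C3) (p : V) :
  DifC2 VC3 G (F p) -> DifC3 V F p -> DifC2 V (fun x => G (F x)) p.
Proof.
  intros [g1 g2] (f1 & f2 & f3). split.
  - apply (Dif_comp3 V (fun s => fst (G s)) F); auto.
  - apply (Dif_comp3 V (fun s => snd (G s)) F); auto.
Qed.

Lemma DifC2_id p : DifC2 VC2 (fun x => x) p.
Proof. split; [exact (Dif2_fst p)|exact (Dif2_snd p)]. Qed.

Lemma DifC3_id p : DifC3 VC3 (fun x => x) p.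
Proof. split; [exact (Dif3_x p)|split; [exact (Dif3_y p)|exact (Dif3_z p)]]. Qed.

(** * The group generated by the involutions *)

Lemma s_of_DifC3 A B Cc i (V : nspace) (F : V -> C3) p : DifC3 V F p -> DifC3 V (fun x => s_of A B Cc i (F x)) p.
Proof.
  intros (h1 & h2 & h3).
  assert (E : forall x, F x = (fst (fst (F x)), snd (fst (F x)), snd (F x))) by (intro x; destruct (F x) as [[? ?] ?]; reflexivity).
  assert (lem : forall a (f g h : V -> CC), Dif V f p -> Dif V g p -> Dif V h p -> Dif V (fun x => a - f x * g x - h x)%cc p).
  { intros a f g h hf hg hh. apply (Dif_sub V (fun x => a - f x * g x)%cc); auto.
    apply (Dif_sub V (fun _ => a)); [apply Dif_const|apply Dif_mul; auto]. }
  assert (ext : forall G : V -> C3, (forall x, G x = s_of A B Cc i (F x)) -> DifC3 V G p -> DifC3 V (fun x => s_of A B Cc i (F x)) p).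
  { intros G e (g1 & g2 & g3). split; [|split].
    - exact (Dif_ext V _ _ p (fun x => f_equal (fun P => fst (fst P)) (e x)) g1).
    - exact (Dif_ext V _ _ p (fun x => f_equal (fun P => snd (fst P)) (e x)) g2).
    - exact (Dif_ext V _ _ p (fun x => f_equal snd (e x)) g3). }
  set (f := fun x => fst (fst (F x))) in *. set (g := fun x => snd (fst (F x))) in *. set (h := fun x => snd (F x)) in *.
  destruct i.
  - apply (ext (fun x => (A - g x * h x - f x, g x, h x)%cc)); [intro x; rewrite (E x); reflexivity|].
    split; [|split]; auto. apply (lem A g h f); auto.
  - apply (ext (fun x => (f x, B - f x * h x - g x, h x)%cc)); [intro x; rewrite (E x); reflexivity|].
    split; [|split]; auto. apply (lem B f h g); auto.
  - apply (ext (fun x => (f x, g x, Cc - f x * g x - h x)%cc)); [intro x; rewrite (E x); reflexivity|].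
    split; [|split]; auto. apply (lem Cc f g h); auto.
Qed.

Lemma eval_word_DifC3 A B Cc w (V : nspace) (F : V -> C3) p : DifC3 V F p -> DifC3 V (fun x => eval_word A B Cc w (F x)) p.
Proof.
  intro h. induction w as [|i w IH]; [exact h|].
  exact (s_of_DifC3 A B Cc i V (fun x => eval_word A B Cc w (F x)) p IH).
Qed.

Lemma iter_eval_DifC3 A B Cc w k (V : nspace) (F : V -> C3) p :
  DifC3 V F p -> DifC3 V (fun x => iter k (eval_word A B Cc w) (F x)) p.
Proof.
  intro h. induction k as [|k IH]; [exact h|].
  exact (eval_word_DifC3 A B Cc w V (fun x => iter k (eval_word A B Cc w) (F x)) p IH).
Qed.

Lemma s_of_invol A B Cc i P : s_of A B Cc i (s_of A B Cc i P) = P.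
Proof. destruct P as [[x y] z]. destruct i; unfold s_of, s_x, s_y, s_z; repeat apply f_equal2; ring. Qed.

Lemma eval_word_app A B Cc u v P : eval_word A B Cc (u ++ v) P = eval_word A B Cc u (eval_word A B Cc v P).
Proof.
  induction u as [|i u IH]; [reflexivity|].
  change (s_of A B Cc i (eval_word A B Cc (u ++ v) P) = s_of A B Cc i (eval_word A B Cc u (eval_word A B Cc v P))).
  rewrite IH. reflexivity.
Qed.

Lemma eval_word_rev_l A B Cc w P : eval_word A B Cc (rev w) (eval_word A B Cc w P) = P.
Proof.
  induction w as [|i w IH]; [reflexivity|]. simpl rev. rewrite eval_word_app.
  change (eval_word A B Cc (rev w) (s_of A B Cc i (s_of A B Cc i (eval_word A B Cc w P))) = P).
  rewrite s_of_invol. exact IH.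
Qed.

Lemma eval_word_rev_r A B Cc w P : eval_word A B Cc w (eval_word A B Cc (rev w) P) = P.
Proof. rewrite <- (rev_involutive w) at 1. apply eval_word_rev_l. Qed.

Lemma s_of_onS A B Cc D i P : onS A B Cc D P -> onS A B Cc D (s_of A B Cc i P).
Proof.
  destruct P as [[x y] z]. unfold onS. intro h. destruct i; unfold s_of, s_x, s_y, s_z; apply Csub_eq0;
    match type of h with ?l = ?r => transitivity (l - r)%cc; [ring|rewrite h; ring] end.
Qed.

Lemma eval_word_onS A B Cc D w P : onS A B Cc D P -> onS A B Cc D (eval_word A B Cc w P).
Proof.
  intro h. induction w as [|i w IH]; [exact h|].
  exact (s_of_onS A B Cc D i (eval_word A B Cc w P) IH).
Qed.

Lemma iter_inv {T : Type} (f g : T -> T) : (forall x, g (f x) = x) -> forall k x, iter k g (iter k f x) = x.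
Proof.
  intros H k. induction k as [|k IH]; intro x; [reflexivity|].
  rewrite iter_succ_r. simpl. rewrite H. apply IH.
Qed.

Lemma iter_onS A B Cc D w k P : onS A B Cc D P -> onS A B Cc D (iter k (eval_word A B Cc w) P).
Proof. intro h. induction k as [|k IH]; [exact h|]. simpl. apply eval_word_onS; auto. Qed.

(** * Inverting monomial maps on the torus *)

(** Monomial map of the adjugate, its negative exponents being written as denominators; for
    determinant [-1] both coordinates are inverted. *)
Definition moninv (N : Mat2) (p : C2) : C2 :=
  let '(a, b, c, d) := N in
  let u := (Cpow (fst p) (Z.to_nat d) / Cpow (snd p) (Z.to_nat b))%cc in
  let v := (Cpow (snd p) (Z.to_nat a) / Cpow (fst p) (Z.to_nat c))%cc in
  if Z.eq_dec (mdet N) 1 then (u, v) else (Cinv u, Cinv v).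

Lemma monomial_offax N s : offax s -> offax (monomial N s).
Proof.
  intros [h1 h2]. destruct N as [[[a b] c] d]. split; unfold monomial; cbn [fst snd]; apply Cmul_neq0; apply Cpow_neq0; auto.
Qed.

Lemma iter_monomial_offax N k s : offax s -> offax (iter k (monomial N) s).
Proof. intro h. induction k as [|k IH]; [exact h|]. simpl. apply monomial_offax; auto. Qed.

Lemma moninv_offax N s : offax s -> offax (moninv N s).
Proof.
  intros [h1 h2]. destruct N as [[[a b] c] d]. unfold moninv.
  destruct (Z.eq_dec _ _); split; cbn [fst snd]; try apply Cinv_neq0; apply Cdiv_neq0; apply Cpow_neq0; auto.
Qed.

Lemma iter_moninv_offax N k s : offax s -> offax (iter k (moninv N) s).
Proof. intro h. induction k as [|k IH]; [exact h|]. simpl. apply moninv_offax; auto. Qed.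

Lemma moninv_DifC2 N s : offax s -> DifC2 VC2 (moninv N) s.
Proof.
  intros [h1 h2]. destruct N as [[[a b] c] d]. unfold moninv.
  pose proof (Dif2_fst s) as D1. pose proof (Dif2_snd s) as D2.
  destruct (Z.eq_dec _ _); split; cbn [fst snd];
    try (apply (Dif_inv VC2); [apply Cdiv_neq0; apply Cpow_neq0; auto|]);
    apply (Dif_div VC2); try (apply Cpow_neq0; auto); apply Dif_pow; auto.
Qed.

Lemma Cpow_inv z n : z <> C0 -> Cpow (Cinv z) n = Cinv (Cpow z n).
Proof.
  intro h. induction n as [|n IH]; simpl.
  - field. apply C1_neq0.
  - rewrite IH. field. split; auto. apply Cpow_neq0; auto.
Qed.

Lemma Cpow_div z w n : w <> C0 -> Cpow (z / w)%cc n = (Cpow z n / Cpow w n)%cc.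
Proof. intro h. unfold Cdiv. rewrite Cpow_mul_base, Cpow_inv by auto. reflexivity. Qed.

Lemma Cpow_ratio_aux p q (m n k k' : nat) : p <> C0 -> q <> C0 -> (m = S n)%nat -> k = k' ->
  (Cpow p m * Cpow q k / (Cpow p n * Cpow q k') = p)%cc.
Proof.
  intros hp hq -> ->. simpl. pose proof (Cpow_neq0 p n hp). pose proof (Cpow_neq0 q k' hq). field. auto.
Qed.

Lemma moninv_monomial N s : positive_entries N -> inGL2Z N -> offax s ->
  moninv N (monomial N s) = s /\ monomial N (moninv N s) = s.
Proof.
  intros hN hdet [hp hq]. destruct N as [[[a b] c] d], s as [p q]. cbn [fst snd] in *. simpl in hN.
  unfold inGL2Z, mdet in hdet. unfold moninv, monomial; cbn [fst snd mdet].
  destruct hN as (ha & hb & hc & hd).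
  assert (ea : a = Z.of_nat (Z.to_nat a)) by (rewrite Z2Nat.id; lia).
  assert (eb : b = Z.of_nat (Z.to_nat b)) by (rewrite Z2Nat.id; lia).
  assert (ec : c = Z.of_nat (Z.to_nat c)) by (rewrite Z2Nat.id; lia).
  assert (ed : d = Z.of_nat (Z.to_nat d)) by (rewrite Z2Nat.id; lia).
  set (a' := Z.to_nat a) in *. set (b' := Z.to_nat b) in *. set (c' := Z.to_nat c) in *. set (d' := Z.to_nat d) in *.
  clearbody a' b' c' d'. subst a b c d.
  assert (npow : forall z n, z <> C0 -> Cpow z n <> C0) by (intros; apply Cpow_neq0; auto).
  destruct (Z.eq_dec _ _) as [e|e].
  - assert (e' : (a' * d' = S (c' * b'))%nat) by lia.
    split; apply f_equal2; cbn [fst snd];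
      rewrite ?Cpow_div, ?Cpow_mul_base, ?Cpow_pow by (auto using Cmul_neq0).
    + apply Cpow_ratio_aux; auto; lia.
    + transitivity (Cpow q (d' * a') * Cpow p (c' * a') / (Cpow q (b' * c') * Cpow p (a' * c')))%cc;
        [unfold Cdiv; f_equal; [ring|f_equal; ring]|]. apply Cpow_ratio_aux; auto; lia.
    + transitivity (Cpow p (d' * a') * Cpow q (a' * b') / (Cpow p (c' * b') * Cpow q (b' * a')))%cc;
        [field; auto|]. apply Cpow_ratio_aux; auto; lia.
    + transitivity (Cpow q (a' * d') * Cpow p (d' * c') / (Cpow q (b' * c') * Cpow p (c' * d')))%cc;
        [field; auto|]. apply Cpow_ratio_aux; auto; lia.
  - assert (e' : (c' * b' = S (a' * d'))%nat) by lia.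
    split; apply f_equal2; cbn [fst snd];
      rewrite ?Cpow_inv, ?Cpow_div, ?Cpow_mul_base, ?Cpow_pow by (auto using Cmul_neq0, Cdiv_neq0).
    + transitivity (Cpow p (c' * b') * Cpow q (d' * b') / (Cpow p (a' * d') * Cpow q (b' * d')))%cc;
        [field; repeat split; auto|]. apply Cpow_ratio_aux; auto; lia.
    + transitivity (Cpow q (b' * c') * Cpow p (a' * c') / (Cpow q (d' * a') * Cpow p (c' * a')))%cc;
        [field; repeat split; auto|]. apply Cpow_ratio_aux; auto; lia.
    + transitivity (Cpow p (c' * b') * Cpow q (b' * a') / (Cpow p (d' * a') * Cpow q (a' * b')))%cc;
        [field; repeat split; auto|]. apply Cpow_ratio_aux; auto; lia.
    + transitivity (Cpow q (b' * c') * Cpow p (c' * d') / (Cpow q (a' * d') * Cpow p (d' * c')))%cc;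
        [field; repeat split; auto|]. apply Cpow_ratio_aux; auto; lia.
Qed.

Lemma monomial_DifC2 N p : DifC2 VC2 (monomial N) p.
Proof. exact (Dif2_monomial N p). Qed.

Lemma iter_DifC2 (f : C2 -> C2) (P : C2 -> Prop) k p : (forall x, P x -> P (f x)) -> (forall x, P x -> DifC2 VC2 f x) ->
  P p -> DifC2 VC2 (iter k f) p.
Proof.
  intros hP hD hp. assert (I : P (iter k f p) /\ DifC2 VC2 (iter k f) p).
  { induction k as [|k [I1 I2]]; [split; auto; apply DifC2_id|]. split; [apply hP; auto|].
    exact (DifC2_comp2 VC2 f (iter k f) p (hD _ I1) I2). }
  apply I.
Qed.

Lemma iter_moninv_l N k s : positive_entries N -> inGL2Z N -> offax s ->
  iter k (moninv N) (iter k (monomial N) s) = s.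
Proof.
  intros h1 h2. revert s. induction k as [|k IH]; intros s hs; [reflexivity|].
  rewrite iter_succ_r. simpl.
  rewrite (proj1 (moninv_monomial N _ h1 h2 (iter_monomial_offax N k s hs))). apply IH; auto.
Qed.

Lemma iter_moninv_r N k s : positive_entries N -> inGL2Z N -> offax s ->
  iter k (monomial N) (iter k (moninv N) s) = s.
Proof.
  intros h1 h2. revert s. induction k as [|k IH]; intros s hs; [reflexivity|].
  rewrite iter_succ_r. simpl.
  rewrite (proj2 (moninv_monomial N _ h1 h2 (iter_moninv_offax N k s hs))). apply IH; auto.
Qed.

Lemma axprod_lt1 s : Bidisk s -> axprod s < 1.
Proof. intros [h1 h2]. unfold Disk, axprod in *. pose proof (Cabs_ge0 (fst s)). pose proof (Cabs_ge0 (snd s)). nra. Qed.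

Lemma monomial_Bidisk N s : positive_entries N -> Bidisk s -> Bidisk (monomial N s).
Proof. intros hN hs. destruct (monomial_small N s hN hs). pose proof (axprod_lt1 s hs). split; unfold Disk; lra. Qed.

Lemma iter_monomial_Bidisk N k s : positive_entries N -> Bidisk s -> Bidisk (iter k (monomial N) s).
Proof. intros hN hs. induction k as [|k IH]; [exact hs|]. simpl. apply monomial_Bidisk; auto. Qed.

Lemma iter_monomial_small N s r e : positive_entries N -> Bidisk s -> 0 < r -> 0 < e ->
  exists k, axes_nbhd r e (iter k (monomial N) s).
Proof.
  intros hN hs hr he. set (x := axprod s). pose proof (axprod_lt1 s hs) as hx. fold x in hx. pose proof (axprod_ge0 s) as hx0. fold x in hx0.
  assert (I : forall k, axprod (iter k (monomial N) s) <= x ^ (S k)).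
  { induction k as [|k IH]; [simpl iter; fold x; simpl pow; lra|]. simpl iter.
    pose proof (iter_monomial_Bidisk N k s hN hs) as hk. destruct (monomial_small N _ hN hk) as [m1 m2].
    set (y := axprod (iter k (monomial N) s)) in *. assert (hy0 : 0 <= y) by apply axprod_ge0.
    assert (hp : 0 <= x ^ (S k) <= x).
    { split; [apply pow_le; auto|]. simpl. assert (0 <= x ^ k <= 1). { split; [apply pow_le; auto|]. rewrite <- (pow1 k). apply pow_incr; lra. } nra. }
    unfold axprod at 1. apply Rle_trans with (y * y); [apply Rmult_le_compat; auto using Cabs_ge0|].
    change (x ^ S (S k)) with (x * x ^ S k). apply Rmult_le_compat; auto; lra. }
  destruct (pow_lt_1_zero x) with (y := Rmin r e) as [n hn].
  { rewrite Rabs_right; lra. }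
  { apply Rmin_pos; auto. }
  (* One more step than for [axprod]: each coordinate is bounded by the product at the previous
     iterate. *)
  exists (S n). specialize (hn (S n) ltac:(lia)). rewrite Rabs_right in hn by (apply Rle_ge, pow_le; auto).
  specialize (I n) as I1. specialize (I (S n)) as I2. simpl iter in I2 |- *.
  destruct (monomial_small N _ hN (iter_monomial_Bidisk N n s hN hs)) as [m1 m2].
  rmin r e.
  assert (x ^ (S (S n)) <= x ^ (S n)).
  { change (x ^ S (S n)) with (x * x ^ S n). pose proof (pow_le x (S n) hx0). nra. }
  set (z := x ^ S n) in *. set (z' := x ^ S (S n)) in *. repeat split; lra.
Qed.

(** * The conjugacy *)

Section Conjugacy.
Variables (A B Cc D : CC) (c : letter) (w : list letter).
Hypothesis Hred : reduced_from c w.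
Hypothesis Hc : chart_of c w = c.
Hypothesis Hpos : positive_entries (Nw c w).

Notation N := (Nw c w).
Notation L := (Lw A B Cc D c w).
Notation F := (TwMap (Nw c w) (Lw A B Cc D c w)).
Notation f := (eval_word A B Cc w).
Notation fi := (eval_word A B Cc (rev w)).
Notation Paff := (affine_pt A B Cc D c).
Notation Pi4 := (proj_pt A B Cc D c).
Notation Phi := (Phi0 (Nw c w) (Lw A B Cc D c w)).
Notation mon := (monomial (Nw c w)).
Notation kap := (chart_inv A B Cc D c).

(** Properties of the chart that hold near the axes; used as [extra] in the choice of the domain
    [W], they hold at each of its points. *)
Definition chart_good (s : C2) : Prop :=
  (offax s -> f (Paff s) = Paff (F s) /\ offax (F s)) /\ Cabs (fst s) < 1 /\ Cabs (snd s) < 1 /\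
  X_at A B Cc D c s <> C0 /\ 0 < fst (Deltaj A B Cc D c s).

Notation W := (lin_domain (Nw c w) (Lw A B Cc D c w) chart_good).

Lemma Nw_inv : inGL2Z N.
Proof. apply Nw_det; auto. Qed.

Lemma Lw_log_monomial r : 0 < r -> r < 1 -> log_monomial r N L.
Proof. intros; apply log_monomial_word; auto. Qed.

Lemma chart_good_near_axes r : 0 < r -> r < 1 -> near_axes r chart_good.
Proof.
  intros h0 h1. pose proof (word_Paff A B Cc D r h0 h1 c w Hred) as V1.
  pose proof (X_near1 (param_at A B Cc c) (param_at A B Cc (o1 c)) (param_at A B Cc (o2 c)) D r h0 h1) as V2.
  pose proof (Delta_low (param_at A B Cc c) (param_at A B Cc (o1 c)) (param_at A B Cc (o2 c)) D r h0 h1) as V3.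
  destruct (near_axes_and _ _ _ V1 (near_axes_and _ _ _ V2 V3)) as (e & he & H). exists e. split; auto.
  intros s hs. destruct (H s hs) as (g1 & g2 & g3). destruct hs as (k1 & k2 & _). rewrite Hc in g1.
  split; [exact g1|]. split; [lra|]. split; [lra|]. split.
  - apply near1_abs in g2. apply Cabs_neq0. unfold X_at. lra.
  - unfold Deltaj. assert (0 < 1 - r * r) by nra. nra.
Qed.

Lemma W_good s : W s -> chart_good s.
Proof. exact (W_Ex N L Hpos Nw_inv Lw_log_monomial chart_good chart_good_near_axes s). Qed.

Lemma W_near s : W s -> near2 s W.
Proof.
  intros (r & h0 & h1 & hs). apply (near_mono VC2 s (axes_nbhd r (lin_radius N L chart_good r))).
  - intros x hx. exists r. auto.
  - apply axes_nbhd_near; [lra|auto].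
Qed.

Lemma W_step s : W s -> W (F s) /\ Phi (F s) = mon (Phi s).
Proof. exact (W_F N L Hpos Nw_inv Lw_log_monomial chart_good chart_good_near_axes s). Qed.

Lemma twist_offax s al : offax s -> offax (twist s al).
Proof. intros [h1 h2]. split; apply Cmul_neq0; auto using cexp_neq0. Qed.

Lemma Phi_offax s : offax (Phi s) <-> offax s.
Proof.
  split; intro h.
  - destruct h as [h1 h2]. split; intro e; [apply h1|apply h2]; unfold Phi0, twist; cbn [fst snd]; rewrite e; ring.
  - apply twist_offax; auto.
Qed.

Lemma W_iterate k s : W s -> offax s ->
  W (iter k F s) /\ offax (iter k F s) /\ Phi (iter k F s) = iter k mon (Phi s) /\ iter k f (Paff s) = Paff (iter k F s).
Proof.
  intros hs ho. induction k as [|k (I1 & I2 & I3 & I4)]; [repeat split; auto; apply ho|].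
  simpl. destruct (W_step _ I1) as [J1 J2]. destruct (W_good _ I1) as [J3 _]. destruct (J3 I2) as [J4 J5].
  split; auto. split; auto. split; [rewrite J2, I3; reflexivity|rewrite I4; exact J4].
Qed.

Lemma fi_f P : fi (f P) = P.
Proof. apply eval_word_rev_l. Qed.

Lemma f_fi P : f (fi P) = P.
Proof. apply eval_word_rev_r. Qed.

Lemma iter_f_inj k P P' : iter k f P = iter k f P' -> P = P'.
Proof. intro e. rewrite <- (iter_inv f fi fi_f k P), <- (iter_inv f fi fi_f k P'), e. reflexivity. Qed.

Lemma iter_mon_inj k p p' : offax p -> offax p' -> iter k mon p = iter k mon p' -> p = p'.
Proof.
  intros h h' e. rewrite <- (iter_moninv_l N k p Hpos Nw_inv h), <- (iter_moninv_l N k p' Hpos Nw_inv h'), e. reflexivity.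
Qed.

Lemma Paff_inj s s' : W s -> W s' -> offax s -> offax s' -> Paff s = Paff s' -> s = s'.
Proof.
  intros hs hs' [a1 a2] [b1 b2] e. destruct (W_good _ hs) as (_ & l1 & l2 & _). destruct (W_good _ hs') as (_ & m1 & m2 & _).
  assert (e12 : jouk (fst s) = jouk (fst s') /\ jouk (snd s) = jouk (snd s')).
  { unfold affine_pt, cpl in e. set (u := (- (X_at A B Cc D c s / (fst s * snd s)))%cc) in e.
    set (v := (- (X_at A B Cc D c s' / (fst s' * snd s')))%cc) in e. clearbody u v.
    destruct c.
    - split; [exact (f_equal (fun x => snd (fst x)) e)|exact (f_equal (fun x => snd x) e)].
    - split; [exact (f_equal (fun x => fst (fst x)) e)|exact (f_equal (fun x => snd x) e)].
    - split; [exact (f_equal (fun x => fst (fst x)) e)|exact (f_equal (fun x => snd (fst x)) e)]. }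
  destruct e12 as [e1 e2]. apply jouk_inj in e1; auto. apply jouk_inj in e2; auto.
  rewrite (surjective_pairing s), (surjective_pairing s'), e1, e2. reflexivity.
Qed.

(* [Rel p P] says that [P] is the image of [p] under the conjugacy, extended from a neighborhood of the
   axes to the punctured bidisk by [P = f^{-k} (Psi (p^{N^k}))]. *)
Definition Rel (p : C2) (P : C3) : Prop :=
  exists k s, W s /\ offax s /\ Phi s = iter k mon p /\ iter k f P = Paff s.

(** Two representations are compared after a common number [K] of steps, large enough for both
    points to lie over the radius [1/2], where [Phi] is injective. *)
Lemma Rel_meet p P p' P' : Rel p P -> Rel p' P' ->
  exists K s s', W s /\ W s' /\ offax s /\ offax s' /\ Phi s = iter K mon p /\ Phi s' = iter K mon p' /\
    iter K f P = Paff s /\ iter K f P' = Paff s' /\ (Phi s = Phi s' -> s = s').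
Proof.
  intros (k & s & hs & ho & e1 & e2) (k' & s' & hs' & ho' & e1' & e2').
  pose proof (lin_radius_good N L Hpos Nw_inv Lw_log_monomial chart_good chart_good_near_axes (1/2) ltac:(lra) ltac:(lra)) as (he & _).
  destruct (F_iter_small N L Hpos Nw_inv Lw_log_monomial chart_good chart_good_near_axes s (1/2) _ hs ltac:(lra) he) as [m hm].
  destruct (F_iter_small N L Hpos Nw_inv Lw_log_monomial chart_good chart_good_near_axes s' (1/2) _ hs' ltac:(lra) he) as [m' hm'].
  exists (k + k' + (m + m'))%nat, (iter (k' + (m + m')) F s), (iter (k + (m + m')) F s').
  destruct (W_iterate (k' + (m + m')) s hs ho) as (a1 & a2 & a3 & a4).
  destruct (W_iterate (k + (m + m')) s' hs' ho') as (b1 & b2 & b3 & b4).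
  replace (iter (k + k' + (m + m')) mon p) with (iter (k' + (m + m') + k) mon p) by (f_equal; lia).
  replace (iter (k + k' + (m + m')) mon p') with (iter (k + (m + m') + k') mon p') by (f_equal; lia).
  replace (iter (k + k' + (m + m')) f P) with (iter (k' + (m + m') + k) f P) by (f_equal; lia).
  replace (iter (k + k' + (m + m')) f P') with (iter (k + (m + m') + k') f P') by (f_equal; lia).
  rewrite (iter_add mon _ k p), (iter_add mon _ k' p'), (iter_add f _ k P), (iter_add f _ k' P'), e2, e2', <- e1, <- e1'.
  split; auto. split; auto. split; auto. split; auto. split; [exact a3|]. split; [exact b3|]. split; [exact a4|]. split; [exact b4|].
  intro e. apply (Phi_inj N L Hpos Nw_inv Lw_log_monomial chart_good chart_good_near_axes (1/2)); auto; try lra; [apply hm; lia|apply hm'; lia].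
Qed.

Lemma Rel_unique p P P' : Rel p P -> Rel p P' -> P = P'.
Proof.
  intros h h'. destruct (Rel_meet _ _ _ _ h h') as (K & s & s' & _ & _ & _ & _ & e1 & e2 & e3 & e4 & H).
  apply (iter_f_inj K). rewrite e3, e4. f_equal. apply H. congruence.
Qed.

Lemma Rel_inj p p' P : offax p -> offax p' -> Rel p P -> Rel p' P -> p = p'.
Proof.
  intros ho ho' h h'. destruct (Rel_meet _ _ _ _ h h') as (K & s & s' & w1 & w2 & o1 & o2 & e1 & e2 & e3 & e4 & H).
  apply (iter_mon_inj K); auto. rewrite <- e1, <- e2. f_equal. apply Paff_inj; auto. congruence.
Qed.

Lemma Rel_step p P : Rel p P -> Rel (mon p) (f P).
Proof.
  intros (k & s & hs & ho & e1 & e2). destruct (W_iterate 1 s hs ho) as (a1 & a2 & a3 & a4). simpl in *.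
  exists k, (F s). split; auto. split; auto. rewrite <- !iter_succ_r. simpl. rewrite <- e1, e2. auto.
Qed.

Lemma Rel_base s : W s -> offax s -> Rel (Phi s) (Paff s).
Proof. intros hs ho. exists 0%nat, s. auto. Qed.

Lemma Rel_onS p P : Rel p P -> onS A B Cc D P.
Proof.
  intros (k & s & hs & ho & e1 & e2). rewrite <- (iter_inv f fi fi_f k P), e2.
  apply iter_onS, Paff_onS; auto.
Qed.

Lemma Phi_inverse_at r : 0 < r -> r < 1 -> exists e2 (G : C2 -> C2), 0 < e2 /\
  forall t, axes_nbhd r e2 t -> W (G t) /\ Phi (G t) = t /\ DifC2 VC2 G t.
Proof. exact (Phi_inverse N L Hpos Nw_inv Lw_log_monomial chart_good chart_good_near_axes r). Qed.

Lemma Rel_exists p : Bidisk p -> offax p -> exists P, Rel p P.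
Proof.
  intros hp ho. destruct (Phi_inverse_at (1/2) ltac:(lra) ltac:(lra)) as (e & G & he & HG).
  destruct (iter_monomial_small N p (1/2) e Hpos hp ltac:(lra) he) as [k hk].
  destruct (HG _ hk) as (g1 & g2 & _). exists (iter k fi (Paff (G (iter k mon p)))).
  exists k, (G (iter k mon p)). split; auto. split.
  - apply Phi_offax. rewrite g2. apply iter_monomial_offax; auto.
  - split; auto. apply (iter_inv fi f f_fi).
Qed.

Lemma Bidisk_axis p : Bidisk p -> ~ offax p -> axprod p = 0 /\ W p /\ Phi p = p /\
  forall e, 0 < e -> exists r, 0 < r /\ r < 1 /\ axes_nbhd r e p.
Proof.
  intros [h1 h2] hn. unfold Disk in *.
  assert (e0 : axprod p = 0).
  { unfold axprod. destruct (excluded_middle_informative (fst p = C0)) as [e|e]; [rewrite e, Cabs_C0; ring|].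
    destruct (excluded_middle_informative (snd p = C0)) as [e'|e']; [rewrite e', Cabs_C0; ring|].
    exfalso. apply hn. split; auto. }
  set (r := (1 + Rmax (Cabs (fst p)) (Cabs (snd p))) / 2).
  assert (hr : Cabs (fst p) < r /\ Cabs (snd p) < r /\ 0 < r /\ r < 1).
  { unfold r. pose proof (Rmax_l (Cabs (fst p)) (Cabs (snd p))). pose proof (Rmax_r (Cabs (fst p)) (Cabs (snd p))).
    pose proof (Cabs_ge0 (fst p)). assert (Rmax (Cabs (fst p)) (Cabs (snd p)) < 1) by (apply Rmax_lub_lt; auto). lra. }
  destruct hr as (r1 & r2 & r3 & r4).
  assert (hW : W p).
  { exists r. split; auto. split; auto. destruct (lin_radius_good N L Hpos Nw_inv Lw_log_monomial chart_good chart_good_near_axes r r3 r4) as (he & _).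
    repeat split; auto. rewrite e0; auto. }
  split; auto. split; auto. split; [exact (Phi_axis N L Hpos Nw_inv Lw_log_monomial chart_good chart_good_near_axes p hW e0)|].
  intros e he. exists r. repeat split; auto. rewrite e0; auto.
Qed.

(** On the axes, where [f] cannot be inverted, the value is that of the chart, in agreement with
    [Phi0] being the identity there. *)
Definition Psi (p : C2) : C4 :=
  if excluded_middle_informative (offax p) then lift3 (epsilon (inhabits (C0, C0, C0)) (Rel p)) else Pi4 p.

Lemma Psi_Rel p P : offax p -> Rel p P -> Psi p = lift3 P.
Proof.
  intros ho h. unfold Psi. destruct (excluded_middle_informative (offax p)) as [_|]; [|contradiction].
  f_equal. apply (Rel_unique p); auto. apply epsilon_spec. exists P; auto.
Qed.

Lemma Psi_axis p : ~ offax p -> Psi p = Pi4 p.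
Proof. intro h. unfold Psi. destruct (excluded_middle_informative (offax p)); [contradiction|reflexivity]. Qed.

Lemma Pi4_neq0 s : W s -> Pi4 s <> zero4.
Proof. intro h. destruct (W_good _ h) as (_ & _ & _ & hX & _). apply cpl4_neq0; auto. Qed.

(** The two cases of the definition fit together: on all of [W] the class of [Psi] is the chart
    composed with the inverse of [Phi], hence regular across the axes. *)
Lemma Psi_Phi s : W s -> peq (Psi (Phi s)) (Pi4 s).
Proof.
  intro hs. destruct (excluded_middle_informative (offax s)) as [ho|hn].
  - rewrite (Psi_Rel _ (Paff s)); [|apply Phi_offax; auto|apply Rel_base; auto].
    apply peq_sym, peq_lift_Paff; auto.
  - destruct (W_good _ hs) as (_ & l1 & l2 & _). destruct (Bidisk_axis s (conj l1 l2) hn) as (_ & _ & e & _).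
    rewrite e, Psi_axis by auto. apply peq_refl, Pi4_neq0; auto.
Qed.

Lemma Psi_onbarS p : Bidisk p -> onbarS A B Cc D (Psi p).
Proof.
  intro hp. destruct (excluded_middle_informative (offax p)) as [ho|hn].
  - destruct (Rel_exists p hp ho) as [P hP]. rewrite (Psi_Rel p P) by auto. apply onbarS_lift3. apply (Rel_onS p); auto.
  - destruct (Bidisk_axis p hp hn) as (_ & hW & _). rewrite Psi_axis by auto. apply Pi4_onbarS.
    destruct (W_good _ hW) as (_ & _ & _ & hX & _). exact hX.
Qed.

Lemma onbarS_neq0 q : onbarS A B Cc D q -> q <> zero4.
Proof. destruct q as [[[? ?] ?] ?]. intros [h _]. exact h. Qed.

Lemma Psi_neq0 p : Bidisk p -> Psi p <> zero4.
Proof. intro h. apply onbarS_neq0, Psi_onbarS; auto. Qed.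

Lemma coord3_Pi4 s : coord 3 (Pi4 s) = (- (fst s * snd s))%cc.
Proof. apply coord3_cpl4. Qed.

Lemma coord3_lift3 P : coord 3 (lift3 P) = C1.
Proof. destruct P as [[? ?] ?]. reflexivity. Qed.

Lemma coord3_axis s : ~ offax s -> coord 3 (Pi4 s) = C0.
Proof.
  intro h. rewrite coord3_Pi4. destruct (excluded_middle_informative (fst s = C0)) as [e|e]; [rewrite e; ring|].
  destruct (excluded_middle_informative (snd s = C0)) as [e'|e']; [rewrite e'; ring|].
  exfalso. apply h. split; auto.
Qed.

Lemma lidx_lt4 : (lidx c < 4)%nat.
Proof. destruct c; simpl; lia. Qed.

Lemma coord_Pi4 s : W s -> coord (lidx c) (Pi4 s) <> C0.
Proof. intro h. unfold proj_pt. rewrite coordj_cpl4. apply (W_good _ h). Qed.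

Lemma Pi4_inj s s' : W s -> W s' -> peq (Pi4 s) (Pi4 s') -> s = s'.
Proof.
  intros h h' e. destruct (W_good _ h) as (_ & a1 & a2 & a3 & _). destruct (W_good _ h') as (_ & b1 & b2 & b3 & _).
  destruct (kap_Pi4 A B Cc D c s a1 a2 a3) as (_ & _ & _ & <-).
  destruct (kap_Pi4 A B Cc D c s' b1 b2 b3) as (_ & _ & _ & <-).
  f_equal. symmetry. apply peq_chart; auto using lidx_lt4, coord_Pi4.
Qed.

Lemma Psi_inj p p' : Bidisk p -> Bidisk p' -> peq (Psi p) (Psi p') -> p = p'.
Proof.
  assert (mix : forall p p', Bidisk p -> offax p -> ~ offax p' -> ~ peq (Psi p) (Psi p')).
  { intros q q' hq ho hn e. destruct (Rel_exists q hq ho) as [P hP]. rewrite (Psi_Rel q P), (Psi_axis q') in e by auto.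
    apply (peq_coord 3) in e; [|lia|rewrite coord3_lift3; apply C1_neq0]. apply e, coord3_axis; auto. }
  intros hp hp' e.
  destruct (excluded_middle_informative (offax p)) as [ho|hn]; destruct (excluded_middle_informative (offax p')) as [ho'|hn'].
  - destruct (Rel_exists p hp ho) as [P hP]. destruct (Rel_exists p' hp' ho') as [P' hP'].
    rewrite (Psi_Rel p P), (Psi_Rel p' P') in e by auto. apply peq_lift3_inj in e. subst P'. apply (Rel_inj p p' P); auto.
  - exfalso. apply (mix p p'); auto.
  - exfalso. apply (mix p' p); auto. apply peq_sym; auto.
  - rewrite !Psi_axis in e by auto. apply Pi4_inj; auto; [apply (Bidisk_axis p hp hn)|apply (Bidisk_axis p' hp' hn')].
Qed.

(** ** Local lifts of [Psi] *)

Lemma Dif2_Xj s : 0 < fst (Deltaj A B Cc D c s) -> Dif2 (X_at A B Cc D c) s.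
Proof.
  intro h. unfold X_at, Xf, Deltaf, S0f, Rf. pose proof (Dif2_fst s) as d1. pose proof (Dif2_snd s) as d2.
  assert (poly : forall a b c' d, Dif2 (Rf a b c' d) s /\ Dif2 S0f s).
  { intros a b c' d. unfold Rf, S0f.
    split; repeat first [apply (Dif_const VC2) | exact d1 | exact d2
      | apply (Dif_sub VC2) | apply (Dif_add VC2) | apply (Dif_mul VC2)]. }
  destruct (poly (param_at A B Cc c) (param_at A B Cc (o1 c)) (param_at A B Cc (o2 c)) D) as [dR dS].
  assert (dD : Dif2 (Deltaf (param_at A B Cc c) (param_at A B Cc (o1 c)) (param_at A B Cc (o2 c)) D) s).
  { apply (Dif_sqrt VC2 (fun s => S0f s * S0f s + fst s * snd s * Rf (param_at A B Cc c) (param_at A B Cc (o1 c)) (param_at A B Cc (o2 c)) D s)%cc); [exact h|].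
    apply (Dif_add VC2); [exact (Dif_mul VC2 _ _ _ dS dS)|].
    apply (Dif_mul VC2 (fun s => fst s * snd s)%cc); [exact (Dif2_mul s)|exact dR]. }
  apply (Dif_mul VC2 _ (fun _ => Cinv 2)); [|apply (Dif_const VC2)].
  apply (Dif_add VC2); [|exact dD].
  repeat first [apply (Dif_const VC2) | exact d1 | exact d2 | apply (Dif_sub VC2) | apply (Dif_add VC2) | apply (Dif_mul VC2)].
Qed.

Lemma Dif_coord_Pi4 (V : nspace) (G : V -> C2) p i : W (G p) -> DifC2 V G p -> Dif V (fun x => coord i (Pi4 (G x))) p.
Proof.
  intros hW [g1 g2]. destruct (W_good _ hW) as (_ & _ & _ & _ & hD).
  assert (dX : Dif V (fun x => X_at A B Cc D c (G x)) p).
  { apply (Dif_ext V (fun x => X_at A B Cc D c (fst (G x), snd (G x)))); [intro x; rewrite <- surjective_pairing; auto|].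
    apply (Dif_comp2 V (X_at A B Cc D c)); auto. rewrite <- surjective_pairing. apply Dif2_Xj; auto. }
  set (X := fun x => X_at A B Cc D c (G x)) in *. set (u := fun x => fst (G x)) in *. set (v := fun x => snd (G x)) in *.
  assert (d1 : Dif V (fun x => v x * (1 + u x * u x))%cc p).
  { apply Dif_mul; auto. apply (Dif_add V (fun _ => C1)); [apply Dif_const|apply Dif_mul; auto]. }
  assert (d2 : Dif V (fun x => u x * (1 + v x * v x))%cc p).
  { apply Dif_mul; auto. apply (Dif_add V (fun _ => C1)); [apply Dif_const|apply Dif_mul; auto]. }
  assert (d3 : Dif V (fun x => - (u x * v x))%cc p) by (apply Dif_opp, Dif_mul; auto).
  unfold proj_pt, cpl4, c4. destruct c; destruct i as [|[|[|i]]]; simpl coord; assumption.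
Qed.

Lemma DifC3_Paff (V : nspace) (G : V -> C2) p : W (G p) -> offax (G p) -> DifC2 V G p -> DifC3 V (fun x => Paff (G x)) p.
Proof.
  intros hW [o1' o2'] [g1 g2]. destruct (W_good _ hW) as (_ & _ & _ & _ & hD).
  assert (dX : Dif V (fun x => X_at A B Cc D c (G x)) p).
  { apply (Dif_ext V (fun x => X_at A B Cc D c (fst (G x), snd (G x)))); [intro x; rewrite <- surjective_pairing; auto|].
    apply (Dif_comp2 V (X_at A B Cc D c)); auto. rewrite <- surjective_pairing. apply Dif2_Xj; auto. }
  assert (dJ : forall u : V -> CC, u p <> C0 -> Dif V u p -> Dif V (fun x => jouk (u x)) p).
  { intros u hu du. unfold jouk. apply Dif_opp, Dif_div; auto. apply (Dif_add V (fun _ => C1)); [apply Dif_const|apply Dif_mul; auto]. }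
  set (X := fun x => X_at A B Cc D c (G x)) in *. set (u := fun x => fst (G x)) in *. set (v := fun x => snd (G x)) in *.
  assert (d0 : Dif V (fun x => - (X x / (u x * v x)))%cc p).
  { apply Dif_opp, Dif_div; auto; [apply Cmul_neq0; auto|apply Dif_mul; auto]. }
  assert (d1 : Dif V (fun x => jouk (u x)) p) by (apply dJ; auto).
  assert (d2 : Dif V (fun x => jouk (v x)) p) by (apply dJ; auto).
  unfold affine_pt, cpl. destruct c; (split; [|split]); assumption.
Qed.

Lemma Dif_coord_lift3 (V : nspace) (G : V -> C3) p i : DifC3 V G p -> Dif V (fun x => coord i (lift3 (G x))) p.
Proof.
  intros (g1 & g2 & g3).
  apply (Dif_ext V (fun x => coord i (fst (fst (G x)), snd (fst (G x)), snd (G x), C1))).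
  - intro x. destruct (G x) as [[? ?] ?]. reflexivity.
  - destruct i as [|[|[|i]]]; simpl coord; auto. apply Dif_const.
Qed.

Lemma near_offax s : offax s -> near2 s offax.
Proof.
  intros [h1 h2]. exact (near_and VC2 s _ _ (near_neq0 VC2 fst s (Dif2_fst s) h1) (near_neq0 VC2 snd s (Dif2_snd s) h2)).
Qed.

Lemma iter_mon_DifC2 k p : DifC2 VC2 (iter k mon) p.
Proof. apply (iter_DifC2 mon (fun _ => True)); auto. intros; apply monomial_DifC2. Qed.

(** [Psi] changes its normalization at the axes, from [lift3] to [proj_pt], so that only its
    projective class is regular there. A local lift with differentiable coordinates carries the
    regularity. *)
Lemma Psi_local p0 : Bidisk p0 -> exists Lam : C2 -> C4,
  near2 p0 (fun p => peq (Psi p) (Lam p)) /\ forall i, Dif2 (fun p => coord i (Lam p)) p0.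
Proof.
  intro hp. destruct (excluded_middle_informative (offax p0)) as [ho|hn].
  - destruct (Phi_inverse_at (1/2) ltac:(lra) ltac:(lra)) as (e & G & he & HG).
    (* The same [k] serves for all points near [p0], the neighborhood of the axes being open. *)
    destruct (iter_monomial_small N p0 (1/2) e Hpos hp ltac:(lra) he) as [k hk].
    exists (fun p => lift3 (iter k fi (Paff (G (iter k mon p))))). split.
    + assert (N1 : near2 p0 (fun p => axes_nbhd (1/2) e (iter k mon p))).
      { apply (near_comp2 VC2 (iter k mon)); [apply iter_mon_DifC2|apply axes_nbhd_near; [lra|auto]]. }
      eapply near_mono; [|exact (near_and VC2 _ _ _ N1 (near_offax p0 ho))]. cbn beta. intros p [hd ho'].
      destruct (HG _ hd) as (g1 & g2 & _). rewrite (Psi_Rel p (iter k fi (Paff (G (iter k mon p))))); auto.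
      * apply peq_refl, lift3_neq0.
      * exists k, (G (iter k mon p)). split; auto. split; [apply Phi_offax; rewrite g2; apply iter_monomial_offax; auto|].
        split; auto. apply (iter_inv fi f f_fi).
    + intro i. destruct (HG _ hk) as (g1 & g2 & g3).
      apply (Dif_coord_lift3 VC2 (fun p => iter k fi (Paff (G (iter k mon p))))).
      apply (iter_eval_DifC3 A B Cc (rev w) k VC2 (fun p => Paff (G (iter k mon p)))).
      apply (DifC3_Paff VC2 (fun p => G (iter k mon p))); auto.
      * apply Phi_offax. rewrite g2. apply iter_monomial_offax; auto.
      * apply (DifC2_comp2 VC2 G (iter k mon)); auto. apply iter_mon_DifC2.
  - destruct (Bidisk_axis p0 hp hn) as (_ & _ & _ & H).
    destruct (H 1 ltac:(lra)) as (r & h0 & h1 & hd0).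
    destruct (Phi_inverse_at r h0 h1) as (e & G & he & HG).
    assert (hd : axes_nbhd r e p0).
    { destruct (Bidisk_axis p0 hp hn) as (e0 & _). destruct hd0 as (d1 & d2 & _). repeat split; auto. rewrite e0; auto. }
    exists (fun p => Pi4 (G p)). split.
    + eapply near_mono; [|exact (axes_nbhd_near r e p0 ltac:(lra) hd)]. cbn beta. intros p hp'.
      destruct (HG _ hp') as (g1 & g2 & _). rewrite <- g2 at 1. apply Psi_Phi; auto.
    + intro i. destruct (HG _ hd) as (g1 & g2 & g3). apply (Dif_coord_Pi4 VC2 G); auto.
Qed.

Lemma Bidisk_near p : Bidisk p -> near2 p Bidisk.
Proof.
  intros [h1 h2]. unfold Disk in *.
  eapply near_mono; [|exact (near_and VC2 p _ _ (Dif_cont VC2 fst p (1 - Cabs (fst p)) (Dif2_fst p) ltac:(lra))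
     (Dif_cont VC2 snd p (1 - Cabs (snd p)) (Dif2_snd p) ltac:(lra)))].
  cbn beta. intros x [a b]. split; unfold Disk.
  - pose proof (Cabs_tri (fst x - fst p) (fst p)) as t. replace (fst x - fst p + fst p)%cc with (fst x) in t by ring. lra.
  - pose proof (Cabs_tri (snd x - snd p) (snd p)) as t. replace (snd x - snd p + snd p)%cc with (snd x) in t by ring. lra.
Qed.

Lemma Psi_holoP : holoP Bidisk Psi.
Proof.
  split; [intros p hp; exact (Bidisk_near p hp)|].
  split; [exact Psi_neq0|]. intros i hi.
  assert (key : forall p, Bidisk p -> coord i (Psi p) <> C0 ->
    near2 p (fun x => coord i (Psi x) <> C0) /\ forall j, (j < 4)%nat -> Dif2 (fun x => coord j (Psi x) / coord i (Psi x))%cc p).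
  { intros p hp hn. destruct (Psi_local p hp) as (Lam & HN & HD).
    pose proof (near_self VC2 _ _ HN) as e0. cbn beta in e0.
    assert (hl : coord i (Lam p) <> C0) by (apply (peq_coord i (Psi p)); auto).
    pose proof (near_neq0 VC2 (fun x => coord i (Lam x)) p (HD i) hl) as HN2. split.
    - eapply near_mono; [|exact (near_and VC2 _ _ _ HN HN2)]. cbn beta. intros x [a b].
      apply (peq_coord i (Lam x)); auto. apply peq_sym; auto.
    - intros j hj. apply (Dif_ext_near VC2 (fun x => coord j (Lam x) / coord i (Lam x))%cc).
      + eapply near_mono; [|exact (near_and VC2 _ _ _ HN HN2)]. cbn beta. intros x [a b].
        symmetry. apply (peq_ratio i j (Lam x) (Psi x)); auto. apply peq_sym; auto.
      + apply (Dif_div VC2); auto; apply HD. }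
  cbv zeta.
  assert (ho : open2 (fun p => Bidisk p /\ coord i (Psi p) <> C0)).
  { intros p [hp hn]. exact (near_and VC2 p _ _ (Bidisk_near p hp) (proj1 (key p hp hn))). }
  split; auto. intros j hj. apply holo2_of_Dif; auto. intros p [hp hn]. apply key; auto.
Qed.

Lemma Psi_cont p0 eps : Bidisk p0 -> 0 < eps -> near2 p0 (fun p => pdist (Psi p0) (Psi p) < eps).
Proof.
  intros hp he. destruct (Psi_local p0 hp) as (Lam & HN & HD).
  pose proof (near_self VC2 _ _ HN) as e0. cbn beta in e0. pose proof (peq_neq0 _ _ e0) as hl.
  destruct (pdist_close (Lam p0) eps hl he) as (d & hd & H).
  pose proof (fun i => Dif_cont VC2 _ p0 d (HD i) hd) as C.
  pose proof (near_and VC2 _ _ _ (near_and VC2 _ _ _ (C 0%nat) (C 1%nat)) (near_and VC2 _ _ _ (C 2%nat) (C 3%nat))) as NC.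
  eapply near_mono; [|exact (near_and VC2 _ _ _ HN NC)]. cbn beta. intros x [a [[c0 c1] [c2 c3]]].
  assert (e : pdist (Psi p0) (Psi x) = pdist (Lam p0) (Lam x)).
  { rewrite (pdist_peq_l (Psi p0) (Lam p0)) by first [exact e0 | exact (peq_neq0 _ _ a)].
    rewrite (pdist_peq_r (Psi p0) (Psi x) (Lam x)); auto. apply (proj1 e0). }
  rewrite e. apply H. intros k hk. destruct k as [|[|[|[|k]]]]; try lia; auto.
Qed.

(** ** Local holomorphic inverses of [Psi] *)

(** [biholo_onto] asks for an inverse that is the restriction of functions of three variables, so
    [G] lives on an open set of the ambient chart and inverts [Psi] on the surface only. The second
    clause also shows that the image is open in the surface. *)
Definition LocInv (p0 : C2) (i : nat) (G : C3 -> C2) : Prop :=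
  near3 (chart i (Psi p0)) (fun x => DifC2 VC3 G x /\
    forall q, onbarS A B Cc D q -> coord i q <> C0 -> chart i q = x -> Bidisk (G x) /\ peq (Psi (G x)) q).

Lemma kap_chart s0 : W s0 -> kap (chart (lidx c) (Pi4 s0)) = s0 /\
  near3 (chart (lidx c) (Pi4 s0)) (fun x => DifC2 VC3 kap x /\ W (kap x) /\
    forall q, onbarS A B Cc D q -> coord (lidx c) q <> C0 -> chart (lidx c) q = x -> peq (Pi4 (kap x)) q).
Proof.
  intro hW. destruct (W_good _ hW) as (_ & a1 & a2 & a3 & a4).
  destruct (kap_Pi4 A B Cc D c s0 a1 a2 a3) as (_ & _ & _ & ek). split; auto.
  pose proof (kap_near A B Cc D c s0 a1 a2 a3 a4) as HN.
  pose proof (near_self VC3 _ _ HN) as (k1 & k2 & _).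
  assert (N2 : near3 (chart (lidx c) (Pi4 s0)) (fun x => W (kap x))).
  { apply (near_comp2 VC3 kap); [split; auto|]. rewrite ek. apply W_near; auto. }
  eapply near_mono; [|exact (near_and VC3 _ _ _ HN N2)]. cbn beta. intros x [(b1 & b2 & b3) b4].
  split; [split; auto|]. split; auto. intros q hq hn e.
  destruct b3 as [c1 c2]; [rewrite <- e; apply cub_chart; auto|].
  apply (peq_of_chart c); auto; [apply coord_Pi4; auto|congruence].
Qed.

Lemma DifC2_Phi s : W s -> DifC2 VC2 Phi s.
Proof. exact (Dif2_Phi N L Hpos Nw_inv Lw_log_monomial chart_good chart_good_near_axes s). Qed.

Lemma LocInv_axis p0 : Bidisk p0 -> ~ offax p0 -> LocInv p0 (lidx c) (fun x => Phi (kap x)).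
Proof.
  intros hp hn. destruct (Bidisk_axis p0 hp hn) as (_ & hW & eP & _).
  unfold LocInv. rewrite Psi_axis by auto. destruct (kap_chart p0 hW) as [ek HN].
  pose proof (near_self VC3 _ _ HN) as (k1 & k2 & _).
  assert (N2 : near3 (chart (lidx c) (Pi4 p0)) (fun x => Bidisk (Phi (kap x)))).
  { apply (near_comp2 VC3 (fun x => Phi (kap x))).
    - apply (DifC2_comp2 VC3 Phi kap); auto. apply DifC2_Phi; auto.
    - rewrite ek, eP. apply Bidisk_near; auto. }
  eapply near_mono; [|exact (near_and VC3 _ _ _ HN N2)]. cbn beta. intros x [(b1 & b2 & b3) b4].
  split; [apply (DifC2_comp2 VC3 Phi kap); auto; apply DifC2_Phi; auto|].
  intros q hq hc e. split; auto. apply (peq_trans _ (Pi4 (kap x))); [apply Psi_Phi; auto|apply b3; auto].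
Qed.

Lemma DifC3_chart (V : nspace) (G : V -> C3) p : coord (lidx c) (lift3 (G p)) <> C0 -> DifC3 V G p ->
  DifC3 V (fun x => chart (lidx c) (lift3 (G x))) p.
Proof.
  intros hn dG. pose proof (fun i => Dif_coord_lift3 V G p i dG) as d.
  assert (q : forall i, Dif V (fun x => coord i (lift3 (G x)) / coord (lidx c) (lift3 (G x)))%cc p).
  { intro i. apply Dif_div; auto. }
  assert (E : forall x, chart (lidx c) (lift3 (G x)) =
    (coord (lidx (o1 c)) (lift3 (G x)) / coord (lidx c) (lift3 (G x)),
     coord (lidx (o2 c)) (lift3 (G x)) / coord (lidx c) (lift3 (G x)),
     coord 3 (lift3 (G x)) / coord (lidx c) (lift3 (G x)))%cc).
  { intro x. destruct (G x) as [[? ?] ?]. destruct c; reflexivity. }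
  split; [|split].
  - apply (Dif_ext V _ _ p (fun x => eq_sym (f_equal (fun P => fst (fst P)) (E x)))), q.
  - apply (Dif_ext V _ _ p (fun x => eq_sym (f_equal (fun P => snd (fst P)) (E x)))), q.
  - apply (Dif_ext V _ _ p (fun x => eq_sym (f_equal snd (E x)))), q.
Qed.

(** Reads [Rel] backwards: [f^k], then the inverse chart, then [Phi], then the inverse of the
    monomial map on the torus, with the same [k] around the point. *)
Lemma LocInv_offax p0 : Bidisk p0 -> offax p0 -> exists G, LocInv p0 3 G.
Proof.
  intros hp ho. destruct (Rel_exists p0 hp ho) as [P0 hP]. assert (hP' := hP).
  destruct hP' as (k & s0 & hW & hs & e1 & e2).
  set (H := fun x => chart (lidx c) (lift3 (iter k f x))).
  exists (fun x => iter k (moninv N) (Phi (kap (H x)))).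
  unfold LocInv. rewrite (Psi_Rel p0 P0), chart3_lift3 by auto.
  assert (pl : peq (Pi4 s0) (lift3 (iter k f P0))) by (rewrite e2; apply peq_lift_Paff; auto).
  assert (hn : coord (lidx c) (lift3 (iter k f P0)) <> C0).
  { apply (peq_coord _ (Pi4 s0)); auto using lidx_lt4, coord_Pi4. }
  assert (eH : H P0 = chart (lidx c) (Pi4 s0)).
  { unfold H. apply peq_chart; auto using lidx_lt4, coord_Pi4. }
  destruct (kap_chart s0 hW) as [ek HN]. rewrite <- eH in ek, HN.
  assert (Df : forall x, DifC3 VC3 (iter k f) x).
  { intro x. apply (iter_eval_DifC3 A B Cc w k VC3 (fun x => x)). apply DifC3_id. }
  assert (Nn : near3 P0 (fun x => coord (lidx c) (lift3 (iter k f x)) <> C0)).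
  { apply (near_neq0 VC3 (fun x => coord (lidx c) (lift3 (iter k f x)))); auto. apply (Dif_coord_lift3 VC3 (iter k f)); auto. }
  assert (DH : forall x, coord (lidx c) (lift3 (iter k f x)) <> C0 -> DifC3 VC3 H x).
  { intros x hx. apply (DifC3_chart VC3 (iter k f)); auto. }
  pose proof (near_comp3 VC3 H P0 _ (DH P0 hn) HN) as NH. cbn beta in NH.
  pose proof (near_self VC3 _ _ NH) as (k1 & k2 & _).
  assert (DkH : forall x, coord (lidx c) (lift3 (iter k f x)) <> C0 -> DifC2 VC3 kap (H x) -> DifC2 VC3 (fun y => kap (H y)) x).
  { intros x hx hk. apply (DifC2_comp3 VC3 kap H); auto. }
  assert (No : near3 P0 (fun x => offax (kap (H x)))).
  { apply (near_comp2 VC3 (fun x => kap (H x))); auto. rewrite ek. apply near_offax; auto. }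
  assert (DG : forall x, coord (lidx c) (lift3 (iter k f x)) <> C0 -> DifC2 VC3 kap (H x) -> W (kap (H x)) -> offax (kap (H x)) ->
     DifC2 VC3 (fun x => iter k (moninv N) (Phi (kap (H x)))) x).
  { intros x hx hk hw hox. apply (DifC2_comp2 VC3 (iter k (moninv N)) (fun x => Phi (kap (H x)))).
    - apply (iter_DifC2 (moninv N) offax); auto using moninv_offax, moninv_DifC2. apply Phi_offax; auto.
    - apply (DifC2_comp2 VC3 Phi (fun x => kap (H x))); auto. apply DifC2_Phi; auto. }
  assert (eG : iter k (moninv N) (Phi (kap (H P0))) = p0).
  { rewrite ek, e1. apply iter_moninv_l; auto using Nw_inv. }
  assert (Nb : near3 P0 (fun x => Bidisk (iter k (moninv N) (Phi (kap (H x)))))).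
  { apply (near_comp2 VC3 (fun x => iter k (moninv N) (Phi (kap (H x))))).
    - apply DG; auto. rewrite ek; auto.
    - rewrite eG. apply Bidisk_near; auto. }
  eapply near_mono; [|exact (near_and VC3 _ _ _ (near_and VC3 _ _ _ NH Nn) (near_and VC3 _ _ _ No Nb))].
  cbn beta. intros x [[(b1 & b2 & b3) b4] [b5 b6]]. split; [apply DG; auto|].
  intros q hq h3 e. split; auto.
  pose proof (lift3_chart3 q h3) as pq. rewrite e in pq.
  assert (hx : onS A B Cc D x) by (apply onbarS_lift3, (onbarS_peq A B Cc D q); auto).
  assert (hfx : onbarS A B Cc D (lift3 (iter k f x))) by (apply onbarS_lift3, iter_onS; auto).
  pose proof (b3 _ hfx b4 eq_refl) as pp. fold (H x) in pp.
  assert (eP : Paff (kap (H x)) = iter k f x).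
  { apply peq_lift3_inj. apply (peq_trans _ (Pi4 (kap (H x)))); auto. apply peq_sym, peq_lift_Paff; auto. }
  assert (hoG : offax (iter k (moninv N) (Phi (kap (H x))))).
  { apply iter_moninv_offax. apply Phi_offax; auto. }
  rewrite (Psi_Rel _ x); auto.
  - apply peq_sym; auto.
  - exists k, (kap (H x)). split; auto. split; auto. split; auto.
    symmetry. apply iter_moninv_r; auto using Nw_inv. apply Phi_offax; auto.
Qed.

Lemma LocInv_exists p0 : Bidisk p0 -> exists i G, (i < 4)%nat /\ coord i (Psi p0) <> C0 /\ LocInv p0 i G.
Proof.
  intro hp. destruct (excluded_middle_informative (offax p0)) as [ho|hn].
  - destruct (LocInv_offax p0 hp ho) as [G HG]. exists 3%nat, G. split; [lia|]. split; auto.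
    destruct (Rel_exists p0 hp ho) as [P hP]. rewrite (Psi_Rel p0 P) by auto. rewrite coord3_lift3. apply C1_neq0.
  - exists (lidx c), (fun x => Phi (kap x)). split; [apply lidx_lt4|]. split; [|apply LocInv_axis; auto].
    rewrite Psi_axis by auto. apply coord_Pi4. apply (Bidisk_axis p0 hp hn).
Qed.

Definition image_nbhd (q : C4) : Prop := onbarS A B Cc D q /\ exists p, Bidisk p /\ peq (Psi p) q.

Lemma near_of_pdist p0 q0 i (Q : C3 -> Prop) : (i < 4)%nat -> coord i (Psi p0) <> C0 -> peq (Psi p0) q0 ->
  near3 (chart i (Psi p0)) Q ->
  exists r, 0 < r /\ forall q, onbarS A B Cc D q -> pdist q0 q < r -> coord i q <> C0 /\ Q (chart i q).
Proof.
  intros hi hn e HN.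
  assert (hn' : coord i q0 <> C0) by (apply (peq_coord i (Psi p0)); auto).
  rewrite <- (peq_chart i _ _ hi e hn) in HN. apply near3_ball in HN. destruct HN as (r & hr & H).
  destruct (pdist_chart i q0 r hi hn' hr) as (d & hd & H'). exists d. split; auto.
  intros q hq hqd. destruct (H' q (onbarS_neq0 q hq) hqd) as [g1 g2]. split; auto.
Qed.

Lemma Psi_biholo : biholo_onto A B Cc D Psi image_nbhd.
Proof.
  split; [intros q h; apply h|]. split; [|split; [exact Psi_holoP|split; [|split; [exact Psi_inj|]]]].
  - intros q (hq & p0 & hp & e). destruct (LocInv_exists p0 hp) as (i & G & hi & hn & HG).
    destruct (near_of_pdist p0 q i _ hi hn e HG) as (r & hr & H). exists r. split; auto.
    intros q' hq' hd. destruct (H q' hq' hd) as [h1 [_ h2]]. split; auto.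
    exists (G (chart i q')). apply h2; auto.
  - intros p hp. split; [apply Psi_onbarS; auto|]. exists p. split; auto. apply peq_refl, Psi_neq0; auto.
  - set (Ph := fun q => epsilon (inhabits (C0, C0)) (fun p => Bidisk p /\ peq (Psi p) q)).
    assert (HPh : forall q, image_nbhd q -> Bidisk (Ph q) /\ peq (Psi (Ph q)) q).
    { intros q (_ & hex). exact (epsilon_spec _ (fun p => Bidisk p /\ peq (Psi p) q) hex). }
    exists Ph. split; auto. intros q hU. assert (hU' := hU). destruct hU' as (hq & p0 & hp & e).
    destruct (LocInv_exists p0 hp) as (i & G & hi & hn & HG).
    exists i. split; auto. split; [apply (peq_coord i (Psi p0)); auto|].
    unfold LocInv in HG. rewrite <- (peq_chart i _ _ hi e hn) in HG. apply near3_ball in HG. destruct HG as (r & hr & H).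
    exists r. split; auto. exists (fun x => fst (G x)), (fun x => snd (G x)).
    split; [|split].
    + apply holo3_of_Dif; [apply open3_ball|]. intros x hx. apply (H x hx).
    + apply holo3_of_Dif; [apply open3_ball|]. intros x hx. apply (H x hx).
    + intros q' hU' hc' hd. destruct (H _ hd) as [_ H']. destruct hU' as (hq' & hex).
      destruct (H' q' hq' hc' eq_refl) as [h1 h2]. destruct (HPh q' (conj hq' hex)) as [h3 h4].
      rewrite <- surjective_pairing. apply Psi_inj; auto. apply (peq_trans _ q'); auto. apply peq_sym; auto.
Qed.

(** * The conjugacy equation and the indeterminacy of the inverse *)

Lemma LocInv_center p0 i G : Bidisk p0 -> (i < 4)%nat -> coord i (Psi p0) <> C0 -> LocInv p0 i G -> G (chart i (Psi p0)) = p0.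
Proof.
  intros hp hi hn HG. destruct (near_self VC3 _ _ HG) as [_ H].
  destruct (H (Psi p0) (Psi_onbarS p0 hp) hn eq_refl) as [h1 h2]. apply Psi_inj; auto.
Qed.

(** The value of the extension is a limit along finite points of the surface. Near [Psi p] these are
    images of points off the axes, where the equation is [Rel_step]; continuity of [Psi] at [mon p]
    then gives the limit. *)
Lemma Psi_conj p : Bidisk p -> ext_val A B Cc D f (Psi p) (Psi (mon p)).
Proof.
  intro hp. split; [apply Psi_onbarS; auto|]. split; [apply Psi_neq0, monomial_Bidisk; auto|].
  intros eps he. destruct (LocInv_exists p hp) as (i & G & hi & hn & HG).
  pose proof (LocInv_center p i G hp hi hn HG) as eG.
  destruct (near_self VC3 _ _ HG) as [dG _].
  assert (NC : near3 (chart i (Psi p)) (fun x => pdist (Psi (mon p)) (Psi (mon (G x))) < eps)).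
  { apply (near_comp2 VC3 (fun x => mon (G x)) _ (fun y => pdist (Psi (mon p)) (Psi y) < eps)).
    - apply (DifC2_comp2 VC3 mon G); auto. apply monomial_DifC2.
    - rewrite eG. apply Psi_cont; auto. apply monomial_Bidisk; auto. }
  destruct (near_of_pdist p (Psi p) i _ hi hn (peq_refl _ (Psi_neq0 p hp)) (near_and VC3 _ _ _ HG NC)) as (r & hr & H).
  exists r. split; auto. intros P' hP' hd.
  destruct (H (lift3 P') (proj2 (onbarS_lift3 A B Cc D P') hP') hd) as [h1 [[_ h2] h3]].
  destruct (h2 _ (proj2 (onbarS_lift3 A B Cc D P') hP') h1 eq_refl) as [h4 h5].
  set (p' := G (chart i (lift3 P'))) in *.
  assert (ho : offax p').
  { apply NNPP. intro hno. apply peq_sym in h5. rewrite Psi_axis in h5 by auto.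
    apply (peq_coord 3) in h5; [|lia|rewrite coord3_lift3; apply C1_neq0]. apply h5, coord3_axis; auto. }
  destruct (Rel_exists p' h4 ho) as [P'' hP'']. rewrite (Psi_Rel p' P'') in h5 by auto. apply peq_lift3_inj in h5. subst P''.
  rewrite (Psi_Rel (mon p') (f P')) in h3; auto using monomial_offax, Rel_step.
Qed.

Lemma mon_axis p : ~ offax p -> mon p = (C0, C0).
Proof.
  intro hn. destruct N as [[[a b] c'] d]. simpl in Hpos. unfold monomial.
  assert (z : forall x y, (0 < x)%Z -> (0 < y)%Z -> (Cpow (fst p) (Z.to_nat x) * Cpow (snd p) (Z.to_nat y) = 0)%cc).
  { intros x y hx hy. destruct (excluded_middle_informative (fst p = C0)) as [e|e].
    - rewrite e, Cpow_0_l by lia. ring.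
    - destruct (excluded_middle_informative (snd p = C0)) as [e'|e'].
      + rewrite e', (Cpow_0_l (Z.to_nat y)) by lia. ring.
      + exfalso. apply hn. split; auto. }
  rewrite !z by lia. reflexivity.
Qed.

Lemma Bidisk_half : Bidisk (CR (1/2), C0) /\ Bidisk (C0, CR (1/2)) /\ Bidisk (C0, C0).
Proof.
  unfold Bidisk, Disk; cbn [fst snd]. rewrite Cabs_CR, Cabs_C0, Rabs_right by lra. lra.
Qed.

(* Near the vertex, [fi] takes values close to every point of the two axes. *)
Lemma fi_limit_axis p0 p : Bidisk p0 -> ~ offax p0 -> ext_val A B Cc D fi (Psi (C0, C0)) p -> peq p (Psi p0).
Proof.
  intros hp hn (_ & hpn & H). apply peq_limit; auto; [apply Psi_neq0; auto|]. intros eps he.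
  destruct (H eps he) as (d & hd & H').
  assert (N1 : near2 p0 (fun x => pdist (Psi (C0, C0)) (Psi (mon x)) < d)).
  { apply (near_comp2 VC2 mon p0 (fun y => pdist (Psi (C0, C0)) (Psi y) < d)); [apply monomial_DifC2|].
    rewrite mon_axis by auto. apply Psi_cont; auto. apply Bidisk_half. }
  destruct (near_and VC2 _ _ _ (near_and VC2 _ _ _ N1 (Psi_cont p0 eps hp he)) (Bidisk_near p0 hp)) as (r & hr & N2).
  set (t := CR (Rmin r 1 / 4)).
  assert (ht : 0 < Rmin r 1) by (apply Rmin_pos; lra). pose proof (Rmin_l r 1).
  assert (at' : Cabs t = Rmin r 1 / 4) by (unfold t; rewrite Cabs_CR, Rabs_right; lra).
  assert (tn : t <> C0) by (apply Cabs_neq0; lra).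
  assert (hx : exists x, n2 x < r /\ offax (add2 p0 x)).
  { exists (if excluded_middle_informative (fst p0 = C0) then t else C0, if excluded_middle_informative (snd p0 = C0) then t else C0).
    unfold n2, offax, add2; cbn [fst snd].
    destruct (excluded_middle_informative (fst p0 = C0)) as [e1|e1]; destruct (excluded_middle_informative (snd p0 = C0)) as [e2|e2];
      rewrite ?Cabs_C0, ?at', ?e1, ?e2; (split; [lra|]);
      replace (0 + t)%cc with t by ring; split; auto;
      match goal with |- (?z + 0)%cc <> _ => replace (z + 0)%cc with z by ring; auto end. }
  destruct hx as (x & hx & ho). destruct (N2 x hx) as [[n1 n3] n4]. simpl vadd in n1, n3, n4.
  destruct (Rel_exists _ n4 ho) as [P hP].
  exists (Psi (add2 p0 x)). split; [apply Psi_neq0; auto|]. split; auto.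
  rewrite (Psi_Rel _ P) by auto. rewrite <- (fi_f P). apply H'.
  - apply eval_word_onS, (Rel_onS _ _ hP).
  - rewrite <- (Psi_Rel (mon (add2 p0 x)) (f P)); auto using monomial_offax, Rel_step.
Qed.

(** A value at the vertex would equal both [Psi (1/2, 0)] and [Psi (0, 1/2)], against the
    injectivity of [Psi]. *)
Lemma Ind_vertex : Ind A B Cc D fi (Psi (C0, C0)).
Proof.
  destruct Bidisk_half as (b1 & b2 & b0).
  split; [apply Psi_onbarS; auto|]. intros (p & hp).
  assert (n1 : ~ offax (CR (1/2), C0)) by (intros [_ h]; apply h; reflexivity).
  assert (n2' : ~ offax (C0, CR (1/2))) by (intros [h _]; apply h; reflexivity).
  pose proof (fi_limit_axis _ p b1 n1 hp) as e1. pose proof (fi_limit_axis _ p b2 n2' hp) as e2.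
  assert (e : (CR (1/2), C0) = (C0, CR (1/2))).
  { apply Psi_inj; auto. apply (peq_trans _ p); auto. apply peq_sym; auto. }
  apply (f_equal (fun x : C2 => fst (fst x))) in e. simpl in e. lra.
Qed.

End Conjugacy.

Theorem theorem3p1 (A B Cc D : CC) (w : list letter) (vplus : C4) :
  alg_stable w ->
  onbarS A B Cc D vplus ->
  (forall q, Ind A B Cc D (eval_word A B Cc (rev w)) q <-> (onbarS A B Cc D q /\ peq vplus q)) ->
  exists N : Mat2,
    inGL2Z N /\ positive_entries N /\ conj_PGL N (M_word w) /\
    exists (U : C4 -> Prop) (Psi : C2 -> C4),
      biholo_onto A B Cc D Psi U /\
      peq (Psi (C0, C0)) vplus /\
      forall p, Bidisk p ->
        ext_val A B Cc D (eval_word A B Cc w) (Psi p) (Psi (monomial N p)).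
Proof.
  intros (_ & (hne & hadj & hcyc) & hx & hy & hz) _ hInd.
  (* Source and image then lie in the same chart, and cyclic reducedness says that the last letter
     differs from [c]; it applies because three letters occur, so the word has length at least
     two. *)
  set (c := nth 0 w Lx).
  assert (hlen : (2 <= length w)%nat).
  { destruct w as [|i [|j v]]; simpl; try lia; [destruct hx|].
    destruct hx as [e|[]]. destruct hy as [e'|[]]. congruence. }
  assert (hc : chart_of c w = c) by (unfold c; destruct w; [congruence|reflexivity]).
  assert (hred : reduced_from c w).
  { apply reduced_from_nth; auto. intros _ e. apply (hcyc hlen). symmetry; exact e. }
  assert (hpos : positive_entries (Nw c w)) by (apply Nw_positive; auto).
  exists (Nw c w). split; [apply Nw_det; auto|]. split; auto. split; [apply Nw_conj; auto|].
  exists (image_nbhd A B Cc D c w), (Psi A B Cc D c w).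
  split; [apply Psi_biholo; auto|]. split.
  (* [vplus] is known only as the unique indeterminacy point of the inverse, so it is enough that
     the center of the chart is one. *)
  - apply peq_sym. apply (hInd (Psi A B Cc D c w (C0, C0))). apply Ind_vertex; auto.
  - intros p hp. apply Psi_conj; auto.
Qed.
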